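(* Let $I\subset\mathbb{R}$ be an open interval and let $\varphi:I\to\mathbb{R}$ be a smooth convex function such that $\varphi''>0$ on $I$ and $-1/\varphi''$ is convex on $I$. Then for every $t\geq0$, every $\mathbf{x}\in\mathbb{H}$, and every $f\in\mathcal{C}^\infty_c(\mathbb{H},I)$, $$P_t(\varphi(f))(\mathbf{x})-\varphi(P_tf(\mathbf{x}))\leq C_1^2\,t\,P_t\big(\varphi''(f)\,|\nabla f|^2\big)(\mathbf{x}).$$
   Context: $\mathbb{H}=\mathbb{R}^3$ is the Heisenberg group with product $(x,y,z)\bullet(x',y',z')=(x+x',y+y',z+z'+\tfrac12(xy'-yx'))$. $\mathcal{C}^\infty_c(\mathbb{H},I)$ denotes the class of smooth compactly supported functions on $\mathbb{H}$ with values in $I$. The left-invariant vector fields are $X=\partial_x-\tfrac y2\partial_z$, $Y=\partial_y+\tfrac x2\partial_z$. Put $L=X^2+Y^2$ and $|\nabla f|=\sqrt{(Xf)^2+(Yf)^2}$. The heat semigroup $(P_t)_{t\ge0}=(e^{tL})_{t\geq 0}$ is given by $P_0=\mathrm{Id}$ and, for $t>0$, $P_tf(\mathbf{x})=\int_{\mathbb{R}^3}f(\mathbf{x}\bullet\mathbf{y})\,p_t(\mathbf{y})\,d\mathbf{y}$ ($d\mathbf y$ Lebesgue measure), where, with $r^2=x^2+y^2$, $$p_t(x,y,z)=\frac1{8\pi^2}\int_{-\infty}^{+\infty}e^{i\lambda z}\frac{\lambda}{\sinh\lambda t}\exp\!\Big(-\frac{r^2}{4}\lambda\coth(\lambda t)\Big)d\lambda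 .$$ $C_1$ denotes the smallest constant such that $|\nabla P_tf|\leq C_1P_t(|\nabla f|)$ pointwise for all $t\geq0$ and all smooth $f:\mathbb{H}\to\mathbb{R}$ whose partial derivatives all have polynomial growth; such a finite positive constant exists (H.-Q. Li's gradient bound). *)

(* Defs.v *)
From HB Require Import structures.
From mathcomp Require Import all_boot all_order all_algebra.
From mathcomp Require Import all_classical all_reals all_analysis.

Set Implicit Arguments.
Unset Strict Implicit.
Unset Printing Implicit Defensive.

Import Order.TTheory GRing.Theory Num.Theory.
Import numFieldNormedType.Exports.

Local Open Scope classical_set_scope.
Local Open Scope ring_scope.

(* The point (x, y, z) has coordinates p.1.1, p.1.2, p.2.  A notation rather
   than a definition, so that the normed-module, topological and measurable
   structures of the product are found directly. *)
Notation heis R := ((R * R * R)%type) (only parsing).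

Section product_sigma_finite.
Local Open Scope ereal_scope.
Context d1 d2 (T1 : measurableType d1) (T2 : measurableType d2) (R : realType).
Variable m1 : {sigma_finite_measure set T1 -> \bar R}.
Variable m2 : {sigma_finite_measure set T2 -> \bar R}.

Lemma product_measure1_sigma_finite : sigma_finite setT (m1 \x m2).
Proof.
have /sigma_finiteP[F [TF ndF Foo]] := sigma_finiteT m1.
have /sigma_finiteP[G [TG ndG Goo]] := sigma_finiteT m2.
exists (fun n => F n `*` G n).
  rewrite -setXTT TF TG predeqE => -[x y]; split.
    move=> [/= [n _ Fnx] [k _ Gky]]; exists (maxn n k) => //; split.
    - by move: x Fnx; exact/subsetPset/ndF/leq_maxl.
    - by move: y Gky; exact/subsetPset/ndG/leq_maxr.
  by move=> [n _ []/= ? ?]; split; exists n.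
move=> k; have [? ?] := Foo k; have [? ?] := Goo k.
split; first exact: measurableX.
by rewrite product_measure1E// lte_mul_pinfty// ge0_fin_numE.
Qed.
End product_sigma_finite.

(* Lebesgue measure on R^2 and R^3.  The sigma-finite instances are declared by
   hand: for a product measure the library infers them only when both factors
   are sub-probabilities. *)
Section lebesgue_product.
Context {R : realType}.

Definition leb2 := (@lebesgue_measure R \x @lebesgue_measure R)%E.

HB.instance Definition _ := Measure.on leb2.

HB.instance Definition _ := Measure_isSigmaFinite.Build _ _ _ leb2
  (product_measure1_sigma_finite _ _).

Definition heis_leb := (leb2 \x @lebesgue_measure R)%E.

HB.instance Definition _ := Measure.on heis_leb.

HB.instance Definition _ := Measure_isSigmaFinite.Build _ _ _ heis_leb
  (product_measure1_sigma_finite _ _).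

End lebesgue_product.

Section Heisenberg.
Context {R : realType}.
Implicit Types (f : heis R -> R) (p q : heis R) (t : R).

Definition heis_mul p q : heis R :=
  (p.1.1 + q.1.1, p.1.2 + q.1.2,
   p.2 + q.2 + 2^-1 * (p.1.1 * q.1.2 - p.1.2 * q.1.1)).

Definition heis_basis (i : 'I_3) : heis R :=
  ((i == 0 :> nat)%:R, (i == 1 :> nat)%:R, (i == 2 :> nat)%:R).

Definition partial (i : 'I_3) f : heis R -> R :=
  fun p => 'D_(heis_basis i) f p.

(* Iterated partial derivative: partials [:: i1; ...; ik] f is
   d_i1 (... (d_ik f)). *)
Definition partials (s : seq 'I_3) f : heis R -> R := foldr partial f s.

Definition smooth f := forall s p, differentiable (partials s f) p.

(* `|p| is the sup norm on the product; all norms are equivalent here. *)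
Definition poly_growth f :=
  exists (C : R) (k : nat), forall p, `|f p| <= C * (1 + `|p|) ^+ k.

Definition smooth_poly_growth f :=
  smooth f /\ forall s, poly_growth (partials s f).

Definition Cc_infty (I : set R) f :=
  [/\ smooth f, compact (closure [set p | f p != 0]) & forall p, I (f p)].

Definition fieldX f p : R :=
  'D_((1, 0, 0) : heis R) f p - p.1.2 / 2 * 'D_((0, 0, 1) : heis R) f p.

Definition fieldY f p : R :=
  'D_((0, 1, 0) : heis R) f p + p.1.1 / 2 * 'D_((0, 0, 1) : heis R) f p.

Definition grad_norm f p : R :=
  Num.sqrt (fieldX f p ^+ 2 + fieldY f p ^+ 2).

Definition sinh (u : R) : R := (expR u - expR (- u)) / 2.
Definition cosh (u : R) : R := (expR u + expR (- u)) / 2.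
Definition coth (u : R) : R := cosh u / sinh u.

(* The oscillating factor e^{i l z} is represented by its real part: the
   remaining factors are real and even in l, so the integral of the imaginary
   part sin (l z) vanishes.  The integrand is 0/0 at l = 0 only, a null set. *)
Definition heat_kernel t p : R :=
  (8 * pi ^+ 2)^-1 *
  \int[@lebesgue_measure R]_l
    (cos (l * p.2) * (l / sinh (l * t)) *
     expR (- ((p.1.1 ^+ 2 + p.1.2 ^+ 2) / 4 * (l * coth (l * t))))).

Definition heat_semigroup t f p : R :=
  if t == 0 then f p
  else \int[heis_leb]_q (f (heis_mul p q) * heat_kernel t q).

Definition gradient_bound (C : R) :=
  forall t f p, 0 <= t -> smooth_poly_growth f ->
    grad_norm (heat_semigroup t f) p <= C * heat_semigroup t (grad_norm f) p.

Definition smallest_gradient_constant (C : R) :=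
  gradient_bound C /\ forall C', gradient_bound C' -> C <= C'.

Definition smooth_on (I : set R) (phi : R -> R) :=
  forall n u, I u -> derivable (derive1n n phi) u 1.

End Heisenberg.

(* Main.v *)
Require Import Defs.
From HB Require Import structures.
From mathcomp Require Import all_boot all_order all_algebra.
From mathcomp Require Import all_classical all_reals all_analysis.
From mathcomp Require Import measurable_realfun gauss_integral ring lra.
Import Order.TTheory GRing.Theory Num.Theory.
Import numFieldNormedType.Exports.
Local Open Scope classical_set_scope.
Local Open Scope ring_scope.

(* For s in [0, t] put
     w(s, p) = P_s(phi(f))(p) - phi(P_s f(p)) - C1 ^ 2 s P_s(h)(p),
   with h = phi''(f) |grad f| ^ 2.  Since P_s(phi(f)), P_s f and P_s(h) solve the
   heat equation,
     (d/ds - L) w = phi''(P_s f) |grad P_s f| ^ 2 - C1 ^ 2 P_s(h).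
   The gradient bound gives |grad P_s f| <= C1 P_s |grad f|, and convexity of
   -1/phi'' makes (u, v) |-> phi''(u) v ^ 2 jointly convex, so by Jensen's
   inequality phi''(P_s f) (P_s |grad f|) ^ 2 <= P_s(h).  Hence w is a bounded
   subsolution with w(0, .) = 0, and the weak maximum principle yields w <= 0.
   The semigroup law is never used; what is needed of the kernel is that it is a
   probability density and solves the heat equation.  Nonnegativity is read off
   the gradient bound at the origin, applied to bump functions: if the kernel
   were negative near q, a bump supported there would make P_1 |grad f|
   negative.  The total mass is computed by integrating first in z, with Abel
   regularization, which leaves a Gaussian in (x, y). *)

(** * Integration on the Heisenberg group *)

(** The proof works with two forms of [P_s], each good where the other fails. For [s > 0], moving
    the translation onto the kernel and unfolding the frequency integral gives one integral [Phi]
    over pairs (q, l). Every derivative then falls on an explicit elementary integrand, so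
    boundedness, measurability and bounded support of the data suffice, and no smoothness of
    [phi''(f) |grad f| ^ 2] has to be established. These bounds blow up as [s] tends to 0. There the
    dilated form takes over: the time-1 kernel stays fixed and dominated convergence gives
    continuity on the whole time interval. It presupposes an integrable time-1 kernel, which the
    oscillating integral does not show; integrability comes from nonnegativity and monotone
    convergence, so the sign of the kernel must be settled before its mass. The field X is constant
    along each straight line [p + e *: vX p], and likewise Y, so [X ^ 2] and [Y ^ 2] are ordinary
    second derivatives along lines and all the analysis is one-variable calculus. Since [phi(f)] has
    no bounded support, [phi(f) - phi(0)] is used instead; total mass 1 restores the constant. *)

Section affine_substitution.
Context {R : realType}.
Local Notation mu := (@lebesgue_measure R).
Local Open Scope ereal_scope.

Lemma measurable_affine (a b : R) :
  measurable_fun [set: R] (fun x : R => a * x + b : measurableTypeR R)%R.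
Proof.
apply: measurable_funD => //; apply: measurable_funM => //.
Qed.

(** The pushforward rescaled by [a] gives every half-open interval its length, so by uniqueness it
    is Lebesgue measure. *)
Lemma lebesgue_measure_affine (a b : R) (A : set R) : (0 < a)%R -> measurable A ->
  pushforward mu (fun x : R => a * x + b : measurableTypeR R)%R A =
  (a^-1)%:E * mu A.
Proof.
move=> a0 mA.
have a0' : (0 <= a)%R by exact: ltW.
have mphi := measurable_affine a b.
pose nu := mscale (NngNum a0') (pushforward mu
   (fun x : R => a * x + b : measurableTypeR R)%R).
have -> : mu A = nu mphi A.
  apply: lebesgue_measure_unique => //= _ [[c d] _ <-] /=.
  rewrite /nu /mscale /= /pushforward.
  have -> : (fun x : R => (a * x + b)%R) @^-1` `]c, d]%classic =
      [set` `](c - b) / a, (d - b) / a]%R].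
    apply/seteqP; split => x /=; rewrite !in_itv/=;
    by rewrite ltr_pdivrMr// ler_pdivlMr// ltrBlDr lerBrDr (mulrC x).
  rewrite !lebesgue_measure_itv/= !lte_fin ltr_pM2r ?invr_gt0//.
  rewrite ltrD2r; case: ifPn => cd; last by rewrite mule0.
  rewrite -!EFinB -EFinM; congr EFin; field.
  by rewrite gt_eqF.
rewrite /nu /mscale /= muleA -EFinM mulVf ?gt_eqF// mul1e.
by [].
Qed.

Lemma ge0_integral_affine (a b : R) (f : R -> \bar R) : (0 < a)%R ->
  measurable_fun setT f -> (forall x, 0 <= f x) ->
  \int[mu]_x f (a * x + b)%R = (a^-1)%:E * \int[mu]_x f x.
Proof.
move=> a0 mf f0.
have mphi := measurable_affine a b.
have av0 : (0 <= a^-1)%R by rewrite invr_ge0 ltW.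
transitivity (\int[pushforward mu
    (fun x : R => a * x + b : measurableTypeR R)%R]_x f x).
  by rewrite ge0_integral_pushforward.
rewrite -(ge0_integral_mscale mu measurableT (NngNum av0))//.
apply: eq_measure_integral => A mA _.
exact: lebesgue_measure_affine.
Qed.

End affine_substitution.

Section heis_integral.
Context {R : realType}.
Local Notation mu := (@lebesgue_measure R).
Local Open Scope ereal_scope.
Implicit Types (f : heis R -> \bar R) (p : heis R).

Lemma ge0_integral_heis f : measurable_fun setT f -> (forall p, 0 <= f p) ->
  \int[heis_leb]_p f p = \int[mu]_x \int[mu]_y \int[mu]_z f (x, y, z).
Proof.
move=> mf f0; rewrite fubini_tonelli1//.
rewrite (@fubini_tonelli1 _ _ _ _ _ mu mu (fubini_F mu f))//.
  exact: measurable_fun_fubini_tonelli_F.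
by move=> x; exact: integral_ge0.
Qed.

(* Covers both left translations and dilations of the Heisenberg group. *)
Lemma ge0_integral_heis_triangular (a b c x0 y0 : R) (z0 : R * R -> R) f :
  (0 < a)%R -> (0 < b)%R -> (0 < c)%R -> measurable_fun setT z0 ->
  measurable_fun setT f -> (forall p, 0 <= f p) ->
  \int[heis_leb]_p f (a * p.1.1 + x0, b * p.1.2 + y0, c * p.2 + z0 p.1)%R =
  ((a * b * c)^-1)%:E * \int[heis_leb]_p f p.
Proof.
move=> a0 b0 c0 mz0 mf f0.
have mslice x y : measurable_fun setT (fun z => f (x, y, z)).
  by apply: measurableT_comp => //; exact: measurable_fun_pair.
have mI : measurable_fun setT (fun xy : R * R => \int[mu]_z f (xy, z)).
  exact: (@measurable_fun_fubini_tonelli_F _ _ _ _ _ mu f).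
have mII : measurable_fun setT (fun x : R => \int[mu]_y \int[mu]_z f (x, y, z)).
  apply: (@measurable_fun_fubini_tonelli_F _ _ _ _ _ mu
    (fun xy : R * R => \int[mu]_z f (xy, z))) => // xy.
  exact: integral_ge0.
rewrite !ge0_integral_heis//; last first.
  apply: measurableT_comp => //; apply: measurable_fun_pair.
    apply: measurable_fun_pair.
      apply: measurable_funD => //; apply: measurable_funM => //.
      exact: (measurableT_comp measurable_fst).
    apply: measurable_funD => //; apply: measurable_funM => //.
    exact: (measurableT_comp measurable_snd).
  apply: measurable_funD; first exact: measurable_funM.
  exact: measurableT_comp.
(* The innermost integral goes first: with (x, y) fixed, the shift [z0 (x, y)] is a constant in
   z. *)
transitivity (\int[mu]_x \int[mu]_y ((c^-1)%:E *
    \int[mu]_z f (a * x + x0, b * y + y0, z)%R)).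
  apply: eq_integral => x _; apply: eq_integral => y _.
  by rewrite (@ge0_integral_affine _ c (z0 (x, y))
    (fun z => f (a * x + x0, b * y + y0, z)%R)).
have cv0 (d : R) : (0 < d)%R -> 0 <= (d^-1)%:E.
  by move=> d0; rewrite lee_fin invr_ge0 ltW.
transitivity (\int[mu]_x ((b^-1)%:E * ((c^-1)%:E * \int[mu]_y
    \int[mu]_z f (a * x + x0, y, z)%R))).
  apply: eq_integral => x _.
  have mJ : measurable_fun setT
      (fun y : R => \int[mu]_z f ((a * x + x0)%R, y, z)).
    by apply: (measurableT_comp mI); exact: measurable_fun_pair.
  rewrite ge0_integralZl//; last 3 first.
  - exact: (measurableT_comp mJ (measurable_affine b y0)).
  - by move=> y _; exact: integral_ge0.
  - exact: cv0.
  rewrite (@ge0_integral_affine _ b y0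
    (fun y => \int[mu]_z f ((a * x + x0)%R, y, z)))//.
    by rewrite muleCA.
  by move=> y; exact: integral_ge0.
have h0 x : 0 <= \int[mu]_y \int[mu]_z f (x, y, z).
  by apply: integral_ge0 => y _; exact: integral_ge0.
pose k := ((b^-1)%:E * (c^-1)%:E : \bar R).
have k0 : 0 <= k by rewrite mule_ge0// cv0.
transitivity (\int[mu]_x (k * \int[mu]_y \int[mu]_z f (a * x + x0, y, z)%R)).
  by apply: eq_integral => x _; rewrite muleA.
have mIIa : measurable_fun setT
    (fun x : R => \int[mu]_y \int[mu]_z f ((a * x + x0)%R, y, z)).
  exact: (measurableT_comp mII (measurable_affine a x0)).
transitivity (k * \int[mu]_x \int[mu]_y \int[mu]_z f ((a * x + x0)%R, y, z)).
  apply: ge0_integralZl.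
  - exact: measurableT.
  - exact: mIIa.
  - by move=> x _; exact: h0.
  - exact: k0.
rewrite /k.
rewrite (@ge0_integral_affine _ a x0
  (fun x => \int[mu]_y \int[mu]_z f (x, y, z)))// muleA; congr *%E.
by rewrite -!EFinM; congr EFin; field; rewrite !gt_eqF.
Qed.

(** No integrability is assumed. The positive and negative parts scale by the same finite positive
    factor, which also fixes infinite values, so the convention for divergent integrals agrees on
    both sides. *)
Lemma integral_heis_triangular (a b c x0 y0 : R) (z0 : R * R -> R) (f : heis R -> R) :
  (0 < a)%R -> (0 < b)%R -> (0 < c)%R -> measurable_fun setT z0 ->
  measurable_fun setT f ->
  (\int[heis_leb]_p f (a * p.1.1 + x0, b * p.1.2 + y0, c * p.2 + z0 p.1) =
  (a * b * c)^-1 * \int[heis_leb]_p f p)%R.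
Proof.
move=> a0 b0 c0 mz0 mf.
have /measurable_EFinP mfE := mf.
have k0 : (0 <= (a * b * c)^-1)%R by rewrite invr_ge0 !mulr_ge0// ltW.
rewrite /Rintegral [in LHS]integralE.
have Ep := @ge0_integral_heis_triangular a b c x0 y0 z0 (EFin \o f)^\+ a0 b0 c0 mz0
  (measurable_funepos mfE) (fun=> funepos_ge0 _ _).
have En := @ge0_integral_heis_triangular a b c x0 y0 z0 (EFin \o f)^\- a0 b0 c0 mz0
  (measurable_funeneg mfE) (fun=> funeneg_ge0 _ _).
rewrite (_ : integral _ _ (funepos _) =
  ((a * b * c)^-1)%:E * \int[heis_leb]_p (EFin \o f)^\+ p); last first.
  by rewrite -Ep; apply: eq_integral => p _; rewrite !funeposE.
rewrite (_ : integral _ _ (funeneg _) =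
  ((a * b * c)^-1)%:E * \int[heis_leb]_p (EFin \o f)^\- p); last first.
  by rewrite -En; apply: eq_integral => p _; rewrite !funenegE.
have kp : (0 < (a * b * c)^-1)%R by rewrite invr_gt0 !mulr_gt0.
rewrite [in RHS]integralE.
set X := integral _ _ _; set Y := integral _ _ _.
have X0 : 0 <= X by exact: integral_ge0.
have Y0 : 0 <= Y by exact: integral_ge0.
move: X Y X0 Y0 => [x||] [y||] //= _ _;
  by rewrite ?gt0_muley ?lte_fin//= ?mulrBr ?mulr0.
Qed.

(** A left translation is triangular with unit diagonal: its shift in z depends on x and y only. *)
Lemma integral_heis_mul p (f : heis R -> R) : measurable_fun setT f ->
  (\int[heis_leb]_q f (heis_mul p q) = \int[heis_leb]_q f q)%R.
Proof.
move=> mf.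
have mz : measurable_fun setT
    (fun v : R * R => p.2 + 2^-1 * (p.1.1 * v.2 - p.1.2 * v.1))%R.
  apply: measurable_funD => //; apply: measurable_funM => //.
  by apply: measurable_funB; exact: measurable_funM.
rewrite -[RHS]mul1r -[in RHS]invr1 -[1%R in RHS]mulr1 -[X in (X * 1)%R]mulr1.
rewrite -(@integral_heis_triangular 1 1 1 p.1.1 p.1.2 _ f ltr01 ltr01 ltr01 mz)//.
apply: eq_Rintegral => q _; congr f; rewrite /heis_mul !mul1r.
by congr (_, _, _); rewrite ?(addrC p.1.1) ?(addrC p.1.2)//; ring.
Qed.

Lemma integral_heis_dilation (s : R) (f : heis R -> R) : (0 < s)%R ->
  measurable_fun setT f ->
  (\int[heis_leb]_q f (s * q.1.1, s * q.1.2, s ^+ 2 * q.2) =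
   s ^- 4 * \int[heis_leb]_q f q)%R.
Proof.
move=> s0 mf.
have := @integral_heis_triangular s s (s ^+ 2)%R 0%R 0%R (cst 0%R) f s0 s0 (exprn_gt0 _ s0)
  (measurable_cst _) mf.
rewrite -expr2 -exprD => <-.
by apply: eq_Rintegral => q _; rewrite !addr0.
Qed.

End heis_integral.

Section heis_measurable.
Context {R : realType}.

Lemma heis_ballE (p : heis R) (e : R) :
  ball p e = (ball p.1.1 e `*` ball p.1.2 e) `*` ball p.2 e.
Proof. by []. Qed.

(** An open set is a countable union of balls with rational centres and radii [1 / (n + 1)]; in the
    sup norm these are boxes, hence in the product sigma-algebra. *)
Lemma open_measurable_heis (U : set (heis R)) : open U -> measurable U.
Proof.
move=> oU.
pose B (i : (rat * rat * rat) * nat) : set (heis R) :=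
  ball ((ratr i.1.1.1, ratr i.1.1.2, ratr i.1.2) : heis R) i.2.+1%:R^-1.
have -> : U = \bigcup_(i in [set i | B i `<=` U]) B i.
  apply/seteqP; split => [p Up|p [i /= iU Bip]]; last exact: iU.
  have [e /= e0 eU] : nbhs_ball p U.
    by apply/nbhs_ballP; move: oU; rewrite openE => /(_ _ Up).
  have /cvgr_lt : @harmonic R @ \oo --> 0 by exact: cvg_harmonic.
  have e20 : 0 < e / 2 by rewrite divr_gt0.
  move=> /(_ _ e20) [n _ /(_ n (leqnn n))] /= ne.
  set d := n.+1%:R^-1 in ne.
  have d0 : 0 < d by rewrite invr_gt0.
  have rd (x : R) : exists q : rat, ball (ratr q : R) d x.
    have [q] := @rat_in_itvoo R (x - d) (x + d) ltac:(lra).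
    by rewrite in_itv/= => qx; exists q; rewrite /ball/= ltr_norml; lra.
  have [qx Hx] := rd p.1.1; have [qy Hy] := rd p.1.2; have [qz Hz] := rd p.2.
  exists ((qx, qy, qz), n) => //= q Bq; apply: eU.
  have Bp : B ((qx, qy, qz), n) p by [].
  have pe : ball p (d + d) q by apply: ball_triangle Bq; exact: ball_sym.
  by apply: le_ball pe; rewrite ltW//; lra.
rewrite bigcup_mkcond; apply: countable_bigcupT_measurable; first exact: countableP.
move=> i; case: ifPn => // _.
rewrite /B heis_ballE; apply: measurableX; last exact: measurable_ball.
by apply: measurableX; exact: measurable_ball.
Qed.

Lemma continuous_measurable_heis (f : heis R -> R) :
  continuous f -> measurable_fun setT f.
Proof.
move=> cf; apply: (measurability _ (RGenOInfty.measurableE R)).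
move=> /= _ [_ [a ->]] <-; apply: measurableI => //; apply: open_measurable_heis.
by move/continuousP : cf; apply; exact: interval_open.
Qed.

End heis_measurable.

(** * The heat equation *)

Section derivation_under_integral.
Context {R : realType} d (Y : measurableType d) (mu : {measure set Y -> \bar R}).

(** One majorant [G] serves twice: for [f] it gives integrability of each slice, for [f'] it
    dominates the difference quotients. *)
Lemma is_derive_integral (f f' : R -> Y -> R) (a r : R) (G : Y -> R) : 0 < r ->
  (forall x, x \in `]a - r, a + r[ -> measurable_fun setT (f x)) ->
  mu.-integrable setT (EFin \o G) ->
  (forall x y, x \in `]a - r, a + r[ -> `|f x y| <= G y) ->
  (forall x y, x \in `]a - r, a + r[ -> `|f' x y| <= G y) ->
  (forall x y, x \in `]a - r, a + r[ -> is_derive x 1 (f^~ y) (f' x y)) ->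
  is_derive a 1 (fun x => \int[mu]_y f x y) (\int[mu]_y f' a y).
Proof.
move=> r0 mf iG fG f'G df.
have aI : a \in `]a - r, a + r[ by rewrite in_itv/=; lra.
have G0 y : 0 <= G y by apply: le_trans (fG a y aI).
have intf x : `]a - r, a + r[%classic x -> mu.-integrable setT (EFin \o f x).
  move=> /= xI; apply: le_integrable iG => //.
    exact/measurable_EFinP/mf.
  by move=> y _; rewrite /= lee_fin (le_trans (fG _ _ xI))// ler_norm.
have d1E x y : x \in `]a - r, a + r[ -> partial1of2 f x y = f' x y.
  by move=> xI; rewrite partial1of2E; have := df x y xI => Hd; rewrite derive_val.
have derf1 x y : `]a - r, a + r[%classic x -> setT y -> derivable (f ^~ y) x 1.
  by move=> xI _; have := df x y xI => Hd; exact: ex_derive.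
have bd x y : `]a - r, a + r[%classic x -> setT y -> `|partial1of2 f x y| <= G y.
  by move=> xI _; rewrite d1E//; exact: f'G.
have H1 := derivable_under_integral measurableT aI intf derf1 G0 iG bd.
have H2 := differentiation_under_integral measurableT aI intf derf1 G0 iG bd.
apply: DeriveDef => //; rewrite -derive1E H2.
by apply: eq_Rintegral => y _; exact: d1E.
Qed.

End derivation_under_integral.

(** * The two hyperbolic factors of the kernel: evenness, decay, derivatives in time *)

Section hyperbolic_factors.
Context {R : realType}.
Implicit Types (l s u : R).

Lemma sinhN u : sinh (- u) = - sinh u.
Proof. by rewrite /sinh opprK; field. Qed.

Lemma coshN u : cosh (- u) = cosh u.
Proof. by rewrite /cosh opprK addrC. Qed.

(** With [a = expR (u / 2)] and [b = expR (- (u / 2))], [sinh u] is [(a ^ 2 - b ^ 2) / 2], while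
    [a >= 1 + u / 2] and [b <= 1]. The bound keeps the linear zero at 0 and exponential growth
    together, so [l / sinh (l s)] is controlled near 0 and at infinity at once. *)
Lemma sinh_ge_mul_expR u : 0 <= u -> u / 4 * expR (u / 2) <= sinh u.
Proof.
move=> u0; rewrite /sinh.
have -> : expR u = expR (u / 2) * expR (u / 2) by rewrite -expRD; congr expR; field.
have -> : expR (- u) = expR (- (u / 2)) * expR (- (u / 2)).
  by rewrite -expRD; congr expR; field.
have e1 : 1 + u / 2 <= expR (u / 2) by exact: expR_ge1Dx.
have e2 : expR (- (u / 2)) <= 1.
  by rewrite -[leRHS]expR0 ler_expR; lra.
have e3 : 0 < expR (- (u / 2)) by exact: expR_gt0.
set a := expR (u / 2) in e1 *; set b := expR (- (u / 2)) in e2 e3 *.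
nra.
Qed.

Lemma sinh_gt0 u : 0 < u -> 0 < sinh u.
Proof.
by move=> u0; apply: lt_le_trans (sinh_ge_mul_expR u (ltW u0));
  rewrite mulr_gt0 ?expR_gt0 ?divr_gt0.
Qed.

Lemma sinh_eq0 u : (sinh u == 0) = (u == 0).
Proof.
have [->|u0] := eqVneq u 0; first by rewrite /sinh oppr0 subrr mul0r eqxx.
have [/sinh_gt0|uN|u00] := ltgtP 0 u; first by move/gt_eqF.
- have : 0 < sinh (- u) by apply: sinh_gt0; rewrite oppr_gt0.
  by rewrite sinhN oppr_gt0 => /lt_eqF.
- by rewrite u00 eqxx in u0.
Qed.

(** At [l = 0] both factors take the value 0 by the division convention, not their limit [1 / s].
    The estimates below survive this; only the limit of small frequencies in the mass computation
    has to avoid [l = 0]. *)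
Definition ampl l s := l / sinh (l * s).
Definition rate l s := l * coth (l * s).

Lemma amplN l s : ampl (- l) s = ampl l s.
Proof. by rewrite /ampl !mulNr sinhN invrN mulrN opprK. Qed.

Lemma rateN l s : rate (- l) s = rate l s.
Proof. by rewrite /rate /coth !mulNr sinhN coshN invrN !mulrN opprK. Qed.

Lemma ampl_abs l s : ampl l s = ampl `|l| s.
Proof. by have [//|] := ger0P l; rewrite amplN. Qed.

Lemma rate_abs l s : rate l s = rate `|l| s.
Proof. by have [//|] := ger0P l; rewrite rateN. Qed.

Lemma ampl0 s : ampl 0 s = 0. Proof. by rewrite /ampl mul0r. Qed.
Lemma rate0 s : rate 0 s = 0. Proof. by rewrite /rate mul0r. Qed.

Lemma ampl_ge0 l s : 0 < s -> 0 <= ampl l s.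
Proof.
move=> s0; rewrite ampl_abs.
have [->|l0] := eqVneq `|l| 0; first by rewrite ampl0.
have lp : 0 < `|l| by rewrite lt_def l0/=.
by rewrite /ampl divr_ge0// ltW// sinh_gt0// mulr_gt0.
Qed.

Lemma ampl_le l s : 0 < s -> ampl l s <= 4 / s * expR (- (`|l| * s / 2)).
Proof.
move=> s0; rewrite ampl_abs.
have [->|l0] := eqVneq `|l| 0.
  by rewrite ampl0 mulr_ge0 ?expR_ge0 ?divr_ge0 ?ltW.
have lp : 0 < `|l| by rewrite lt_def l0/=.
have ls : 0 < `|l| * s by rewrite mulr_gt0.
rewrite /ampl ler_pdivrMr ?sinh_gt0//.
have := sinh_ge_mul_expR _ (ltW ls).
rewrite -(ler_pM2l (_ : 0 < 4 / s * expR (- (`|l| * s / 2)))); last first.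
  by rewrite mulr_gt0 ?expR_gt0 ?divr_gt0.
apply: le_trans.
rewrite expRN; have := expR_gt0 (`|l| * s / 2); set e := expR _ => e0.
rewrite le_eqVlt; apply/orP; left; apply/eqP; field.
by rewrite !gt_eqF.
Qed.

Lemma cosh_gt0 u : 0 < cosh u.
Proof. by rewrite /cosh divr_gt0// addr_gt0// expR_gt0. Qed.

Lemma rate_ge0 l s : 0 < s -> 0 <= rate l s.
Proof.
move=> s0; rewrite (_ : rate l s = ampl l s * cosh (l * s)).
  by rewrite mulr_ge0 ?ampl_ge0// ltW// cosh_gt0.
by rewrite /rate /ampl /coth mulrA mulrAC.
Qed.

(** Since [cosh u - sinh u = expR (- u) <= 1] for [u >= 0], one has [coth u <= 1 + 1 / sinh u], that
    is, [rate <= |l| + ampl]. *)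
Lemma rate_le l s : 0 < s -> rate l s <= `|l| + 4 / s.
Proof.
move=> s0.
have /le_trans-> // : rate l s <= `|l| + ampl l s; last first.
  rewrite lerD2l (le_trans (ampl_le l s s0))// -[leRHS]mulr1.
  rewrite ler_pM2l ?divr_gt0//.
  by rewrite -[leRHS]expR0 ler_expR oppr_le0 divr_ge0// mulr_ge0// ltW.
rewrite rate_abs [in leRHS]ampl_abs.
have [->|l0] := eqVneq `|l| 0; first by rewrite ampl0 rate0 addr0.
have lp : 0 < `|l| by rewrite lt_def l0/=.
have ls : 0 < `|l| * s by rewrite mulr_gt0.
have sp := sinh_gt0 _ ls.
rewrite /rate /coth /ampl -(ler_pM2r sp) mulrA mulfVK ?gt_eqF// mulrDl mulfVK ?gt_eqF//.
rewrite -[X in _ <= _ + X]mulr1 -mulrDr ler_pM2l//.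
have : expR (- (`|l| * s)) <= 1 by rewrite -[leRHS]expR0 ler_expR; lra.
rewrite /cosh /sinh; lra.
Qed.

Global Instance is_derive_sinh u : is_derive u 1 sinh (cosh u).
Proof.
by rewrite /sinh; apply: is_derive_eq; rewrite /cosh /GRing.scale/=; field.
Qed.

Global Instance is_derive_cosh u : is_derive u 1 cosh (sinh u).
Proof.
by rewrite /cosh; apply: is_derive_eq; rewrite /sinh /GRing.scale/=; field.
Qed.

Let is_derive_sinhM l s : is_derive s 1 (fun s => sinh (l * s)) (cosh (l * s) * l).
Proof.
have := @is_derive1_comp R sinh (fun s => l * s) s (cosh (l * s)) l.
apply; apply: is_derive_eq; rewrite /GRing.scale/=; ring.
Qed.

Let is_derive_coshM l s : is_derive s 1 (fun s => cosh (l * s)) (sinh (l * s) * l).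
Proof.
have := @is_derive1_comp R cosh (fun s => l * s) s (sinh (l * s)) l.
apply; apply: is_derive_eq; rewrite /GRing.scale/=; ring.
Qed.

Let is_derive_invsinhM l s : l != 0 -> 0 < s ->
  is_derive s 1 (fun s => (sinh (l * s))^-1)
    (- (sinh (l * s)) ^- 2 * (cosh (l * s) * l)).
Proof.
move=> l0 s0.
have sn0 : sinh (l * s) != 0 by rewrite sinh_eq0 mulf_neq0// gt_eqF.
have H := is_derive_sinhM l s.
exact: is_deriveV.
Qed.

(** This and the Riccati equation for [rate] form a closed system in time: the time derivative of
    the integrand is the same envelope times a polynomial in [l] and [rate], which makes the heat
    equation an algebraic identity. *)
Lemma is_derive_ampl l s : 0 < s ->
  is_derive s 1 (ampl l) (- (ampl l s * rate l s)).
Proof.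
move=> s0; have [->|l0] := eqVneq l 0.
  rewrite ampl0 mul0r oppr0 (_ : ampl 0 = cst 0); last by apply/funext => ?; rewrite ampl0.
  exact: is_derive_cst.
have sn0 : sinh (l * s) != 0 by rewrite sinh_eq0 mulf_neq0// gt_eqF.
have := is_derive_invsinhM l s l0 s0.
rewrite /ampl => H; apply: is_derive_eq.
by rewrite /rate /coth /GRing.scale/=; field.
Qed.

Lemma is_derive_rate l s : 0 < s ->
  is_derive s 1 (rate l) (l ^+ 2 - rate l s ^+ 2).
Proof.
move=> s0; have [->|l0] := eqVneq l 0.
  rewrite rate0 expr0n/= subrr (_ : rate 0 = cst 0); last by apply/funext => ?; rewrite rate0.
  exact: is_derive_cst.
have sn0 : sinh (l * s) != 0 by rewrite sinh_eq0 mulf_neq0// gt_eqF.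
have := is_derive_invsinhM l s l0 s0.
rewrite /rate /coth => H; apply: is_derive_eq.
by rewrite /GRing.scale/=; field.
Qed.

(** Inversion is not continuous at 0, so it is written as [x] times a real power of [x ^ 2]; both
    sides vanish at 0. *)
Lemma measurable_invr : measurable_fun [set: R] (@GRing.inv R).
Proof.
have -> : @GRing.inv R = fun x => x * (x ^+ 2) `^ (-1).
  apply/funext => x; rewrite powR_inv1 ?sqr_ge0//.
  have [->|x0] := eqVneq x 0; first by rewrite invr0 mul0r.
  by field.
apply: measurable_funM => //.
have H := measurableT_comp (measurable_powR (-1)) (@exprn_measurable R setT 2).
exact: H.
Qed.

Lemma continuous_sinh : continuous (@sinh R).
Proof.
by move=> u; apply: differentiable_continuous; apply/derivable1_diffP; exact: ex_derive.
Qed.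

Lemma continuous_cosh : continuous (@cosh R).
Proof.
by move=> u; apply: differentiable_continuous; apply/derivable1_diffP; exact: ex_derive.
Qed.

Lemma measurable_sinh : measurable_fun [set: R] sinh.
Proof. by apply: continuous_measurable_fun; exact: continuous_sinh. Qed.

Lemma measurable_cosh : measurable_fun [set: R] cosh.
Proof. by apply: continuous_measurable_fun; exact: continuous_cosh. Qed.

Lemma measurable_ampl s : measurable_fun setT (ampl ^~ s).
Proof.
have mlin : measurable_fun setT (fun l => l * s) by exact: measurable_funM.
apply: measurable_funM => //.
exact: (measurableT_comp measurable_invr
  (measurableT_comp measurable_sinh mlin)).
Qed.

Lemma measurable_rate s : measurable_fun setT (rate ^~ s).
Proof.
have mlin : measurable_fun setT (fun l => l * s) by exact: measurable_funM.
apply: measurable_funM => //; apply: measurable_funM.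
  exact: (measurableT_comp measurable_cosh mlin).
exact: (measurableT_comp measurable_invr
  (measurableT_comp measurable_sinh mlin)).
Qed.

(* Uniform in [s >= s0]: this one bound dominates the heat kernel integrand and
   all the derivatives of it that are needed. *)
Lemma ampl_poly_le (s0 : R) : 0 < s0 -> exists2 C : R, 0 <= C &
  forall l s, s0 <= s -> ampl l s * (1 + `|l|) ^+ 2 <= C * (oneDsqr l)^-1.
Proof.
move=> s00; pose c := s0 / 2.
have c0 : 0 < c by rewrite divr_gt0.
exists (4 / s0 * (1 + 4 / c) ^+ 4).
  by rewrite mulr_ge0 ?exprn_ge0 ?addr_ge0// divr_ge0// ltW.
move=> l s s0s.
have sp : 0 < s by exact: lt_le_trans s0s.
set x := `|l|.
have x0 : 0 <= x by exact: normr_ge0.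
have D0 : 0 < oneDsqr l by rewrite (lt_le_trans _ (oneDsqr_ge1 l)).
rewrite ler_pdivlMr//.
have DE : oneDsqr l <= (1 + x) ^+ 2.
  rewrite /oneDsqr sqrrD expr1n -(real_normK (num_real l)) -/x.
  by rewrite lerD2r lerDl mul1r mulrn_wge0.
have eb : ampl l s <= 4 / s0 * expR (- (x * c)).
  apply: le_trans (ampl_le l s sp) _; apply: ler_pM; rewrite ?expR_ge0 ?divr_ge0 ?(ltW sp)//.
    by rewrite ler_pM2l// lef_pV2.
  rewrite ler_expR lerN2 -/x /c mulrA ler_pM2r ?invr_gt0//.
  exact: ler_wpM2l.
(* The exponential decay pays for four powers of [1 + |l|]: two appear in the claim and two absorb
   [1 + l ^ 2]. Each power costs [1 + x <= (1 + 4 / c) (1 + x c / 4)], and the last factor is at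
   most [expR (x c / 4)]. *)
have p1 : (1 + x) ^+ 4 <= (1 + 4 / c) ^+ 4 * expR (x * c).
  have -> : expR (x * c) = expR (x * c / 4) ^+ 4.
    by rewrite -expRM_natl; congr expR; field.
  have h0 : 0 <= 1 + 4 / c by rewrite addr_ge0// divr_ge0// ltW.
  rewrite -exprMn lerXn2r ?nnegrE ?(mulr_ge0 h0) ?expR_ge0 ?addr_ge0//.
  apply: (@le_trans _ _ ((1 + 4 / c) * (1 + x * c / 4))).
    have -> : (1 + 4 / c) * (1 + x * c / 4) = 1 + x + 4 / c + x * c / 4.
      by field; rewrite gt_eqF.
    have h1 : 0 <= 4 / c by rewrite divr_ge0// ltW.
    have h2 : 0 <= x * c / 4 by rewrite divr_ge0// mulr_ge0// ltW.
    lra.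
  by rewrite ler_pM2l ?expR_ge1Dx// addr_gt0// divr_gt0.
have a0 := ampl_ge0 l s sp.
apply: (@le_trans _ _ (ampl l s * (1 + x) ^+ 4)).
  rewrite -mulrA ler_wpM2l// (_ : (1 + x) ^+ 4 = (1 + x) ^+ 2 * (1 + x) ^+ 2); last by ring.
  by rewrite ler_wpM2l// sqr_ge0.
apply: (@le_trans _ _ (4 / s0 * expR (- (x * c)) * ((1 + 4 / c) ^+ 4 * expR (x * c)))).
  by apply: ler_pM => //; rewrite exprn_ge0// addr_ge0.
rewrite expRN le_eqVlt; apply/orP; left; apply/eqP.
field; rewrite !gt_eqF//; exact: expR_gt0.
Qed.

End hyperbolic_factors.

(** * The kernel integrand, its derivatives, and the heat equation at fixed frequency *)

Section kernel_integrand.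
Context {R : realType}.
Implicit Types (l s : R) (w d p q v : heis R).

Definition kint s l w : R :=
  cos (l * w.2) * ampl l s *
  expR (- ((w.1.1 ^+ 2 + w.1.2 ^+ 2) / 4 * rate l s)).

Lemma heat_kernelE s w :
  heat_kernel s w = (8 * pi ^+ 2)^-1 * \int[@lebesgue_measure R]_l kint s l w.
Proof. by []. Qed.

Definition hdot w d : R := w.1.1 * d.1.1 + w.1.2 * d.1.2.

(** The nonnegative envelope left after removing the cosine; each derivative below is [kenv] times a
    trigonometric factor with polynomial coefficients. *)
Definition kenv s l w : R :=
  ampl l s * expR (- ((w.1.1 ^+ 2 + w.1.2 ^+ 2) / 4 * rate l s)).

(* [kint1] and [kint2] are the first two derivatives of [kint s l] at [w] in the
   direction [d], and [kintS] is the time derivative. *)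
Definition kint1 s l w d : R :=
  kenv s l w * (- (l * d.2) * sin (l * w.2)
    - rate l s / 2 * hdot w d * cos (l * w.2)).

Definition kint2 s l w d : R :=
  kenv s l w * (- (l * d.2) ^+ 2 * cos (l * w.2)
    + rate l s * hdot w d * (l * d.2) * sin (l * w.2)
    + ((rate l s / 2 * hdot w d) ^+ 2 - rate l s / 2 * hdot d d) * cos (l * w.2)).

Definition kintS s l w : R :=
  kenv s l w * (- rate l s - (w.1.1 ^+ 2 + w.1.2 ^+ 2) / 4 * (l ^+ 2 - rate l s ^+ 2))
  * cos (l * w.2).

Lemma is_derive_kint s l w d (e : R) :
  is_derive e 1 (fun e : R => kint s l (w + e *: d)) (kint1 s l (w + e *: d) d).
Proof.
rewrite /kint /kint1 /kenv /hdot /=.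
apply: is_derive_eq; rewrite /GRing.scale/=.
by field.
Qed.

Lemma is_derive_kint1 s l w d (e : R) :
  is_derive e 1 (fun e : R => kint1 s l (w + e *: d) d) (kint2 s l (w + e *: d) d).
Proof.
rewrite /kint1 /kint2 /kenv /hdot /=.
apply: is_derive_eq; rewrite /GRing.scale/=.
by field.
Qed.

Lemma is_derive_kintS s l w : 0 < s ->
  is_derive s 1 (fun s => kint s l w) (kintS s l w).
Proof.
move=> s0; rewrite /kint /kintS /kenv.
have H1 := is_derive_ampl l s s0.
have H2 := is_derive_rate l s s0.
apply: is_derive_eq; rewrite /GRing.scale/=.
by field.
Qed.

(** The two directions are the negatives of the right-invariant fields at [w], which is how
    [w = (- p) q] moves when [p] follows X or Y. The sine terms of the two summands cancel, and the
    cosine terms add up to the time derivative. *)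
Lemma kint_heat s l w :
  kint2 s l w (-1, 0, - (w.1.2 / 2)) + kint2 s l w (0, -1, w.1.1 / 2) = kintS s l w.
Proof. by rewrite /kint2 /kintS /hdot /=; field. Qed.

End kernel_integrand.

Section kernel_integrand_bounds.
Context {R : realType}.
Implicit Types (l s K : R) (w d p q v : heis R).

Definition hbounded K w := [/\ `|w.1.1| <= K, `|w.1.2| <= K & `|w.2| <= K].

Lemma kenv_ge0 l s w : 0 < s -> 0 <= kenv s l w.
Proof. by move=> s0; rewrite /kenv mulr_ge0 ?ampl_ge0 ?expR_ge0. Qed.

Lemma kenv_le l s w : 0 < s -> kenv s l w <= ampl l s.
Proof.
move=> s0; rewrite /kenv -[leRHS]mulr1 ler_wpM2l ?ampl_ge0//.
rewrite -[leRHS]expR0 ler_expR oppr_le0 mulr_ge0 ?rate_ge0//.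
by rewrite divr_ge0// addr_ge0// sqr_ge0.
Qed.

Lemma normr_cos_le1 (u : R) : `|cos u| <= 1.
Proof. by rewrite ler_norml cos_geN1 cos_le1. Qed.

Lemma normr_sin_le1 (u : R) : `|sin u| <= 1.
Proof. by rewrite ler_norml sin_geN1 sin_le1. Qed.

Lemma normr_hdot_le K w d : hbounded K w -> hbounded K d ->
  `|hdot w d| <= 2 * K ^+ 2.
Proof.
move=> [w1 w2 _] [d1 d2 _]; rewrite /hdot (le_trans (ler_normD _ _))// !normrM.
have -> : 2 * K ^+ 2 = K * K + K * K by ring.
by apply: lerD; apply: ler_pM.
Qed.

(** For [w] and [d] in a box, each quantity is the envelope times a factor of size at most a
    constant times [(1 + |l|) ^ 2], which [ampl_poly_le] absorbs. *)
Lemma kint_bounds (s0 K : R) : 0 < s0 -> 0 <= K -> exists2 C : R, 0 <= C &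
  forall l s w d, s0 <= s -> hbounded K w -> hbounded K d ->
    [/\ `|kint s l w| <= C * (oneDsqr l)^-1,
        `|kint1 s l w d| <= C * (oneDsqr l)^-1,
        `|kint2 s l w d| <= C * (oneDsqr l)^-1 &
        `|kintS s l w| <= C * (oneDsqr l)^-1].
Proof.
move=> s00 K0; have [C0 C00 HC0] := ampl_poly_le s0 s00.
(* By [rate_le], [rate l s <= k (1 + |l|)] whenever [s >= s0]. The constants [C1], [C2], [C3] then
   control the factors of [kint1], [kint2] and [kintS]. *)
pose k := 1 + 4 / s0.
have k0 : 0 <= k by rewrite addr_ge0// divr_ge0// ltW.
pose C1 := K + k * K ^+ 2.
pose C2 := C1 ^+ 2 + k * K ^+ 2.
pose C3 := k + K ^+ 2 * (1 + k ^+ 2).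
have C10 : 0 <= C1 by rewrite addr_ge0// mulr_ge0// sqr_ge0.
have C20 : 0 <= C2 by rewrite addr_ge0 ?sqr_ge0// mulr_ge0// sqr_ge0.
have C30 : 0 <= C3 by rewrite addr_ge0// mulr_ge0 ?addr_ge0// sqr_ge0.
pose C := 1 + C1 + C2 + C3.
have C_0 : 0 <= C by rewrite /C; lra.
exists (C * C0); first exact: mulr_ge0.
move=> l s w d s0s bw bd.
have sp : 0 < s by exact: lt_le_trans s0s.
pose m := 1 + `|l|.
have l0 : 0 <= `|l| by exact: normr_ge0.
have m1 : 1 <= m by rewrite /m; lra.
have m2 : m <= m ^+ 2 by rewrite -[leLHS]mulr1 expr2 ler_wpM2l//; lra.
have m21 : 1 <= m ^+ 2 by exact: le_trans m2.
have key T : `|T| <= C * m ^+ 2 -> `|kenv s l w * T| <= C * C0 * (oneDsqr l)^-1.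
  move=> HT; rewrite normrM (ger0_norm (kenv_ge0 l s w sp)).
  apply: (@le_trans _ _ (ampl l s * (C * m ^+ 2))).
    by apply: ler_pM; rewrite ?kenv_ge0 ?kenv_le.
  by rewrite mulrCA -mulrA ler_wpM2l ?HC0.
have leC (c T : R) : 0 <= c -> c <= C -> `|T| <= c * m ^+ 2 -> `|T| <= C * m ^+ 2.
  by move=> c0 cC /le_trans; apply; rewrite ler_wpM2r// sqr_ge0.
have r0 := rate_ge0 l s sp.
have rk : rate l s <= k * m.
  apply: le_trans (rate_le l s sp) _.
  have : 4 / s <= 4 / s0 by rewrite ler_pM2l// lef_pV2.
  have : 0 <= 4 / s0 * `|l| by rewrite mulr_ge0// divr_ge0// ltW.
  rewrite /k /m mulrDl mulrDr; lra.
set r := rate l s in r0 rk *.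
have hX : `|l * d.2| <= m * K.
  by case: bd => _ _ d2; rewrite normrM; apply: ler_pM => //; rewrite /m; lra.
have hh x y : hbounded K x -> hbounded K y -> `|r / 2 * hdot x y| <= k * K ^+ 2 * m.
  move=> bx by'; rewrite normrM ger0_norm; last by rewrite divr_ge0.
  have -> : k * K ^+ 2 * m = (k * m / 2) * (2 * K ^+ 2) by field.
  by apply: ler_pM; rewrite ?divr_ge0// ?normr_hdot_le// ler_pM2r.
have hY := hh w d bw bd; have hZ := hh d d bd bd.
set X := l * d.2 in hX *; set Y := r / 2 * hdot w d in hY *.
set Z := r / 2 * hdot d d in hZ *.
have nM (u c : R) : `|c| <= 1 -> `|u * c| <= `|u|.
  by move=> c1; rewrite normrM -[leRHS]mulr1 ler_wpM2l.
set c := cos (l * w.2); set sn := sin (l * w.2).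
have c1 : `|c| <= 1 by exact: normr_cos_le1.
have sn1 : `|sn| <= 1 by exact: normr_sin_le1.
split.
- rewrite (_ : kint s l w = kenv s l w * c); last by rewrite /kint /kenv -/c; ring.
  apply: key; apply: (le_trans c1).
  by rewrite -[leLHS]mulr1 ler_pM// /C; lra.
- apply: key; apply: (leC C1); rewrite // /C; first by lra.
  rewrite -/X -/r -/Y -/sn -/c (le_trans (ler_normB _ _))//.
  apply: (@le_trans _ _ (m * K + k * K ^+ 2 * m)).
    apply: lerD; [apply: le_trans hX; rewrite -[leRHS]normrN; exact: nM|].
    by apply: le_trans hY; exact: nM.
  rewrite (_ : _ + _ = C1 * m); last by rewrite /C1; ring.
  by rewrite ler_wpM2l.
- apply: key; apply: (leC C2); rewrite // /C; first by lra.
  rewrite -/X -/r -/Y -/Z -/sn -/c.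
  rewrite (_ : r * hdot w d * X = 2 * (Y * X)); last by rewrite /Y; field.
  (* The terms of [kint2] are those of a square, apart from [Z], so the bound on [|X| + |Y|] found
     for [kint1] is reused squared. *)
  apply: (@le_trans _ _ ((`|X| + `|Y|) ^+ 2 + `|Z|)).
    apply: (le_trans (ler_normD _ _)); apply: (le_trans (lerD (ler_normD _ _) (lexx _))).
    have h1 : `|- X ^+ 2 * c| <= `|X| ^+ 2.
      by apply: le_trans (nM _ _ c1) _; rewrite normrN normrX.
    have h2 : `|2 * (Y * X) * sn| <= 2 * (`|Y| * `|X|).
      by apply: le_trans (nM _ _ sn1) _; rewrite !normrM normr_nat.
    have h3 : `|(Y ^+ 2 - Z) * c| <= `|Y| ^+ 2 + `|Z|.
      by apply: le_trans (nM _ _ c1) _; rewrite (le_trans (ler_normB _ _))// normrX.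
    have -> : (`|X| + `|Y|) ^+ 2 + `|Z| =
      (`|X| ^+ 2 + 2 * (`|Y| * `|X|)) + (`|Y| ^+ 2 + `|Z|) by ring.
    by rewrite !lerD.
  have h4 : (`|X| + `|Y|) ^+ 2 <= (C1 * m) ^+ 2.
    rewrite lerXn2r ?nnegrE ?addr_ge0 ?mulr_ge0 ?(le_trans _ m1)//.
    by rewrite (_ : C1 * m = m * K + k * K ^+ 2 * m) ?lerD// /C1; ring.
  have h5 : `|Z| <= k * K ^+ 2 * m ^+ 2.
    by apply: (le_trans hZ); rewrite ler_wpM2l// mulr_ge0// sqr_ge0.
  by rewrite /C2 mulrDl -exprMn lerD.
- rewrite /kintS -mulrA; apply: key; apply: (leC C3); rewrite // /C; first by lra.
  rewrite -/r -/c; apply: (le_trans (nM _ _ c1)).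
  apply: (le_trans (ler_normB _ _)).
  rewrite normrN (ger0_norm r0) normrM ger0_norm; last first.
    by rewrite divr_ge0// addr_ge0// sqr_ge0.
  rewrite /C3 [leRHS]mulrDl; apply: lerD.
    by apply: (le_trans rk); rewrite ler_wpM2l.
  rewrite -mulrA; apply: ler_pM => //.
  + by rewrite divr_ge0// addr_ge0// sqr_ge0.
  + case: bw => b1 b2 _.
    have s1 : w.1.1 ^+ 2 <= K ^+ 2 by rewrite -real_normK ?num_real// lerXn2r ?nnegrE.
    have s2 : w.1.2 ^+ 2 <= K ^+ 2 by rewrite -real_normK ?num_real// lerXn2r ?nnegrE.
    have := sqr_ge0 K; lra.
  + apply: (le_trans (ler_normB _ _)); rewrite !normrX (ger0_norm r0) mulrDl mul1r.
    apply: lerD; rewrite ?lerXn2r ?nnegrE//; try (rewrite /m; lra).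
    by rewrite -exprMn lerXn2r ?nnegrE// mulr_ge0//; lra.
Qed.

End kernel_integrand_bounds.

Section semigroup_integrals.
Context {R : realType}.
Local Notation mu := (@lebesgue_measure R).
Implicit Types (l s K : R) (w d p q v : heis R) (F : heis R -> R).

Lemma integral_oneDsqrV : (\int[mu]_x ((oneDsqr x)^-1)%:E = pi%:E)%E.
Proof.
rewrite ge0_symfun_integralT//; last 2 first.
- exact: continuous_oneDsqrV.
- by move=> x; rewrite /= /oneDsqr sqrrN.
rewrite (_ : [set x | (0 <= x)%R] = `[0%R, +oo[%classic); last first.
  by apply/seteqP; split=> x /=; rewrite in_itv/= andbT.
rewrite integral0y_oneDsqr -EFinM; congr EFin; by field.
Qed.

Lemma measurable_oneDsqrV : measurable_fun [set: R] (fun x : R => (oneDsqr x)^-1).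
Proof. by apply: continuous_measurable_fun; exact: continuous_oneDsqrV. Qed.

Lemma oneDsqrV_ge0 l : 0 <= (oneDsqr l)^-1.
Proof. by rewrite invr_ge0 ltW// (lt_le_trans ltr01)// oneDsqr_ge1. Qed.

Lemma integrable_oneDsqrV : mu.-integrable setT (fun x => ((oneDsqr x)^-1)%:E).
Proof.
apply/integrableP; split; first by apply/measurable_EFinP; exact: measurable_oneDsqrV.
under eq_integral do rewrite gee0_abs ?lee_fin ?oneDsqrV_ge0//.
by rewrite integral_oneDsqrV ltry.
Qed.

Lemma hboundedE K : [set q : heis R | hbounded K q] =
  (`[- K, K] `*` `[- K, K]) `*` `[- K, K]%classic.
Proof.
apply/seteqP; split=> q /=; rewrite /hbounded !in_itv/= -!ler_norml.
  by case.
by case=> [[]].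
Qed.

Lemma measurable_hbounded K : measurable [set q : heis R | hbounded K q].
Proof. by rewrite hboundedE; apply: measurableX => //; exact: measurableX. Qed.

Lemma heis_leb_hbounded K : (heis_leb [set q : heis R | hbounded K q] < +oo)%E.
Proof.
have h : mu `[- K, K]%classic \is a fin_num.
  by rewrite lebesgue_measure_itv/=; case: ifP.
rewrite hboundedE /heis_leb product_measure1E//; last exact: measurableX.
rewrite [X in (X * _)%E]product_measure1E// lte_mul_pinfty//.
- by rewrite mule_ge0.
- by rewrite fin_numM.
- by rewrite -ge0_fin_numE.
Qed.

(** A single shape of majorant for the integrand and all its derivatives: the box comes from the
    support of [F], the factor in [l] from [kint_bounds]. *)
Definition dominator (c K : R) (ql : heis R * R) : R :=
  c * \1_[set q : heis R | hbounded K q] ql.1 * (oneDsqr ql.2)^-1.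

Lemma integrable_dominator c K : 0 <= c ->
  (heis_leb \x mu)%E.-integrable setT (EFin \o dominator c K).
Proof.
move=> c0.
have mh := measurable_hbounded K.
have md : measurable_fun setT (EFin \o dominator c K).
  apply/measurable_EFinP; apply: measurable_funM.
    apply: measurable_funM => //.
    have mi : measurable_fun setT (\1_[set q : heis R | hbounded K q] : heis R -> R).
      exact: measurable_indic.
    exact: (measurableT_comp mi measurable_fst).
  exact: (measurableT_comp measurable_oneDsqrV measurable_snd).
have d0 ql : 0 <= dominator c K ql.
  by rewrite /dominator !mulr_ge0// oneDsqrV_ge0.
apply/integrableP; split=> //.
under eq_integral do rewrite gee0_abs ?lee_fin ?d0//.
rewrite fubini_tonelli1//=.
rewrite /fubini_F.
rewrite (_ : integral _ _ _ =
  \int[heis_leb]_q ((c * pi)%:E * (\1_[set q : heis R | hbounded K q] q)%:E))%E; last first.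
  apply: eq_integral => q _ /=; rewrite /dominator/=.
  under eq_integral do rewrite EFinM.
  rewrite ge0_integralZl_EFin//.
  - rewrite integral_oneDsqrV -!EFinM; congr EFin; ring.
  - by apply/measurable_EFinP; exact: measurable_oneDsqrV.
  - by rewrite mulr_ge0.
rewrite ge0_integralZl_EFin//.
- rewrite integral_indic// setIT lte_mul_pinfty// ?lee_fin ?mulr_ge0 ?pi_ge0//.
  exact: heis_leb_hbounded.
- by apply/measurable_EFinP; exact: measurable_indic.
- by rewrite mulr_ge0// pi_ge0.
Qed.

End semigroup_integrals.

Section heis_measurability.
Context {R : realType} {d} {T : measurableType d}.
Implicit Types (l : T -> R) (w v : T -> heis R) (s : R).

Lemma measurable_coords w : measurable_fun setT w ->
  [/\ measurable_fun setT (fun x => (w x).1.1),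
      measurable_fun setT (fun x => (w x).1.2) &
      measurable_fun setT (fun x => (w x).2)].
Proof.
move=> /measurable_fun_pairP[/measurable_fun_pairP[w1 w2] w3].
by split; [exact: w1|exact: w2|exact: w3].
Qed.

Lemma measurable_hmk (a b c : T -> R) : measurable_fun setT a ->
  measurable_fun setT b -> measurable_fun setT c ->
  measurable_fun setT (fun x => (a x, b x, c x) : heis R).
Proof. by move=> ma mb mc; do 2 apply: measurable_fun_pair => //. Qed.

Lemma measurable_hdot w v : measurable_fun setT w -> measurable_fun setT v ->
  measurable_fun setT (fun x => hdot (w x) (v x)).
Proof.
move=> /measurable_coords[w1 w2 _] /measurable_coords[v1 v2 _].
by apply: measurable_funD; exact: measurable_funM.
Qed.

Lemma measurable_kenv s l w : measurable_fun setT l -> measurable_fun setT w ->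
  measurable_fun setT (fun x => kenv s (l x) (w x)).
Proof.
move=> ml /measurable_coords[w1 w2 _].
apply: measurable_funM; first exact: (measurableT_comp (measurable_ampl s) ml).
apply: measurableT_comp => //; apply: measurableT_comp => //; apply: measurable_funM.
  by apply: measurable_funM => //; apply: measurable_funD; exact: measurable_funX.
exact: (measurableT_comp (measurable_rate s) ml).
Qed.

Let mcos : measurable_fun setT (@cos R).
Proof. by apply: continuous_measurable_fun; exact: continuous_cos. Qed.

Let msin : measurable_fun setT (@sin R).
Proof. by apply: continuous_measurable_fun; exact: continuous_sin. Qed.

Lemma measurable_kint s l w : measurable_fun setT l -> measurable_fun setT w ->
  measurable_fun setT (fun x => kint s (l x) (w x)).
Proof.
move=> ml mw; have [_ _ w3] := measurable_coords w mw.
rewrite (_ : (fun x => _) = fun x => kenv s (l x) (w x) * cos (l x * (w x).2)); last first.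
  by apply/funext => x; rewrite /kint /kenv; ring.
apply: measurable_funM; first exact: measurable_kenv.
by apply: measurableT_comp => //; exact: measurable_funM.
Qed.

Lemma measurable_kint1 s l w v : measurable_fun setT l -> measurable_fun setT w ->
  measurable_fun setT v -> measurable_fun setT (fun x => kint1 s (l x) (w x) (v x)).
Proof.
move=> ml mw mv; have [_ _ w3] := measurable_coords w mw.
have [_ _ v3] := measurable_coords v mv.
have mr := measurableT_comp (measurable_rate s) ml.
have mc : measurable_fun setT (fun x => cos (l x * (w x).2)).
  by apply: measurableT_comp => //; exact: measurable_funM.
have ms : measurable_fun setT (fun x => sin (l x * (w x).2)).
  by apply: measurableT_comp => //; exact: measurable_funM.
have mh := measurable_hdot w v mw mv.
apply: measurable_funM; first exact: measurable_kenv.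
apply: measurable_funB.
  by apply: measurable_funM => //; apply: measurableT_comp => //; exact: measurable_funM.
by apply: measurable_funM => //; apply: measurable_funM => //; exact: measurable_funM.
Qed.

Lemma measurable_kint2 s l w v : measurable_fun setT l -> measurable_fun setT w ->
  measurable_fun setT v -> measurable_fun setT (fun x => kint2 s (l x) (w x) (v x)).
Proof.
move=> ml mw mv; have [_ _ w3] := measurable_coords w mw.
have [_ _ v3] := measurable_coords v mv.
have mr := measurableT_comp (measurable_rate s) ml.
have mr2 : measurable_fun setT (fun x => rate (l x) s / 2) by exact: measurable_funM.
have mc : measurable_fun setT (fun x => cos (l x * (w x).2)).
  by apply: measurableT_comp => //; exact: measurable_funM.
have ms : measurable_fun setT (fun x => sin (l x * (w x).2)).
  by apply: measurableT_comp => //; exact: measurable_funM.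
have mh := measurable_hdot w v mw mv; have mh2 := measurable_hdot v v mv mv.
have mlv : measurable_fun setT (fun x => l x * (v x).2) by exact: measurable_funM.
apply: measurable_funM; first exact: measurable_kenv.
apply: measurable_funD; first apply: measurable_funD.
- apply: measurable_funM => //; apply: measurableT_comp => //.
  exact: measurable_funX.
- by apply: measurable_funM => //; apply: measurable_funM => //; exact: measurable_funM.
- apply: measurable_funM => //; apply: measurable_funB.
    by apply: measurable_funX; exact: measurable_funM.
  exact: measurable_funM.
Qed.

End heis_measurability.

(** * Differentiation of the semigroup under the integral sign, for positive time *)

Section heat_integral.
Context {R : realType}.
Local Notation mu := (@lebesgue_measure R).
Implicit Types (l s K : R) (w d p q v : heis R) (F : heis R -> R).

Definition bounded_support K F := [/\ measurable_fun setT F,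
  forall q, `|F q| <= K & forall q, F q != 0 -> hbounded K q].

(* Derivative of [p |-> heis_mul (- p) q] in the direction [v]. *)
Definition hdir v q : heis R :=
  (- v.1.1, - v.1.2, - v.2 + 2^-1 * (- v.1.1 * q.1.2 + v.1.2 * q.1.1)).

(** The inverse of [p] is [- p], and the product is affine in its left factor. A line in [p] thus
    becomes a line in [(- p) q], and second derivatives acquire no extra term. *)
Lemma heis_mul_line p v q (e : R) :
  heis_mul (- (p + e *: v)) q = heis_mul (- p) q + e *: hdir v q.
Proof.
rewrite /heis_mul /hdir; apply/pair_eqP; rewrite /pair_eq/=.
by apply/andP; split; [apply/andP; split|]; apply/eqP => /=; rewrite /GRing.scale/=; ring.
Qed.

(** Up to the factor [(8 pi ^ 2)^-1] this is [P_s F (p)] after the substitution [q := (- p) q], with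
    the frequency integral merged in, so that one differentiation under the integral suffices. The
    three variants are its time derivative and its first and second derivatives along [v]. *)
Definition Phi F s p :=
  \int[(heis_leb \x mu)%E]_ql (F ql.1 * kint s ql.2 (heis_mul (- p) ql.1)).
Definition PhiS F s p :=
  \int[(heis_leb \x mu)%E]_ql (F ql.1 * kintS s ql.2 (heis_mul (- p) ql.1)).
Definition Phi1 F s p v :=
  \int[(heis_leb \x mu)%E]_ql
    (F ql.1 * kint1 s ql.2 (heis_mul (- p) ql.1) (hdir v ql.1)).
Definition Phi2 F s p v :=
  \int[(heis_leb \x mu)%E]_ql
    (F ql.1 * kint2 s ql.2 (heis_mul (- p) ql.1) (hdir v ql.1)).

Lemma hbounded_heis_mul K p q : hbounded K p -> hbounded K q ->
  hbounded (2 * K + K ^+ 2) (heis_mul (- p) q).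
Proof.
move=> [p1 p2 p3] [q1 q2 q3].
have K0 : 0 <= K by exact: le_trans p1.
have K2 : 0 <= K ^+ 2 by exact: sqr_ge0.
have m (a b : R) : `|a| <= K -> `|b| <= K -> `|a * b| <= K ^+ 2.
  by move=> aK bK; rewrite normrM expr2 ler_pM.
have := m _ _ p1 q2; have := m _ _ p2 q1.
move: p1 p2 p3 q1 q2 q3; rewrite /hbounded /heis_mul /=.
rewrite !ler_norml => /andP[? ?] /andP[? ?] /andP[? ?] /andP[? ?] /andP[? ?] /andP[? ?].
by move=> /andP[? ?] /andP[? ?]; split; lra.
Qed.

Lemma hbounded_hdir K v q : hbounded K v -> hbounded K q ->
  hbounded (2 * K + K ^+ 2) (hdir v q).
Proof.
move=> [p1 p2 p3] [q1 q2 q3].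
have K0 : 0 <= K by exact: le_trans p1.
have K2 : 0 <= K ^+ 2 by exact: sqr_ge0.
have m (a b : R) : `|a| <= K -> `|b| <= K -> `|a * b| <= K ^+ 2.
  by move=> aK bK; rewrite normrM expr2 ler_pM.
have := m _ _ p1 q2; have := m _ _ p2 q1.
move: p1 p2 p3 q1 q2 q3; rewrite /hbounded /hdir /=.
rewrite !ler_norml => /andP[? ?] /andP[? ?] /andP[? ?] /andP[? ?] /andP[? ?] /andP[? ?].
by move=> /andP[? ?] /andP[? ?]; split; lra.
Qed.

Lemma hbounded_ge K K' w : K <= K' -> hbounded K w -> hbounded K' w.
Proof. by move=> KK' [? ? ?]; split; exact: le_trans KK'. Qed.

Lemma hbounded_norm p : hbounded `|p| p.
Proof.
case: p => [[x y] z]; rewrite /hbounded prod_normE/=; split.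
- by rewrite le_max prod_normE/= le_max lexx.
- by rewrite le_max prod_normE/= le_max lexx orbT.
- by rewrite le_max lexx orbT.
Qed.

(** Off the support of [F] all terms vanish. On it [p], [q] and [v] lie in a common box of size [k],
    so [(- p) q] and [hdir v q] lie in the box of size [2 k + k ^ 2] where [kint_bounds] applies. *)
Lemma integrand_bounds K F (s0 r : R) v : bounded_support K F -> 0 < s0 ->
  exists C : R, 0 <= C /\ forall s p ql, s0 <= s -> hbounded r p ->
   let w := heis_mul (- p) ql.1 in let d := hdir v ql.1 in
   [/\ `|F ql.1 * kint s ql.2 w| <= dominator C K ql,
       `|F ql.1 * kint1 s ql.2 w d| <= dominator C K ql,
       `|F ql.1 * kint2 s ql.2 w d| <= dominator C K ql &
       `|F ql.1 * kintS s ql.2 w| <= dominator C K ql].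
Proof.
move=> [mF FK Fs] s00.
have K0 : 0 <= K by exact: le_trans (FK 0).
pose k := `|r| + `|v| + K.
have k0 : 0 <= k by rewrite !addr_ge0.
have k20 : 0 <= 2 * k + k ^+ 2 by rewrite addr_ge0 ?sqr_ge0// mulr_ge0.
have [C C0 HC] := kint_bounds s0 (2 * k + k ^+ 2) s00 k20.
exists (K * C); split; first exact: mulr_ge0.
move=> s p [q l] /= s0s rp.
have [F0|F0] := eqVneq (F q) 0.
  rewrite F0 !mul0r normr0.
  by split; rewrite /dominator !mulr_ge0// oneDsqrV_ge0.
have qK := Fs q F0.
have r0 := normr_ge0 r; have v0 := normr_ge0 v; have rr := ler_norm r.
have qk : hbounded k q by apply: hbounded_ge qK; rewrite /k; lra.
have vk : hbounded k v by apply: hbounded_ge (hbounded_norm v); rewrite /k; lra.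
have pk : hbounded k p by apply: hbounded_ge rp; rewrite /k; lra.
have [b0 b1 b2 b3] := HC l s _ _ s0s (hbounded_heis_mul k p q pk qk)
  (hbounded_hdir k v q vk qk).
have i1 : \1_[set q | hbounded K q] q = 1 :> R by rewrite indicE mem_set.
have key (T : R) : `|T| <= C * (oneDsqr l)^-1 -> `|F q * T| <= dominator (K * C) K (q, l).
  by move=> HT; rewrite /dominator/= i1 mulr1 normrM -mulrA ler_pM.
by split; exact: key.
Qed.

Let measurable_path p : measurable_fun setT (fun ql : heis R * R => heis_mul (- p) ql.1).
Proof.
have [q1 q2 q3] := measurable_coords _ (@measurable_fst _ _ (heis R) (measurableTypeR R)).
apply: measurable_hmk; do 1 ?[exact: measurable_funD].
apply: measurable_funD; first exact: measurable_funD.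
by apply: measurable_funM => //; apply: measurable_funB; exact: measurable_funM.
Qed.

Let measurable_dirpath v : measurable_fun setT (fun ql : heis R * R => hdir v ql.1).
Proof.
have [q1 q2 q3] := measurable_coords _ (@measurable_fst _ _ (heis R) (measurableTypeR R)).
apply: measurable_hmk => //; apply: measurable_funD => //.
by apply: measurable_funM => //; apply: measurable_funD; exact: measurable_funM.
Qed.

Lemma measurable_Phi K F s p : bounded_support K F ->
  measurable_fun setT (fun ql : heis R * R => F ql.1 * kint s ql.2 (heis_mul (- p) ql.1)).
Proof.
move=> [mF _ _]; apply: measurable_funM; first exact: (measurableT_comp mF measurable_fst).
exact: measurable_kint.
Qed.

Lemma measurable_Phi1 K F s p v : bounded_support K F ->
  measurable_fun setT (fun ql : heis R * R =>
    F ql.1 * kint1 s ql.2 (heis_mul (- p) ql.1) (hdir v ql.1)).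
Proof.
move=> [mF _ _]; apply: measurable_funM; first exact: (measurableT_comp mF measurable_fst).
exact: measurable_kint1.
Qed.

Lemma measurable_Phi2 K F s p v : bounded_support K F ->
  measurable_fun setT (fun ql : heis R * R =>
    F ql.1 * kint2 s ql.2 (heis_mul (- p) ql.1) (hdir v ql.1)).
Proof.
move=> [mF _ _]; apply: measurable_funM; first exact: (measurableT_comp mF measurable_fst).
exact: measurable_kint2.
Qed.

Lemma integrable_Phis K F s p v : bounded_support K F -> 0 < s ->
  [/\ (heis_leb \x mu)%E.-integrable setT (fun ql : heis R * R =>
        (F ql.1 * kint s ql.2 (heis_mul (- p) ql.1))%:E),
      (heis_leb \x mu)%E.-integrable setT (fun ql : heis R * R =>
        (F ql.1 * kint1 s ql.2 (heis_mul (- p) ql.1) (hdir v ql.1))%:E) &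
      (heis_leb \x mu)%E.-integrable setT (fun ql : heis R * R =>
        (F ql.1 * kint2 s ql.2 (heis_mul (- p) ql.1) (hdir v ql.1))%:E)].
Proof.
move=> bF s0.
have [C [C0 HC]] := integrand_bounds K F s `|p| v bF s0.
have iG := integrable_dominator C K C0.
split; apply: le_integrable iG => //.
- by apply/measurable_EFinP; exact: (measurable_Phi K).
- move=> ql _; rewrite /= lee_fin.
  have [h _ _ _] := HC s p ql (lexx _) (hbounded_norm p).
  by apply: (le_trans h); exact: ler_norm.
- by apply/measurable_EFinP; exact: (measurable_Phi1 K).
- move=> ql _; rewrite /= lee_fin.
  have [_ h _ _] := HC s p ql (lexx _) (hbounded_norm p).
  by apply: (le_trans h); exact: ler_norm.
- by apply/measurable_EFinP; exact: (measurable_Phi2 K).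
- move=> ql _; rewrite /= lee_fin.
  have [_ _ h _] := HC s p ql (lexx _) (hbounded_norm p).
  by apply: (le_trans h); exact: ler_norm.
Qed.

Let line_hbounded p v (a e : R) : e \in `]a - 1, a + 1[ ->
  hbounded (`|p| + (`|a| + 1) * `|v|) (p + e *: v).
Proof.
move=> ea; apply: hbounded_ge (hbounded_norm _).
apply: (le_trans (ler_normD _ _)); rewrite lerD2l normrZ ler_wpM2r//.
move: ea; rewrite in_itv/= => /andP[e1 e2].
rewrite ler_norml; have := ler_norm a; have := ler_norm (- a); rewrite normrN => h1 h2.
by apply/andP; split; lra.
Qed.

Let derive_dominated (f f' : R -> heis R * R -> R) (a r C K : R) : 0 < r -> 0 <= C ->
  (forall x, x \in `]a - r, a + r[ -> measurable_fun setT (f x)) ->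
  (forall x y, x \in `]a - r, a + r[ -> `|f x y| <= dominator C K y) ->
  (forall x y, x \in `]a - r, a + r[ -> `|f' x y| <= dominator C K y) ->
  (forall x y, x \in `]a - r, a + r[ -> is_derive x 1 (f^~ y) (f' x y)) ->
  is_derive a 1 (fun x => \int[(heis_leb \x mu)%E]_y f x y)
    (\int[(heis_leb \x mu)%E]_y f' a y).
Proof.
move=> r0 C0 mf fG f'G df.
exact: (is_derive_integral _ _ (heis_leb \x mu)%E f f' a r (dominator C K) r0 mf
  (integrable_dominator C K C0) fG f'G df).
Qed.

Lemma is_derive_Phi K F s p v (e : R) : bounded_support K F -> 0 < s ->
  is_derive e 1 (fun e : R => Phi F s (p + e *: v)) (Phi1 F s (p + e *: v) v).
Proof.
move=> bF s0.
have [C [C0 HC]] := integrand_bounds K F s (`|p| + (`|e| + 1) * `|v|) v bF s0.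
refine (derive_dominated
  (fun e ql => F ql.1 * kint s ql.2 (heis_mul (- (p + e *: v)) ql.1))
  (fun e ql => F ql.1 * kint1 s ql.2 (heis_mul (- (p + e *: v)) ql.1) (hdir v ql.1))
  e 1 C K ltr01 C0 _ _ _ _).
- by move=> x _; exact: (measurable_Phi K).
- by move=> x ql xe; have [] := HC s (p + x *: v) ql (lexx _) (line_hbounded _ _ _ _ xe).
- by move=> x ql xe; have [] := HC s (p + x *: v) ql (lexx _) (line_hbounded _ _ _ _ xe).
- move=> x [q l] _ /=; rewrite heis_mul_line.
  under eq_fun do rewrite heis_mul_line.
  have H := is_derive_kint s l (heis_mul (- p) q) (hdir v q) x.
  by apply: is_derive_eq; rewrite /GRing.scale/=; ring.
Qed.

Lemma is_derive_Phi1 K F s p v (e : R) : bounded_support K F -> 0 < s ->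
  is_derive e 1 (fun e : R => Phi1 F s (p + e *: v) v) (Phi2 F s (p + e *: v) v).
Proof.
move=> bF s0.
have [C [C0 HC]] := integrand_bounds K F s (`|p| + (`|e| + 1) * `|v|) v bF s0.
refine (derive_dominated
  (fun e ql => F ql.1 * kint1 s ql.2 (heis_mul (- (p + e *: v)) ql.1) (hdir v ql.1))
  (fun e ql => F ql.1 * kint2 s ql.2 (heis_mul (- (p + e *: v)) ql.1) (hdir v ql.1))
  e 1 C K ltr01 C0 _ _ _ _).
- by move=> x _; exact: (measurable_Phi1 K).
- by move=> x ql xe; have [] := HC s (p + x *: v) ql (lexx _) (line_hbounded _ _ _ _ xe).
- by move=> x ql xe; have [] := HC s (p + x *: v) ql (lexx _) (line_hbounded _ _ _ _ xe).
- move=> x [q l] _ /=; rewrite heis_mul_line.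
  under eq_fun do rewrite heis_mul_line.
  have H := is_derive_kint1 s l (heis_mul (- p) q) (hdir v q) x.
  by apply: is_derive_eq; rewrite /GRing.scale/=; ring.
Qed.

Lemma is_derive_PhiS K F s p : bounded_support K F -> 0 < s ->
  is_derive s 1 (fun s => Phi F s p) (PhiS F s p).
Proof.
move=> bF s0; have s20 : 0 < s / 2 by rewrite divr_gt0.
have [C [C0 HC]] := integrand_bounds K F (s / 2) `|p| 0 bF s20.
have pp := hbounded_norm p.
have sx x : x \in `]s - s / 2, s + s / 2[ -> s / 2 <= x.
  by rewrite in_itv/= => /andP[? _]; lra.
refine (derive_dominated
  (fun s ql => F ql.1 * kint s ql.2 (heis_mul (- p) ql.1))
  (fun s ql => F ql.1 * kintS s ql.2 (heis_mul (- p) ql.1))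
  s (s / 2) C K s20 C0 _ _ _ _).
- by move=> x _; exact: (measurable_Phi K).
- by move=> x ql /sx xe; have [] := HC x p ql xe pp.
- by move=> x ql /sx xe; have [] := HC x p ql xe pp.
- move=> x [q l] /sx xe /=.
  have H := is_derive_kintS x l (heis_mul (- p) q) (lt_le_trans s20 xe).
  by apply: is_derive_eq; rewrite /GRing.scale/=; ring.
Qed.

(* [X] and [Y] at [p] are the directional derivatives along these vectors. *)
Definition vX p : heis R := (1, 0, - (p.1.2 / 2)).
Definition vY p : heis R := (0, 1, p.1.1 / 2).

(** The identity already holds under the integral sign: [hdir (vX p) q] and [hdir (vY p) q] are
    exactly the directions of [kint_heat] at [(- p) q]. *)
Lemma Phi_heat K F s p : bounded_support K F -> 0 < s ->
  PhiS F s p = Phi2 F s p (vX p) + Phi2 F s p (vY p).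
Proof.
move=> bF s0.
have [_ _ iX] := integrable_Phis K F s p (vX p) bF s0.
have [_ _ iY] := integrable_Phis K F s p (vY p) bF s0.
rewrite /Phi2 -RintegralD//; apply: eq_Rintegral => -[q l] _ /=.
rewrite -mulrDr -kint_heat; congr (_ * (kint2 _ _ _ _ + kint2 _ _ _ _)).
- rewrite /hdir /heis_mul/=; congr (_, _, _); rewrite ?oppr0//; by field.
- rewrite /hdir /heis_mul/=; congr (_, _, _); rewrite ?oppr0//; by field.
Qed.

(** Linearity of [kint1] in its direction and of [hdir] in [v]. It later recombines coordinate
    derivatives into X and Y. *)
Lemma Phi1_linear K F s p (a b : R) v w : bounded_support K F -> 0 < s ->
  Phi1 F s p (a *: v + b *: w) = a * Phi1 F s p v + b * Phi1 F s p w.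
Proof.
move=> bF s0.
have [_ iv _] := integrable_Phis K F s p v bF s0.
have [_ iw _] := integrable_Phis K F s p w bF s0.
rewrite /Phi1 -!RintegralZl// -RintegralD//; last 2 first.
- exact: (integrableZl measurableT a iv).
- exact: (integrableZl measurableT b iw).
apply: eq_Rintegral => -[q l] _ /=.
by rewrite /kint1 /hdot /hdir/= /GRing.scale/=; ring.
Qed.

End heat_integral.

Section sequential_continuity.
Context {R : realType}.

(** Dominated convergence is about sequences, so continuity is tested on them; if it failed, bad
    points could be chosen in the balls of radius [1 / (n + 1)]. *)
Lemma cvg_seq_continuous (T : pseudoMetricType R) (f : T -> R) (x : T) :
  (forall u : nat -> T, u n @[n --> \oo] --> x -> f (u n) @[n --> \oo] --> f x) ->
  {for x, continuous f}.
Proof.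
move=> H; apply/cvgrPdist_lt => e e0; apply: contrapT => nH.
have P n : exists y, ball x n.+1%:R^-1 y /\ ~ (`|f x - f y| < e).
  apply: contrapT => /forallNP Hn; apply: nH.
  apply/nbhs_ballP; exists n.+1%:R^-1 => /=; first by rewrite invr_gt0.
  by move=> y By; apply: contrapT => fy; apply: (Hn y).
have [u Hu] := choice P.
have ux : u n @[n --> \oo] --> x.
  apply/cvg_ballP => d d0.
  have /cvgr_lt : @harmonic R @ \oo --> 0 by exact: cvg_harmonic.
  move=> /(_ _ d0) [N _ HN]; exists N => // n Nn.
  apply: le_ball (Hu n).1; exact: ltW (HN n Nn).
have /cvgrPdist_lt/(_ _ e0)[N _ HN] := H u ux.
by have := (Hu N).2; apply; exact: (HN N (leqnn N)).
Qed.

Lemma cvg_Rintegral d (T : measurableType d) (mu : {measure set T -> \bar R})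
    (f_ : nat -> T -> R) (f G : T -> R) :
  (forall n, measurable_fun setT (f_ n)) ->
  mu.-integrable setT (EFin \o G) ->
  (forall n y, `|f_ n y| <= G y) ->
  (forall y, f_ n y @[n --> \oo] --> f y) ->
  \int[mu]_y f_ n y @[n --> \oo] --> \int[mu]_y f y.
Proof.
move=> mf iG fG fc.
have mfl : measurable_fun setT f.
  by apply: (measurable_fun_cvg (h := f_)) => // y _; exact: fc.
apply: fine_cvg; rewrite fineK; last first.
  apply: integrable_fin_num => //; apply: le_integrable iG => //.
    exact/measurable_EFinP.
  move=> y _; rewrite /= lee_fin.
  have cy : `|f_ n y| @[n --> \oo] --> `|f y| by exact: cvg_norm.
  have le0 : `|f y| <= G y.
    by rewrite -(cvg_lim (@norm_hausdorff _ _) cy); apply: limr_le;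
      [exact: cvgP cy|exact: nearW].
  exact: (le_trans le0 (ler_norm _)).
apply: (@dominated_cvg _ _ _ mu _ measurableT (fun n x => (f_ n x)%:E) _ (EFin \o G)) => //=.
- by move=> n; exact/measurable_EFinP.
- by move=> y _; apply: cvg_EFin; [exact: nearW|exact: fc].
- by move=> n y _; rewrite lee_fin.
Qed.

End sequential_continuity.

(** * Continuity of the kernel and the link between the semigroup and [Phi] *)

Section heat_kernel_properties.
Context {R : realType}.
Local Notation mu := (@lebesgue_measure R).
Implicit Types (l s K : R) (w d p q v : heis R) (F : heis R -> R).

Lemma integrable_kint_dom (C : R) :
  mu.-integrable setT (EFin \o (fun l => C * (oneDsqr l)^-1)).
Proof. exact: (integrableZl measurableT C integrable_oneDsqrV). Qed.

Lemma measurable_kint_l s w : measurable_fun setT (fun l => kint s l w).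
Proof. exact: measurable_kint. Qed.

(** In contrast with [kint_bounds], this holds uniformly on the whole group; it makes the kernel
    continuous and bounded. *)
Lemma kint_env_le s : 0 < s -> exists2 C, 0 <= C &
  forall l w, `|kint s l w| <= C * (oneDsqr l)^-1.
Proof.
move=> s0; have [C C0 HC] := ampl_poly_le s s0.
exists C => // l w; apply: le_trans (HC l s (lexx _)).
rewrite (_ : kint s l w = kenv s l w * cos (l * w.2)); last by rewrite /kint /kenv; ring.
rewrite normrM (ger0_norm (kenv_ge0 l s w s0)).
apply: ler_pM => //; [exact: kenv_ge0|exact: kenv_le|].
apply: (le_trans (normr_cos_le1 _)).
have := normr_ge0 l; set a := `|l| => a0.
rewrite expr2; nra.
Qed.

Lemma integrable_kint s w : 0 < s -> mu.-integrable setT (EFin \o (kint s ^~ w)).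
Proof.
move=> s0; have [C C0 HC] := kint_env_le s s0.
apply: le_integrable (integrable_kint_dom C) => //.
  by apply/measurable_EFinP; exact: measurable_kint_l.
move=> l _; rewrite /= lee_fin; exact: le_trans (HC l w) (ler_norm _).
Qed.

Lemma cvg_coords w : [/\ v.1.1 @[v --> w] --> w.1.1, v.1.2 @[v --> w] --> w.1.2 &
  v.2 @[v --> w] --> w.2].
Proof.
split; last exact: cvg_snd.
- by apply: (cvg_comp (fun v : heis R => v.1) fst); exact: cvg_fst.
- by apply: (cvg_comp (fun v : heis R => v.1) snd); [exact: cvg_fst|exact: cvg_snd].
Qed.

Lemma continuous_kint s l : continuous (kint s l).
Proof.
move=> w; rewrite /kint; have [c1 c2 c3] := cvg_coords w.
apply: cvgM; first apply: cvgM; last first.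
- apply: (cvg_comp _ expR); last exact: continuous_expR.
  apply: cvgN; apply: cvgM; last exact: cvg_cst.
  apply: cvgM; last exact: cvg_cst.
  by apply: cvgD; [exact: (cvgM c1 c1)|exact: (cvgM c2 c2)].
- exact: cvg_cst.
- apply: (cvg_comp _ cos); last exact: continuous_cos.
  by apply: cvgM => //; exact: cvg_cst.
Qed.

Lemma continuous_heat_kernel s : 0 < s -> continuous (heat_kernel s).
Proof.
move=> s0 w; apply: cvg_seq_continuous => u uw.
change ((8 * pi ^+ 2)^-1 * \int[mu]_l kint s l (u n) @[n --> \oo] -->
  (8 * pi ^+ 2)^-1 * \int[mu]_l kint s l w).
apply: cvgM; first exact: cvg_cst.
have [C C0 HC] := kint_env_le s s0.
apply: (cvg_Rintegral _ _ mu (fun n l => kint s l (u n)) (kint s ^~ w)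
  (fun l => C * (oneDsqr l)^-1)).
- by move=> n; exact: measurable_kint_l.
- exact: integrable_kint_dom.
- by move=> n l; exact: HC.
- by move=> l; apply: (cvg_comp u (kint s l) uw); exact: continuous_kint.
Qed.

Lemma measurable_heat_kernel s : 0 < s -> measurable_fun setT (heat_kernel s).
Proof. by move=> s0; apply: continuous_measurable_heis; exact: continuous_heat_kernel. Qed.

Lemma heis_mulVK p q : heis_mul (- p) (heis_mul p q) = q.
Proof.
case: q => [[a b] c]; rewrite /heis_mul/=; congr (_, _, _); by field.
Qed.

Lemma measurable_heis_mul p : measurable_fun setT (heis_mul p).
Proof.
have [q1 q2 q3] := measurable_coords _ (@measurable_id _ (heis R) setT).
apply: measurable_hmk; do 1 ?[exact: measurable_funD].
apply: measurable_funD; first exact: measurable_funD.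
by apply: measurable_funM => //; apply: measurable_funB; exact: measurable_funM.
Qed.

(** Translation invariance moves [p] from [F] to the kernel, and Fubini merges the frequency
    integral with the integral over the group. *)
Lemma heat_semigroupE K F s p : bounded_support K F -> 0 < s ->
  heat_semigroup s F p = (8 * pi ^+ 2)^-1 * Phi F s p.
Proof.
move=> bF s0; have [mF _ _] := bF.
have mh : measurable_fun setT (fun q => F q * heat_kernel s (heis_mul (- p) q)).
  apply: measurable_funM => //.
  exact: (measurableT_comp (measurable_heat_kernel s s0) (measurable_heis_mul (- p))).
rewrite /heat_semigroup gt_eqF//.
transitivity (\int[heis_leb]_q (F q * heat_kernel s (heis_mul (- p) q))).
  rewrite -(integral_heis_mul p _ mh).
  by apply: eq_Rintegral => q _; rewrite heis_mulVK.
have [iP _ _] := integrable_Phis K F s p 0 bF s0.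
have E q : fubini_F mu (fun ql : heis R * R =>
    (F ql.1 * kint s ql.2 (heis_mul (- p) ql.1))%:E) q =
    (F q * \int[mu]_l kint s l (heis_mul (- p) q))%:E.
  rewrite /fubini_F /= -RintegralZl//; last exact: integrable_kint.
  rewrite fineK//; apply: integrable_fin_num => //.
  exact: (integrableZl measurableT (F q) (integrable_kint s (heis_mul (- p) q) s0)).
have -> : Phi F s p = \int[heis_leb]_q (F q * \int[mu]_l kint s l (heis_mul (- p) q)).
  rewrite /Phi {1}/Rintegral -(integral12_prod_meas1 iP) [RHS]/Rintegral; congr fine.
  by apply: eq_integral => q _; exact: E.
rewrite -[RHS]RintegralZl//; last first.
  have := integrable_fubini_F iP.
  by apply: eq_integrable => // q _; exact: E.
by apply: eq_Rintegral => q _; rewrite heat_kernelE mulrCA.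
Qed.

End heat_kernel_properties.

Section heat_dilation.
Context {R : realType}.
Local Notation mu := (@lebesgue_measure R).
Implicit Types (l s K : R) (w d p q v : heis R) (F : heis R -> R).

Lemma Rintegral_affine (a b : R) (f : R -> R) : 0 < a -> measurable_fun setT f ->
  \int[mu]_x f (a * x + b) = a^-1 * \int[mu]_x f x.
Proof.
move=> a0 mf; have /measurable_EFinP mfE := mf.
have kp : (0 < a^-1) by rewrite invr_gt0.
have Ep := ge0_integral_affine a b (EFin \o f)^\+%E a0
  (measurable_funepos mfE) (fun=> funepos_ge0 _ _).
have En := ge0_integral_affine a b (EFin \o f)^\-%E a0
  (measurable_funeneg mfE) (fun=> funeneg_ge0 _ _).
rewrite /Rintegral [in LHS]integralE [in RHS]integralE.
rewrite (_ : integral _ _ (funepos (fun x => _)) =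
  ((a^-1)%:E * \int[mu]_x (EFin \o f)^\+ x)%E); last first.
  by rewrite -Ep; apply: eq_integral => p _; rewrite !funeposE.
rewrite (_ : integral _ _ (funeneg (fun x => _)) =
  ((a^-1)%:E * \int[mu]_x (EFin \o f)^\- x)%E); last first.
  by rewrite -En; apply: eq_integral => p _; rewrite !funenegE.
rewrite [in RHS](_ : integral _ _ (funepos _) = (\int[mu]_x (EFin \o f)^\+ x)%E)//.
rewrite [in RHS](_ : integral _ _ (funeneg _) = (\int[mu]_x (EFin \o f)^\- x)%E)//.
set X := integral _ _ _; set Y := integral _ _ _.
have X0 : (0 <= X)%E by exact: integral_ge0.
have Y0 : (0 <= Y)%E by exact: integral_ge0.
move: X Y X0 Y0 => [x||] [y||] //= _ _;
  by rewrite ?gt0_muley ?lte_fin//= ?mulrBr ?mulr0.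
Qed.

(* Time [r ^ 2] corresponds to the dilation by [r]. *)
Definition dil (r : R) q : heis R := (r * q.1.1, r * q.1.2, r ^+ 2 * q.2).

Lemma kint_dil (r l : R) q : 0 < r ->
  kint (r ^+ 2) (r ^- 2 * l + 0) (dil r q) = r ^- 2 * kint 1 l q.
Proof.
move=> r0; have rn0 : r != 0 by rewrite gt_eqF.
rewrite /kint /ampl /rate /dil /= !addr0 mulr1.
rewrite (_ : r ^- 2 * l * (r ^+ 2 * q.2) = l * q.2); last by field.
rewrite (_ : r ^- 2 * l * r ^+ 2 = l); last by field.
rewrite (_ : ((r * q.1.1) ^+ 2 + (r * q.1.2) ^+ 2) / 4 * (r ^- 2 * l * coth l) =
  (q.1.1 ^+ 2 + q.1.2 ^+ 2) / 4 * (l * coth l)); last by field.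
ring.
Qed.

(** One factor [r ^- 2] comes from the substitution in [l] and one from [ampl]. The exponent 4 is
    the homogeneous dimension, so the Jacobian of the dilation cancels it in
    [heat_semigroup_dil]. *)
Lemma heat_kernel_dil (r : R) q : 0 < r ->
  heat_kernel (r ^+ 2) (dil r q) = r ^- 4 * heat_kernel 1 q.
Proof.
move=> r0; have rn0 : r != 0 by rewrite gt_eqF.
rewrite !heat_kernelE [RHS]mulrCA; congr (_ * _).
have r2 : 0 < r ^- 2 by rewrite invr_gt0 exprn_gt0.
have := Rintegral_affine (r ^- 2) 0 (fun l => kint (r ^+ 2) l (dil r q)) r2
  (measurable_kint_l _ _).
under eq_Rintegral do rewrite kint_dil//.
have -> : \int[mu]_x (r ^- 2 * kint 1 x q) = r ^- 2 * \int[mu]_x kint 1 x q.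
  exact: (RintegralZl (r ^- 2) measurableT (integrable_kint 1 q ltr01)).
set I := \int[mu]_x kint 1 x q; set J := \int[mu]_x kint _ x (dil r q).
clearbody I J; rewrite invrK => H.
have -> : r ^- 4 * I = r ^- 2 * (r ^- 2 * I) by field.
by rewrite H; field.
Qed.

Lemma measurable_dil (r : R) : measurable_fun setT (dil r).
Proof.
have [q1 q2 q3] := measurable_coords _ (@measurable_id _ (heis R) setT).
by apply: measurable_hmk; exact: measurable_funM.
Qed.

Lemma integrable_mul_bounded (k F : heis R -> R) (M : R) :
  heis_leb.-integrable setT (EFin \o k) -> measurable_fun setT F ->
  (forall q, `|F q| <= M) ->
  heis_leb.-integrable setT (EFin \o (fun q => F q * k q)).
Proof.
move=> ik mF FM; have /integrableP[/measurable_EFinP mk _] := ik.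
apply: le_integrable (integrableZl measurableT M ik) => //.
  by apply/measurable_EFinP; exact: measurable_funM.
move=> q _; rewrite /= lee_fin !normrM ler_wpM2r//.
exact: le_trans (FM q) (ler_norm _).
Qed.

Lemma heat_semigroup_dil (r M : R) F p :
  heis_leb.-integrable setT (EFin \o heat_kernel (R := R) 1) ->
  0 < r -> measurable_fun setT F -> (forall q, `|F q| <= M) ->
  heat_semigroup (r ^+ 2) F p =
  \int[heis_leb]_q (F (heis_mul p (dil r q)) * heat_kernel 1 q).
Proof.
move=> ih r0 mF FM; have rn0 : r != 0 by rewrite gt_eqF.
have r2 : 0 < r ^+ 2 by rewrite exprn_gt0.
rewrite /heat_semigroup (gt_eqF r2).
have mh : measurable_fun setT (fun q => F (heis_mul p q) * heat_kernel (r ^+ 2) q).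
  apply: measurable_funM; last exact: measurable_heat_kernel.
  exact: (measurableT_comp mF (measurable_heis_mul p)).
have ig : heis_leb.-integrable setT
    (EFin \o (fun q => F (heis_mul p (dil r q)) * heat_kernel 1 q)).
  apply: (integrable_mul_bounded _ (fun q => F (heis_mul p (dil r q))) M ih) => //.
  exact: (measurableT_comp mF (measurableT_comp (measurable_heis_mul p) (measurable_dil r))).
have E1 := integral_heis_dilation r _ r0 mh.
have E2 : \int[heis_leb]_q
    (F (heis_mul p (r * q.1.1, r * q.1.2, r ^+ 2 * q.2)) *
     heat_kernel (r ^+ 2) (r * q.1.1, r * q.1.2, r ^+ 2 * q.2)) = r ^- 4 *
    \int[heis_leb]_q (F (heis_mul p (dil r q)) * heat_kernel 1 q).
  rewrite -(RintegralZl (r ^- 4) measurableT ig); apply: eq_Rintegral => q _.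
  by rewrite -/(dil r q) heat_kernel_dil// mulrCA.
apply: (mulfI (_ : r ^- 4 != 0)); first by rewrite invr_eq0 expf_neq0.
exact: etrans (esym E1) E2.
Qed.

End heat_dilation.

(** * Test functions and nonnegativity of the kernel *)

Section heis_calculus.
Context {R : realType}.
Implicit Types (p q v w : heis R) (f g F : heis R -> R).

Lemma is_derive_line f p v (df : R) :
  is_derive (0 : R) 1 (fun e : R => f (p + e *: v)) df -> is_derive p v f df.
Proof.
move=> [d1 d2].
have E : (fun h : R => h^-1 *: ((f \o shift p) (h *: v) - f p)) =
   (fun h : R => h^-1 *: (((fun e : R => f (p + e *: v)) \o shift (0 : R)) (h *: (1 : R))
     - f (p + (0 : R) *: v))).
  apply/funext => h; congr (_ *: (_ - _)); rewrite /= ?scale0r ?addr0//.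
  by rewrite [h *: 1]mulr1 addrC.
by apply: DeriveDef; [rewrite /derivable E|rewrite /derive E].
Qed.

Lemma derive_line_is_derive f p v (e : R) : differentiable f (p + e *: v) ->
  is_derive e 1 (fun e : R => f (p + e *: v)) ('D_v f (p + e *: v)).
Proof.
move=> df.
have E : (fun h : R => h^-1 *: ((f \o shift (p + e *: v)) (h *: v) - f (p + e *: v))) =
   (fun h : R => h^-1 *: (((fun e : R => f (p + e *: v)) \o shift e) (h *: (1 : R))
     - f (p + e *: v))).
  apply/funext => h; congr (_ *: (_ - _)); rewrite /=.
  by rewrite [h *: 1]mulr1 scalerDl addrCA.
have dv : derivable f (p + e *: v) v by exact: diff_derivable.
by apply: DeriveDef; [move: dv; rewrite /derivable E|rewrite /derive E].
Qed.

Lemma heis_basis0 : heis_basis 0 = (1, 0, 0) :> heis R. Proof. by []. Qed.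
Lemma heis_basis1 : heis_basis 1 = (0, 1, 0) :> heis R. Proof. by []. Qed.
Lemma heis_basis2 : heis_basis (lift 0 (lift 0 0)) = (0, 0, 1) :> heis R.
Proof. by []. Qed.

Lemma fieldX_derive f p : differentiable f p -> fieldX f p = 'D_(vX p) f p.
Proof.
move=> df; rewrite /fieldX !deriveE//.
have -> : vX p = (1, 0, 0) - (p.1.2 / 2) *: (0, 0, 1).
  transitivity ((1 - p.1.2 / 2 * 0, 0 - p.1.2 / 2 * 0, 0 - p.1.2 / 2 * 1) : heis R).
    by rewrite /vX; congr (_, _, _); ring.
  by [].
by rewrite linearB; congr (_ - _); rewrite linearZ.
Qed.

Lemma smooth_differentiable f p : smooth f -> differentiable f p.
Proof. by move=> sf; exact: (sf [::] p). Qed.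

Lemma smooth_continuous f : smooth f -> continuous f.
Proof. by move=> sf p; apply: differentiable_continuous; exact: smooth_differentiable. Qed.

Lemma smooth_partial f i : smooth f -> smooth (partial i f).
Proof. by move=> sf s p; have := sf (rcons s i) p; rewrite /partials foldr_rcons. Qed.

Lemma continuous_fieldX f : smooth f -> continuous (fieldX f).
Proof.
move=> sf p; have [c1 c2 c3] := cvg_coords p.
have h0 : {for p, continuous (partial 0 f)} by exact/smooth_continuous/smooth_partial.
have h2 : {for p, continuous (partial (lift 0 (lift 0 0)) f)}.
  exact/smooth_continuous/smooth_partial.
apply: cvgB; first exact: h0.
by apply: cvgM; [apply: cvgM => //; exact: cvg_cst|exact: h2].
Qed.

Lemma continuous_fieldY f : smooth f -> continuous (fieldY f).
Proof.
move=> sf p; have [c1 c2 c3] := cvg_coords p.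
have h0 : {for p, continuous (partial 1 f)} by exact/smooth_continuous/smooth_partial.
have h2 : {for p, continuous (partial (lift 0 (lift 0 0)) f)}.
  exact/smooth_continuous/smooth_partial.
apply: cvgD; first exact: h0.
by apply: cvgM; [apply: cvgM => //; exact: cvg_cst|exact: h2].
Qed.

Lemma grad_norm_ge0 f p : 0 <= grad_norm f p.
Proof. exact: sqrtr_ge0. Qed.

Lemma grad_norm_sqr f p : grad_norm f p ^+ 2 = fieldX f p ^+ 2 + fieldY f p ^+ 2.
Proof. by rewrite sqr_sqrtr// addr_ge0// sqr_ge0. Qed.

Lemma continuous_grad_norm f : smooth f -> continuous (grad_norm f).
Proof.
move=> sf p.
have cX := @continuous_fieldX f sf p; have cY := @continuous_fieldY f sf p.
apply: (cvg_comp _ Num.sqrt); last exact: sqrt_continuous.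
by apply: cvgD; [exact: (cvgM cX cX)|exact: (cvgM cY cY)].
Qed.

Lemma hboundedP (K : R) p : 0 <= K -> (hbounded K p <-> `|p| <= K).
Proof.
move=> K0; split => [[]|pK].
  case: p => [[x y] z] /= h1 h2 h3.
  by rewrite prod_normE ge_max prod_normE ge_max/= h1 h2 h3.
exact: hbounded_ge pK (hbounded_norm p).
Qed.

Lemma compact_hbounded (K : R) : compact [set p : heis R | hbounded K p].
Proof.
by rewrite hboundedE; do 2?[apply: compact_setX]; exact: segment_compact.
Qed.

Lemma partial_eq0 f (K : R) i : (forall p, K < `|p| -> f p = 0) ->
  forall p, K < `|p| -> partial i f p = 0.
Proof.
move=> f0 p Kp; rewrite /partial.
have -> : 'D_(heis_basis i) f p = 'D_(heis_basis i) (cst 0) p.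
  apply: near_eq_derive.
  have /cvgr_gt/(_ _ Kp) := @norm_continuous _ _ p.
  by apply: filterS => q /f0.
exact: derive_cst.
Qed.

Lemma partials_eq0 f (K : R) s : (forall p, K < `|p| -> f p = 0) ->
  forall p, K < `|p| -> partials s f p = 0.
Proof. by move=> f0; elim: s => // i s IH; exact: partial_eq0. Qed.

Lemma continuous_bounded_support f (K : R) : continuous f ->
  (forall p, K < `|p| -> f p = 0) -> exists M, bounded_support M f.
Proof.
move=> cf f0.
have K'0 : 0 <= `|K| by exact: normr_ge0.
have ne0 : [set p : heis R | hbounded `|K| p] !=set0.
  by exists 0; rewrite /= /hbounded /= normr0; split.
have cnf : {within [set p : heis R | hbounded `|K| p], continuous (fun p => `|f p|)}.
  by apply: continuous_subspaceT => p; apply: cvg_norm; exact: cf.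
have [q _ Hq] := compact_EVT_max ne0 (compact_hbounded `|K|) cnf.
have M0 : 0 <= `|f q| by exact: normr_ge0.
have fK p : ~ hbounded `|K| p -> f p = 0.
  move=> nb; apply: f0; rewrite ltNge; apply/negP => pK; apply: nb.
  by apply/hboundedP => //; exact: le_trans (ler_norm K).
(* The same constant must bound the values and the support. *)
exists (`|f q| + `|K|); split.
- exact: continuous_measurable_heis.
- move=> p; have [bp|/fK ->] := pselect (hbounded `|K| p); last by rewrite normr0 addr_ge0.
  by apply: (le_trans (Hq p _)); [rewrite inE|rewrite lerDl].
- move=> p fp; have [bp|/fK fp0] := pselect (hbounded `|K| p).
    by apply: hbounded_ge bp; rewrite lerDr.
  by rewrite fp0 eqxx in fp.
Qed.

Lemma bounded_support_poly_growth f (K : R) : smooth f ->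
  (forall p, K < `|p| -> f p = 0) -> smooth_poly_growth f.
Proof.
move=> sf f0; split => // s.
have cs : continuous (partials s f) by move=> p; apply: differentiable_continuous; exact: sf.
have [M [_ HM _]] := continuous_bounded_support _ K cs (partials_eq0 f K s f0).
by exists M, 0%N => p; rewrite expr0 mulr1.
Qed.

Lemma grad_norm_eq0 f (K : R) : (forall p, K < `|p| -> f p = 0) ->
  forall p, K < `|p| -> grad_norm f p = 0.
Proof.
move=> f0 p Kp; rewrite /grad_norm /fieldX /fieldY.
rewrite -heis_basis0 -heis_basis1 -heis_basis2.
rewrite -/(partial 0 f p) -/(partial 1 f p) -/(partial (lift 0 (lift 0 0)) f p).
by rewrite !(partial_eq0 f K)// !mulr0 subrr addr0 expr0n/= addr0 sqrtr0.
Qed.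

End heis_calculus.

(** * Smooth bump functions of compact support *)

Section smooth_real.
Context {R : realType}.
Implicit Types (f g : R -> R).

(** The derivative is an existential witness, so closure under sums, products and affine
    substitutions follows by induction without a formula for higher derivatives. *)
Fixpoint derivable_times (k : nat) f : Prop :=
  if k is k'.+1 then exists2 g, derivable_times k' g & forall x : R, is_derive x 1 f (g x)
  else True.

Lemma derivable_timesS k f : derivable_times k.+1 f -> derivable_times k f.
Proof.
elim: k f => // k IH f [g gk fg]; exists g => //; exact: IH.
Qed.

Lemma derivable_timesD k f g : derivable_times k f -> derivable_times k g ->
  derivable_times k (fun x => f x + g x).
Proof.
elim: k f g => // k IH f g [f' f'k df] [g' g'k dg].
exists (fun x => f' x + g' x); first exact: IH.
by move=> x; have := df x; have := dg x => ? ?; apply: is_deriveD.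
Qed.

Lemma derivable_timesZ k (a : R) f : derivable_times k f ->
  derivable_times k (fun x => a * f x).
Proof.
elim: k f => // k IH f [f' f'k df].
exists (fun x => a * f' x); first exact: IH.
by move=> x; have := df x => ?; apply: is_derive_eq; rewrite /GRing.scale/=; ring.
Qed.

Lemma derivable_timesM k f g : derivable_times k f -> derivable_times k g ->
  derivable_times k (fun x => f x * g x).
Proof.
elim: k f g => // k IH f g fk gk.
have [f' f'k df] := fk; have [g' g'k dg] := gk.
exists (fun x => f' x * g x + f x * g' x).
  by apply: derivable_timesD; apply: IH => //; exact: derivable_timesS.
move=> x; have := df x; have := dg x => ? ?.
by apply: is_derive_eq; rewrite /GRing.scale/=; ring.
Qed.

Lemma derivable_times_affine k f (a b : R) : derivable_times k f ->
  derivable_times k (fun x => f (a * x + b)).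
Proof.
elim: k f => // k IH f [f' f'k df].
exists (fun x => a * f' (a * x + b)); first by apply: derivable_timesZ; exact: IH.
move=> x; have H := df (a * x + b).
have H2 : is_derive x 1 (fun x => a * x + b) a.
  by apply: is_derive_eq; rewrite /GRing.scale/=; ring.
by rewrite mulrC; exact: is_derive1_comp.
Qed.

(** The classical [expR (- 1 / u)] divided by [u ^ n]. With all these powers the family is stable
    under differentiation up to linear combinations. *)
Definition flat (n : nat) (u : R) : R :=
  if 0 < u then (u^-1) ^+ n * expR (- u^-1) else 0.

(** From [expR v >= v ^ (n + 2) / (n + 2)!] at [v = 1 / u]. The quadratic bound forces the
    derivative at 0 to exist and vanish. *)
Lemma flat_le n (u : R) : `|flat n u| <= (n.+2)`!%:R * u ^+ 2.
Proof.
rewrite /flat; case: ifPn => [u0|_]; last by rewrite normr0 mulr_ge0// sqr_ge0.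
have un0 : u != 0 by rewrite gt_eqF.
have v0 : 0 < u^-1 by rewrite invr_gt0.
rewrite ger0_norm; last by rewrite mulr_ge0 ?expR_ge0// exprn_ge0// ltW.
have e0 := expR_gt0 (u^-1).
rewrite expRN ler_pdivrMr//.
have h := expR_ge1Dxn n.+1 (ltW v0).
have f0 : 0 < (n.+2)`!%:R :> R by rewrite ltr0n fact_gt0.
have {}h : u^-1 ^+ n.+2 / (n.+2)`!%:R <= expR u^-1 by apply: le_trans h; rewrite lerDr.
have c0 : 0 <= (n.+2)`!%:R * u ^+ 2 by rewrite mulr_ge0 ?sqr_ge0// ltW.
apply: le_trans (ler_wpM2l c0 h).
rewrite le_eqVlt; apply/orP; left; apply/eqP.
rewrite !exprS; set X := _ ^+ n; clearbody X.
by field; rewrite un0 gt_eqF.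
Qed.

Lemma is_derive_flat n (u : R) :
  is_derive u 1 (flat n) (- n%:R * flat n.+1 u + flat n.+2 u).
Proof.
have [u0|u0|u0] := ltgtP u 0.
- rewrite /flat ltNge (ltW u0)/= mulr0 addr0.
  have H0 : \forall v \near u, cst 0 v = if 0 < v then v^-1 ^+ n * expR (- v^-1) else 0.
    have : \forall v \near u, v < 0 by exact: lt_nbhsl.
    by apply: filterS => v v0; rewrite ltNge (ltW v0).
  exact: near_eq_is_derive H0 (is_derive_cst 0 u 1).
- have un0 : u != 0 by rewrite gt_eqF.
  rewrite /flat u0.
  have H0 : \forall v \near u, v^-1 ^+ n * expR (- v^-1) =
      if 0 < v then v^-1 ^+ n * expR (- v^-1) else 0.
    have : \forall v \near u, 0 < v by exact: lt_nbhsr.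
    by apply: filterS => v ->.
  suff : is_derive u 1 (fun u : R => u^-1 ^+ n * expR (- u^-1))
      (- n%:R * (u^-1 ^+ n.+1 * expR (- u^-1)) + u^-1 ^+ n.+2 * expR (- u^-1)).
    exact: near_eq_is_derive.
  have H : is_derive u 1 (fun u : R => u^-1) (- u^-1 ^+ 2).
    have H1 : is_derive u (1 : R) (fun u : R => u) 1 by exact: is_derive_id.
    have H2 : is_derive u (1 : R) (fun u : R => u^-1) (- u ^- 2 *: 1) by exact: is_deriveV.
    by move: H2; rewrite /GRing.scale/= mulr1 exprVn.
  clear H0; case: n => [|n].
    under eq_fun do rewrite expr0 mul1r.
    apply: is_derive_eq; rewrite /GRing.scale/=; by ring.
  have Hn : is_derive u 1 (fun u : R => u^-1 ^+ n.+1) (n.+1%:R * u^-1 ^+ n * (- u^-1 ^+ 2)).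
    have -> : (fun u : R => u^-1 ^+ n.+1) = (fun u : R => u^-1) ^+ n.+1.
      by rewrite exprfctE.
    exact: is_deriveX.
  apply: is_derive_eq; rewrite /GRing.scale/= !exprS; by ring.
- rewrite u0.
  have -> : - n%:R * flat n.+1 0 + flat n.+2 0 = 0 by rewrite /flat ltxx mulr0 addr0.
  have H : h^-1 *: ((flat n \o shift (0 : R)) (h *: (1 : R)) - flat n 0) @[h --> 0^'] --> (0 : R).
    apply/cvgr0Pnorm_le => e e0.
    have f0 : 0 < (n.+2)`!%:R :> R by rewrite ltr0n fact_gt0.
    have d0 : 0 < e / (n.+2)`!%:R by rewrite divr_gt0.
    near=> h.
    have hn0 : h != 0 by near: h; exact: nbhs_dnbhs_neq.
    rewrite /= addr0 [h *: 1]mulr1 {2}/flat ltxx subr0 normrM normfV.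
    rewrite ler_pdivrMl ?normr_gt0//.
    apply: (le_trans (flat_le n h)).
    have hd : `|h| <= e / (n.+2)`!%:R.
      by near: h; apply: dnbhs0_le.
    rewrite -real_normK ?num_real// expr2 mulrA mulrC ler_wpM2l//.
    by rewrite mulrC -ler_pdivlMr.
  by apply: DeriveDef; [apply: cvgP H|exact: cvg_lim H].
Unshelve. all: end_near. Qed.

Lemma derivable_times_flat k n : derivable_times k (flat n).
Proof.
elim: k n => // k IH n.
exists (fun u => - n%:R * flat n.+1 u + flat n.+2 u); last by move=> u; exact: is_derive_flat.
by apply: derivable_timesD; [exact: derivable_timesZ|].
Qed.

(** Positive exactly on the open interval from -1 to 1. The factors [1] and [- 1] match the form of
    [derivable_times_affine]. *)
Definition cutoff (u : R) : R := flat 0 (1 * u + 1) * flat 0 (- 1 * u + 1).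

Lemma derivable_times_cutoff k : derivable_times k cutoff.
Proof.
by apply: derivable_timesM; apply: (derivable_times_affine _ (flat 0)); exact: derivable_times_flat.
Qed.

Lemma cutoff_eq0 (u : R) : 1 <= `|u| -> cutoff u = 0.
Proof.
rewrite /cutoff /flat; case: ifPn; last by rewrite mul0r.
case: ifPn; last by rewrite mulr0.
move=> h1 h2; rewrite leNgt ltr_norml; lra.
Qed.

Lemma cutoff0_neq0 : cutoff 0 != 0.
Proof. by rewrite /cutoff /flat !mulr0 add0r ltr01 gt_eqF// !mulr_gt0// ?expR_gt0 ?expr0. Qed.

End smooth_real.

Section product_smooth.
Context {R : realType}.

Definition prod3 (a b c : R -> R) (p : heis R) : R := a p.1.1 * b p.1.2 * c p.2.

Let sm (f : R -> R) := forall k, derivable_times k f.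

Let sm_derive f : sm f -> sm ((derive1 f)) /\ forall x : R, is_derive x 1 f ((derive1 f) x).
Proof.
move=> sf; have [g _ dg] := sf 1%N.
have E : (derive1 f) = g by apply/funext => x; rewrite derive1E; have := dg x => H; exact: derive_val.
split => [k|]; last by rewrite E.
have [h hk dh] := sf k.+1.
suff -> : (derive1 f) = h by [].
by apply/funext => x; rewrite derive1E; have := dh x => H; exact: derive_val.
Qed.

Lemma differentiable_prod3 a b c p : (forall k, derivable_times k a) ->
  (forall k, derivable_times k b) -> (forall k, derivable_times k c) ->
  differentiable (prod3 a b c) p.
Proof.
move=> sa sb sc.
have d1 (f : R -> R) x : sm f -> differentiable f x.
  move=> /sm_derive[_ /(_ x) H]; apply/derivable1_diffP; exact: ex_derive.
have dfst (U V : normedModType R) (x : U * V) : differentiable (@fst U V) x.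
  by apply: linear_differentiable => y; exact: cvg_fst.
have dsnd (U V : normedModType R) (x : U * V) : differentiable (@snd U V) x.
  by apply: linear_differentiable => y; exact: cvg_snd.
have f1 : differentiable (fun p : heis R => p.1.1) p.
  by apply: (@differentiable_comp _ _ _ _ fst fst).
have f2 : differentiable (fun p : heis R => p.1.2) p.
  by apply: (@differentiable_comp _ _ _ _ fst snd).
have f3 : differentiable (fun p : heis R => p.2) p by [].
apply: differentiableM; first apply: differentiableM.
- by apply: differentiable_comp => //; exact: d1.
- by apply: differentiable_comp => //; exact: d1.
- by apply: differentiable_comp => //; exact: d1.
Qed.

(** Products of one-variable functions are stable under partial derivatives, so differentiability of
    all iterated partials reduces to that of [prod3]. *)
Lemma partial_prod3 a b c i : sm a -> sm b -> sm c ->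
  exists a' b' c', [/\ sm a', sm b', sm c' & partial i (prod3 a b c) = prod3 a' b' c'].
Proof.
move=> sa sb sc.
have [sa' da] := sm_derive _ sa; have [sb' db] := sm_derive _ sb.
have [sc' dc] := sm_derive _ sc.
have D (v : heis R) p df : is_derive (0 : R) 1 (fun e : R => prod3 a b c (p + e *: v)) df ->
    'D_v (prod3 a b c) p = df.
  by move=> /is_derive_line H; exact: derive_val.
have A (f f' : R -> R) (x : R) : (forall x : R, is_derive x 1 f (f' x)) ->
    is_derive (0 : R) 1 (fun e : R => f (x + e * 1)) (f' x).
  move=> df; have := df (x + 0 * 1) => H.
  have H2 : is_derive (0 : R) 1 (fun e : R => x + e * 1) 1.
    by apply: is_derive_eq; rewrite /GRing.scale/=; ring.
  have := @is_derive1_comp R f (fun e : R => x + e * 1) 0 _ _ H H2.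
  by rewrite mulr1 mul0r addr0.
have A0 (f : R -> R) (x : R) : is_derive (0 : R) 1 (fun e : R => f (x + e * 0)) 0.
  by under eq_fun do rewrite mulr0; exact: is_derive_cst.
have i3 : i = 0 \/ i = 1 \/ i = lift 0 (lift 0 0).
  case: i => [[|[|[|//]]] Hi]; [left|right; left|right; right]; exact: val_inj.
case: i3 => [->|[->|->]].
- exists (derive1 a), b, c; split => //; apply/funext => p; rewrite /partial heis_basis0; apply: D.
  have H1 := A _ _ p.1.1 da; have H2 := A0 b p.1.2; have H3 := A0 c p.2.
  rewrite /prod3 /=; apply: is_derive_eq.
  by rewrite /GRing.scale/= !mul0r !mulr0 !addr0; ring.
- exists a, (derive1 b), c; split => //; apply/funext => p; rewrite /partial heis_basis1; apply: D.
  have H1 := A0 a p.1.1; have H2 := A _ _ p.1.2 db; have H3 := A0 c p.2.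
  rewrite /prod3 /=; apply: is_derive_eq.
  by rewrite /GRing.scale/= !mul0r !mulr0 !addr0; ring.
- exists a, b, (derive1 c); split => //; apply/funext => p; rewrite /partial heis_basis2; apply: D.
  have H1 := A0 a p.1.1; have H2 := A0 b p.1.2; have H3 := A _ _ p.2 dc.
  rewrite /prod3 /=; apply: is_derive_eq.
  by rewrite /GRing.scale/= !mul0r !mulr0 !addr0; ring.
Qed.

Lemma smooth_prod3 a b c : (forall k, derivable_times k a) ->
  (forall k, derivable_times k b) -> (forall k, derivable_times k c) ->
  smooth (prod3 a b c).
Proof.
move=> sa sb sc s p.
suff [a' [b' [c' [sa' sb' sc' ->]]]] : exists a' b' c', [/\ sm a', sm b', sm c' &
    partials s (prod3 a b c) = prod3 a' b' c'] by exact: differentiable_prod3.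
elim: s => [|i s [a' [b' [c' [sa' sb' sc' /= ->]]]]]; first by exists a, b, c.
exact: partial_prod3.
Qed.

End product_smooth.

Section heat_kernel_positivity.
Context {R : realType}.
Let mu : set R -> \bar R := @lebesgue_measure R.
Implicit Types (p q v w : heis R) (f g F : heis R -> R).

Lemma heis_integrable_indic (A : set (heis R)) : measurable A ->
  (heis_leb A < +oo)%E -> heis_leb.-integrable setT (EFin \o (\1_A : heis R -> R)).
Proof.
move=> mA Ay; apply/integrableP; split.
  by apply/measurable_EFinP; exact: measurable_indic.
rewrite (_ : integral _ _ _ = \int[heis_leb]_x (\1_A x)%:E)%E.
  by rewrite integral_indic// setIT.
by apply: eq_integral => t _; rewrite /= ger0_norm.
Qed.

Lemma bounded_support_integrable K F : bounded_support K F ->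
  heis_leb.-integrable setT (EFin \o F).
Proof.
move=> [mF FK Fs].
have mh := @measurable_hbounded R K.
have ik : heis_leb.-integrable setT (EFin \o (\1_[set q : heis R | hbounded K q] : heis R -> R)).
  exact: (heis_integrable_indic _ mh (heis_leb_hbounded K)).
have := integrable_mul_bounded _ F K ik mF FK.
apply: eq_integrable => // q _ /=; congr EFin.
have [->|/Fs Fq] := eqVneq (F q) 0; first by rewrite mul0r.
by rewrite indicE mem_set// mulr1.
Qed.

(** [F] exceeds [F q / 2] on a sup-norm ball of radius [r], a cube of volume [8 r ^ 3]. *)
Lemma continuous_integral_gt0 K F q : bounded_support K F -> continuous F ->
  (forall p, 0 <= F p) -> 0 < F q -> 0 < \int[heis_leb]_p F p.
Proof.
move=> bF cF F0 Fq.
have Fq2 : 0 < F q / 2 by rewrite divr_gt0.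
have := cF q => /cvgr_gt /(_ (F q / 2)) H.
have /nbhs_ballP[r /= r0 Hr] : \forall p \near q, F q / 2 < F p by apply: H; lra.
have mB : measurable (ball q r) by apply: open_measurable_heis; exact: ball_open.
have iF := bounded_support_integrable K F bF.
have mu0 : heis_leb (ball q r) = (8 * r ^+ 3)%:E.
  rewrite heis_ballE /heis_leb product_measure1E//; last 2 first.
  - by apply: measurableX; exact: measurable_ball.
  - exact: measurable_ball.
  rewrite [X in (X * _)%E]product_measure1E; last 2 first.
  - exact: measurable_ball.
  - exact: measurable_ball.
  transitivity (mu (ball q.1.1 r) * mu (ball q.1.2 r) * mu (ball q.2 r))%E; first by [].
  rewrite /mu !lebesgue_measure_ball ?(ltW r0)// -!EFinM; congr EFin; by ring.
have iB : heis_leb.-integrable setT (EFin \o (\1_(ball q r) : heis R -> R)).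
  by apply: heis_integrable_indic => //; rewrite mu0 ltry.
have E : \int[heis_leb]_p (F q / 2 * (\1_(ball q r) p)) = F q / 2 * (8 * r ^+ 3).
  rewrite (RintegralZl (F q / 2) measurableT iB); congr (_ * _).
  by rewrite /Rintegral integral_indic// setIT; exact: (congr1 fine mu0).
apply: (@lt_le_trans _ _ (F q / 2 * (8 * r ^+ 3))).
  by rewrite mulr_gt0// mulr_gt0// exprn_gt0.
rewrite -E; apply: le_Rintegral => //.
- exact: (integrableZl measurableT (F q / 2) iB).
- move=> p _; rewrite indicE; have [pB|pB] := pselect (ball q r p).
    by rewrite mem_set// mulr1; apply: ltW; exact: Hr.
  by rewrite memNset// mulr0.
Qed.

Definition bump_at q (d : R) : heis R -> R :=
  prod3 (fun x : R => cutoff (d^-1 * x + - (q.1.1 / d)))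
        (fun x : R => cutoff (d^-1 * x + - (q.1.2 / d)))
        (fun x : R => cutoff (d^-1 * x + - (q.2 / d))).

Lemma smooth_bump_at q d : smooth (bump_at q d).
Proof.
by apply: smooth_prod3 => k;
  exact: (derivable_times_affine _ cutoff _ _ (derivable_times_cutoff k)).
Qed.

Lemma bump_at_neq0 q d p : 0 < d -> bump_at q d p != 0 ->
  [/\ `|p.1.1 - q.1.1| < d, `|p.1.2 - q.1.2| < d & `|p.2 - q.2| < d].
Proof.
move=> d0 h.
have P (a b : R) : cutoff (d^-1 * a + - (b / d)) != 0 -> `|a - b| < d.
  apply: contraR; rewrite -leNgt => dab; apply/eqP/cutoff_eq0.
  rewrite (_ : _ + _ = (a - b) / d); last by rewrite mulrBl mulrC.
  by rewrite normrM normfV (gtr0_norm d0) ler_pdivlMr// mul1r.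
split; apply: P; apply: contraNneq h; rewrite /bump_at /prod3 => ->.
- by rewrite !mul0r.
- by rewrite mulr0 mul0r.
- by rewrite mulr0.
Qed.

Lemma bump_at_center q d : bump_at q d q != 0.
Proof.
have P (a : R) : cutoff (d^-1 * a + - (a / d)) != 0.
  by rewrite mulrC subrr cutoff0_neq0.
exact: (mulf_neq0 (mulf_neq0 (P _) (P _)) (P _)).
Qed.

Lemma bump_at_eq0 q d p : 0 < d -> `|q| + d < `|p| -> bump_at q d p = 0.
Proof.
move=> d0 qp; apply/eqP; apply: contraTT qp => /(bump_at_neq0 q d p d0)[h1 h2 h3].
rewrite -leNgt; apply/hboundedP; first by rewrite addr_ge0// ltW.
have [q1 q2 q3] := hbounded_norm q.
have P (a b : R) : `|a - b| < d -> `|b| <= `|q| -> `|a| <= `|q| + d.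
  move=> ab bq; rewrite -(subrK b a) (le_trans (ler_normD _ _))// addrC.
  by apply: lerD => //; exact: ltW.
by split; [exact: P h1 q1|exact: P h2 q2|exact: P h3 q3].
Qed.

(** Otherwise X would annihilate the bump, which would be constant along the line [q + e *: vX q],
    an integral curve of X. At [e = d] the first coordinate has moved by [d] and the bump vanishes,
    unlike at its centre. *)
Lemma grad_bump_at q d : 0 < d -> exists p, 0 < grad_norm (bump_at q d) p.
Proof.
move=> d0; apply: contrapT => /forallNP H.
have sf := smooth_bump_at q d.
have X0 p : fieldX (bump_at q d) p = 0.
  have := H p => /negP; rewrite -leNgt => h.
  have /eqP : grad_norm (bump_at q d) p = 0.
    by apply/eqP; rewrite eq_le h grad_norm_ge0.
  rewrite -(eqrXn2 (n := 2))// ?grad_norm_ge0// grad_norm_sqr expr0n/=.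
  by rewrite paddr_eq0 ?sqr_ge0// => /andP[]; rewrite sqrf_eq0 => /eqP.
have der (e : R) : is_derive e (1 : R) (fun e : R => bump_at q d (q + e *: vX q)) 0.
  have := derive_line_is_derive (bump_at q d) q (vX q) e (smooth_differentiable _ _ sf).
  have -> : 'D_(vX q) (bump_at q d) (q + e *: vX q) = 0 => //.
  rewrite -[RHS](X0 (q + e *: vX q)) fieldX_derive; last exact: smooth_differentiable.
  congr ('D_ _ _ _); rewrite /vX /=; congr (_, _, - (_ / 2)).
  by rewrite /GRing.scale/= mulr0 addr0.
have := is_derive_0_is_cst 0 d der; rewrite scale0r addr0 => E.
have := bump_at_center q d; rewrite E => /(bump_at_neq0 _ _ _ d0)[+ _ _].
by rewrite /= /GRing.scale/= mulr1 addrAC subrr add0r gtr0_norm// ltxx.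
Qed.

(** The case [t = 0], at a point where some bump has positive gradient. *)
Lemma gradient_bound_ge1 (C : R) : gradient_bound C -> 1 <= C.
Proof.
move=> hC; have [p gp] := grad_bump_at 0 1 ltr01.
have sp : smooth_poly_growth (bump_at (0 : heis R) 1).
  apply: (bounded_support_poly_growth _ (`|0 : heis R| + 1)); first exact: smooth_bump_at.
  by move=> q; exact: bump_at_eq0.
have := hC 0 (bump_at 0 1) p (lexx _) sp.
rewrite /heat_semigroup eqxx.
by rewrite -[leLHS]mul1r ler_pM2r.
Qed.

Lemma heis_mul0 q : heis_mul 0 q = q.
Proof.
by case: q => [[a b] e]; rewrite /heis_mul/= !mul0r subrr mulr0 !add0r addr0.
Qed.

Lemma grad_norm_near0 f p : (\forall q \near p, f q = 0) -> grad_norm f p = 0.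
Proof.
move=> f0; have D v : 'D_v f p = 0.
  have -> : 'D_v f p = 'D_v (cst 0) p by exact: near_eq_derive.
  exact: derive_cst.
by rewrite /grad_norm /fieldX /fieldY !D !mulr0 subrr addr0 expr0n/= addr0 sqrtr0.
Qed.

Lemma heat_kernel_ge0 (C : R) : gradient_bound C -> forall q, 0 <= heat_kernel 1 q.
Proof.
move=> hC q; rewrite leNgt; apply/negP => hq.
have C1 := gradient_bound_ge1 C hC.
pose c := - (heat_kernel 1 q / 2).
have c0 : 0 < c by rewrite /c; lra.
have := @continuous_heat_kernel R 1 ltr01 q => /cvgr_lt /(_ (- c)) H.
have /nbhs_ballP[d /= d0 Hd] : \forall p \near q, heat_kernel 1 p < - c.
  by apply: H; rewrite /c; lra.
(* Half of the radius on which the kernel is below [- c]: a point outside that ball has a whole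
   neighbourhood where the bump is zero, so the gradient vanishes there too. *)
have d20 : 0 < d / 2 by rewrite divr_gt0.
pose f := bump_at q (d / 2); pose K := `|q| + d / 2.
have sf : smooth f by exact: smooth_bump_at.
have f0 p : K < `|p| -> f p = 0 by exact: bump_at_eq0.
have spf := bounded_support_poly_growth f K sf f0.
have cG := continuous_grad_norm f sf.
have G0 := grad_norm_eq0 f K f0.
have [M bG] := continuous_bounded_support _ K cG G0.
have iG := bounded_support_integrable M _ bG.
have [p gp] := grad_bump_at q (d / 2) d20.
have Ipos := continuous_integral_gt0 M _ p bG cG (grad_norm_ge0 f) gp.
have cGh : continuous (fun p => grad_norm f p * heat_kernel 1 p).
  by move=> y; apply: cvgM; [exact: cG|exact: continuous_heat_kernel].
have Gh0 y : K < `|y| -> grad_norm f y * heat_kernel 1 y = 0.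
  by move=> Ky; rewrite G0// mul0r.
have [M' bGh] := continuous_bounded_support _ K cGh Gh0.
have iGh := bounded_support_integrable M' _ bGh.
have le1 : \int[heis_leb]_y (grad_norm f y * heat_kernel 1 y) <=
    \int[heis_leb]_y (- c * grad_norm f y).
  apply: le_Rintegral => //; first exact: (integrableZl measurableT (- c) iG).
  move=> y _; rewrite mulrC.
  have [yB|yB] := pselect (ball q d y).
    by rewrite ler_wpM2r ?grad_norm_ge0// ltW// Hd.
  rewrite (_ : grad_norm f y = 0) ?mulr0//; apply: grad_norm_near0.
  apply/nbhs_ballP; exists (d / 2) => //= z yz.
  apply: contrapT => /eqP /(bump_at_neq0 _ _ _ d20)[h1 h2 h3]; apply: yB.
  rewrite [d]splitr; apply: (ball_triangle (y := z)); last exact: ball_sym.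
  rewrite heis_ballE; split; first split; rewrite /= /ball/=.
  - by rewrite distrC.
  - by rewrite distrC.
  - by rewrite distrC.
have := hC 1 f 0 ler01 spf.
rewrite /heat_semigroup oner_eq0 leNgt => /negP; apply.
have -> : \int[heis_leb]_y (grad_norm f (heis_mul 0 y) * heat_kernel 1 y) =
    \int[heis_leb]_y (grad_norm f y * heat_kernel 1 y).
  by apply: eq_Rintegral => y _; rewrite heis_mul0.
apply: (@lt_le_trans _ _ 0); last exact: grad_norm_ge0.
rewrite pmulr_rlt0; last exact: lt_le_trans C1.
apply: (le_lt_trans le1).
rewrite (RintegralZl (- c) measurableT iG) mulNr oppr_lt0.
exact: mulr_gt0.
Qed.

End heat_kernel_positivity.

(** * Total mass of the kernel *)

Section laplace_cos.
Context {R : realType}.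
Let mu : {measure set (measurableTypeR R) -> \bar R} := @lebesgue_measure R.
Implicit Types (e l : R).

Lemma integral_even_FTC (f F : R -> R) (L : R) : (forall x, 0 <= f x) ->
  continuous f -> (forall x, f (- x) = f x) ->
  (forall x : R, 0 < x -> is_derive x 1 F (f x)) -> {for 0, continuous F} ->
  F x @[x --> +oo] --> L ->
  (\int[@lebesgue_measure R]_x (f x)%:E = (2 * (L - F 0))%:E)%E.
Proof.
move=> f0 cf ef dF F0 FL.
rewrite ge0_symfun_integralT//; last by move=> x; rewrite /= ef.
rewrite (_ : [set x | (0 <= x)%R] = `[0%R, +oo[%classic); last first.
  by apply/seteqP; split=> x /=; rewrite in_itv/= andbT.
rewrite (@ge0_continuous_FTC2y _ f F 0 L)//.
- exact: continuous_subspaceT.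
- by move=> x x0; have H := dF x x0; exact: ex_derive.
- exact: cvg_at_right_filter.
- move=> x; rewrite in_itv/= andbT => x0.
  by rewrite derive1E; have H := dF x x0; exact: derive_val.
Qed.

Lemma expR_decay_cvg0 (e C : R) (g : R -> R) : 0 < e -> (forall x, `|g x| <= C) ->
  expR (- (e * x)) * g x @[x --> +oo] --> (0 : R).
Proof.
move=> e0 gC; apply/cvgr0Pnorm_le => d d0.
have C0 : 0 <= C by exact: le_trans (gC 0).
have E : expR (- (e * x)) @[x --> +oo] --> (0 : R).
  apply: (@cvg_comp _ _ _ (fun x => e * x) (fun x => expR (- x)) _ (pinfty_nbhs R)).
    exact: gt0_cvgMry.
  exact: cvgr_expR.
have dC : 0 < d / (C + 1) by rewrite divr_gt0//; lra.
move/cvgr0Pnorm_le : E => /(_ _ dC); apply: filterS => x hx.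
rewrite normrM; apply: (@le_trans _ _ (d / (C + 1) * C)); first exact: ler_pM.
rewrite mulrAC ler_pdivrMr ?ler_wpM2l//; first exact: ltW.
all: lra.
Qed.

Let expabs_continuous e : continuous (fun z : R => expR (- (e * `|z|))).
Proof.
move=> z; apply: (cvg_comp _ expR); last exact: continuous_expR.
by apply: cvgN; apply: cvgM; [exact: cvg_cst|exact: norm_continuous].
Qed.

Lemma integral_expabs e : 0 < e ->
  (\int[@lebesgue_measure R]_z (expR (- (e * `|z|)))%:E = (2 / e)%:E)%E.
Proof.
move=> e0; have en0 : e != 0 by rewrite gt_eqF.
have D (z : R) : is_derive z 1 (fun z => expR (- (e * z)) * (- e^-1)) (expR (- (e * z))).
  by apply: is_derive_eq; rewrite /GRing.scale/=; field.
have -> : 2 / e = 2 * (0 - expR (- (e * 0)) * (- e^-1)).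
  by rewrite mulr0 oppr0 expR0; field.
apply: (integral_even_FTC (fun z => expR (- (e * `|z|)))
  (fun z => expR (- (e * z)) * (- e^-1)) 0).
- by move=> x; exact: expR_ge0.
- exact: expabs_continuous.
- by move=> x; rewrite normrN.
- by move=> x x0; rewrite (gtr0_norm x0).
- by apply: differentiable_continuous; apply/derivable1_diffP; have H := D 0; exact: ex_derive.
- apply: (expR_decay_cvg0 e e^-1 (fun=> - e^-1) e0) => _.
  by rewrite normrN ger0_norm// ltW// invr_gt0.
Qed.

(** [1 + cos] replaces [cos] because the improper fundamental theorem used here wants a nonnegative
    integrand; the extra term is subtracted in [Rintegral_cos_expabs]. *)
Lemma integral_onePcos_expabs e l : 0 < e ->
  (\int[@lebesgue_measure R]_z ((1 + cos (l * z)) * expR (- (e * `|z|)))%:E =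
   (2 / e + 2 * e / (e ^+ 2 + l ^+ 2))%:E)%E.
Proof.
move=> e0; have en0 : e != 0 by rewrite gt_eqF.
have den : 0 < e ^+ 2 + l ^+ 2 by rewrite ltr_pwDl ?sqr_ge0// exprn_gt0.
have denn0 : e ^+ 2 + l ^+ 2 != 0 by rewrite gt_eqF.
pose g z := - e^-1 + (l * sin (l * z) - e * cos (l * z)) / (e ^+ 2 + l ^+ 2).
have D (z : R) : is_derive z 1 (fun z => expR (- (e * z)) * g z)
    ((1 + cos (l * z)) * expR (- (e * z))).
  by rewrite /g; apply: is_derive_eq; rewrite /GRing.scale/=; field; rewrite ?denn0 ?en0.
have -> : 2 / e + 2 * e / (e ^+ 2 + l ^+ 2) = 2 * (0 - expR (- (e * 0)) * g 0).
  by rewrite mulr0 oppr0 expR0 /g mulr0 sin0 cos0; field; rewrite ?denn0 ?en0.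
apply: (integral_even_FTC (fun z => (1 + cos (l * z)) * expR (- (e * `|z|)))
  (fun z => expR (- (e * z)) * g z) 0).
- move=> x; rewrite mulr_ge0 ?expR_ge0//; have := cos_geN1 (l * x); lra.
- move=> z; apply: cvgM; last exact: expabs_continuous.
  apply: cvgD; first exact: cvg_cst.
  by apply: (cvg_comp _ cos); [apply: cvgM; [exact: cvg_cst|exact: cvg_id]|exact: continuous_cos].
- by move=> x; rewrite normrN mulrN cosN.
- by move=> x x0; rewrite (gtr0_norm x0).
- by apply: differentiable_continuous; apply/derivable1_diffP; have H := D 0; exact: ex_derive.
- apply: (expR_decay_cvg0 e (e^-1 + (`|l| + e) / (e ^+ 2 + l ^+ 2)) g e0) => x.
  rewrite /g (le_trans (ler_normD _ _))// normrN (gtr0_norm (_ : 0 < e^-1)) ?invr_gt0//.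
  rewrite lerD2l normrM normfV (gtr0_norm den) ler_pM2r ?invr_gt0//.
  rewrite (le_trans (ler_normB _ _))// !normrM (gtr0_norm e0).
  apply: lerD; first by rewrite -[leRHS]mulr1 ler_wpM2l// normr_sin_le1.
  by rewrite -[leRHS]mulr1 ler_wpM2l ?(ltW e0)// normr_cos_le1.
Qed.

Lemma integrable_expabs e : 0 < e ->
  (@lebesgue_measure R).-integrable setT (EFin \o (fun z : R => expR (- (e * `|z|)))).
Proof.
move=> e0; apply/integrableP; split.
  by apply/measurable_EFinP; apply: continuous_measurable_fun; exact: expabs_continuous.
under eq_integral do rewrite /= ger0_norm ?expR_ge0//.
by rewrite integral_expabs// ltry.
Qed.

Lemma Rintegral_cos_expabs e l : 0 < e ->
  \int[@lebesgue_measure R]_z (cos (l * z) * expR (- (e * `|z|))) =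
  2 * e / (e ^+ 2 + l ^+ 2).
Proof.
move=> e0.
have i1 := integrable_expabs e e0.
have mc : measurable_fun [set: R] (fun z : R => cos (l * z)).
  apply: continuous_measurable_fun => z.
  by apply: (cvg_comp _ cos); [apply: cvgM; [exact: cvg_cst|exact: cvg_id]|exact: continuous_cos].
have i2 : (@lebesgue_measure R).-integrable setT
    (EFin \o (fun z : R => cos (l * z) * expR (- (e * `|z|)))).
  apply: le_integrable i1 => //.
    apply/measurable_EFinP; apply: measurable_funM => //.
    by apply: continuous_measurable_fun; exact: expabs_continuous.
  move=> z _; rewrite /= lee_fin normrM -[leRHS]mul1r ler_wpM2r//.
  exact: normr_cos_le1.
have := integral_onePcos_expabs e l e0 => /(congr1 fine) /= H.
have : \int[@lebesgue_measure R]_z (expR (- (e * `|z|)) + cos (l * z) * expR (- (e * `|z|)))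
    = 2 / e + 2 * e / (e ^+ 2 + l ^+ 2).
  by rewrite -H; apply: eq_Rintegral => z _; rewrite mulrDl mul1r.
rewrite RintegralD// (_ : \int[_]_z expR _ = 2 / e); last first.
  by rewrite /Rintegral integral_expabs.
by move/addrI.
Qed.

End laplace_cos.

Section heat_kernel_mass.
Context {R : realType}.
Local Notation mu := (@lebesgue_measure R).
Implicit Types (e l : R) (w : heis R).

Lemma Rintegral_swap (f : R * R -> R) :
  (mu \x mu)%E.-integrable setT (EFin \o f) ->
  (forall x, mu.-integrable setT (fun y => (f (x, y))%:E)) ->
  (forall y, mu.-integrable setT (fun x => (f (x, y))%:E)) ->
  \int[mu]_x \int[mu]_y f (x, y) = \int[mu]_y \int[mu]_x f (x, y).
Proof.
move=> i2 i1 i1'.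
have E1 x : (\int[mu]_y (f (x, y))%:E = (\int[mu]_y f (x, y))%:E)%E.
  by rewrite fineK//; apply: integrable_fin_num.
have E2 y : (\int[mu]_x (f (x, y))%:E = (\int[mu]_x f (x, y))%:E)%E.
  by rewrite fineK//; apply: integrable_fin_num.
have H := Fubini i2.
have {}H : (\int[mu]_x (\int[mu]_y f (x, y))%:E = \int[mu]_y (\int[mu]_x f (x, y))%:E)%E.
  transitivity (\int[mu]_x \int[mu]_y (f (x, y))%:E)%E.
    by apply: eq_integral => x _; rewrite E1.
  transitivity (\int[mu]_y \int[mu]_x (f (x, y))%:E)%E; first exact: H.
  by apply: eq_integral => y _; rewrite E2.
exact: (congr1 fine H).
Qed.

(** The quotient [sinh h / h] tends to the derivative of [sinh] at 0. Zero values of [h] are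
    excluded because [ampl 0 1] is 0, not 1. *)
Lemma cvg_ampl0 (h : nat -> R) : (forall n, h n != 0) -> h n @[n --> \oo] --> 0 ->
  ampl (h n) 1 @[n --> \oo] --> (1 : R).
Proof.
move=> hn0 h0.
have d1 : derivable (@sinh R) 0 1 by exact: ex_derive.
have D : 'D_1 (@sinh R) 0 = 1.
  by rewrite derive_val /cosh oppr0 expR0; field.
have c : x^-1 *: ((@sinh R \o shift 0) (x *: (1 : R)) - sinh 0) @[x --> (0 : R)^'] -->
    'D_1 (@sinh R) 0 by exact: d1.
move/cvgr_dnbhsP : c => /(_ h (conj hn0 h0)); rewrite D => c.
have {}c : (sinh (h n) / h n) @[n --> \oo] --> (1 : R).
  apply: cvg_trans c; apply: near_eq_cvg; apply: nearW => n /=.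
  by rewrite addr0 [h n *: 1]mulr1 /sinh oppr0 subrr mul0r subr0 [RHS]mulrC.
have {}c : (sinh (h n) / h n)^-1 @[n --> \oo] --> (1 : R).
  by rewrite -[X in _ --> X]invr1; apply: cvgV => //; exact: oner_neq0.
apply: cvg_trans c.
by apply: near_eq_cvg; apply: nearW => n /=; rewrite invf_div /ampl mulr1.
Qed.

Lemma kenv_cvg0 w (h : nat -> R) : (forall n, h n != 0) -> h n @[n --> \oo] --> 0 ->
  kenv 1 (h n) w @[n --> \oo] --> expR (- ((w.1.1 ^+ 2 + w.1.2 ^+ 2) / 4)).
Proof.
move=> hn0 h0; have ca := cvg_ampl0 h hn0 h0.
have cr : rate (h n) 1 @[n --> \oo] --> (1 : R).
  have cc : cosh (h n * 1) @[n --> \oo] --> (1 : R).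
    rewrite [X in _ --> X](_ : 1 = cosh (0 * 1)); last by rewrite mul0r /cosh oppr0 expR0; field.
    apply: (cvg_comp _ (@cosh R)); last exact: continuous_cosh.
    by apply: cvgM => //; exact: cvg_cst.
  have {}cc : ampl (h n) 1 * cosh (h n * 1) @[n --> \oo] --> (1 : R).
    by rewrite -[X in _ --> X]mulr1; exact: cvgM.
  apply: cvg_trans cc.
  apply: near_eq_cvg; apply: nearW => n /=.
  by rewrite /ampl /rate /coth mulrA mulrAC.
rewrite /kenv -[X in _ --> X]mul1r; apply: cvgM => //.
apply: (cvg_comp _ expR); last exact: continuous_expR.
apply: cvgN; rewrite -[X in _ --> X]mulr1; apply: cvgM => //; exact: cvg_cst.
Qed.

Lemma kenv_le4 l w : kenv 1 l w <= 4.
Proof.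
apply: (le_trans (kenv_le l 1 w ltr01)); apply: (le_trans (ampl_le l 1 ltr01)).
by rewrite divr1 -[leRHS]mulr1 ler_wpM2l// -[leRHS]expR0 ler_expR oppr_le0.
Qed.

Lemma measurable_kenv_l s w : measurable_fun setT (fun l => kenv s l w).
Proof. exact: measurable_kenv. Qed.

(* Abel means of the Fourier inversion formula at frequency [0]: only the value
   of [kenv 1] at [l = 0] survives, which is the Gaussian. *)
Lemma fiber_abel_limit w :
  \int[mu]_m (kenv 1 (n.+1%:R^-1 * m) w * (2 * (oneDsqr m)^-1)) @[n --> \oo] -->
  2 * pi * expR (- ((w.1.1 ^+ 2 + w.1.2 ^+ 2) / 4)).
Proof.
set E := expR _.
have idom : mu.-integrable setT (EFin \o (fun m => 8 * (oneDsqr m)^-1)).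
  exact: (integrable_kint_dom 8).
(* At [m = 0] the integrand is 0 for every [n], so the pointwise limit differs from the expected
   function there, on a null set. *)
pose f m : R := if m == 0 then 0 else E * (2 * (oneDsqr m)^-1).
have -> : 2 * pi * E = \int[mu]_m f m.
  have mg : measurable_fun setT (fun m : R => E * (2 * (oneDsqr m)^-1)).
    by apply: measurable_funM => //; apply: measurable_funM => //; exact: measurable_oneDsqrV.
  have mf : measurable_fun setT f.
    apply: measurable_fun_if => //; last exact: measurable_funTS.
    by apply: measurable_fun_eqr.
  transitivity (\int[mu]_m (E * (2 * (oneDsqr m)^-1))).
    rewrite (RintegralZl E measurableT (integrable_kint_dom 2)).
    rewrite (RintegralZl 2 measurableT integrable_oneDsqrV).
    by rewrite /Rintegral integral_oneDsqrV/= mulrC.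
  rewrite /Rintegral; congr fine; apply: ae_eq_integral => //.
  - exact/measurable_EFinP.
  - exact/measurable_EFinP.
  - exists [set 0]; split => //; first exact: lebesgue_measure_set1.
    move=> m /=; apply: contra_notP => /eqP m0 _.
    by rewrite /f (negbTE m0).
apply: (cvg_Rintegral _ _ mu
  (fun n m => kenv 1 (n.+1%:R^-1 * m) w * (2 * (oneDsqr m)^-1)) f
  (fun m => 8 * (oneDsqr m)^-1)) => //.
- move=> n; apply: measurable_funM.
    by apply: measurable_kenv => //; exact: measurable_funM.
  by apply: measurable_funM => //; exact: measurable_oneDsqrV.
- move=> n m; rewrite normrM (ger0_norm (kenv_ge0 _ _ _ ltr01)).
  rewrite (_ : 8 = 4 * 2); last by ring.
  rewrite -mulrA (ger0_norm (_ : 0 <= 2 * _)); last by rewrite mulr_ge0// oneDsqrV_ge0.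
  by rewrite ler_wpM2r ?kenv_le4// mulr_ge0// oneDsqrV_ge0.
- move=> m; rewrite /f; have [->|m0] := eqVneq m 0.
    under eq_fun do rewrite mulr0 /kenv ampl0 mul0r mul0r.
    exact: cvg_cst.
  apply: cvgM; last exact: cvg_cst.
  apply: kenv_cvg0 => [n|]; first by rewrite mulf_neq0// invr_eq0 pnatr_eq0.
  rewrite -[X in _ --> X](mul0r m); apply: cvgM; last exact: cvg_cst.
  exact: cvg_harmonic.
Qed.

(** The damping makes the double integral over (z, l) absolutely convergent. After exchanging the
    order, the z-integral is the Poisson kernel [2 e / (e ^ 2 + l ^ 2)], and [l = e m] moves all
    dependence on [e] into [kenv]. *)
Lemma fiber_abel (e : R) (x y : R) : 0 < e ->
  \int[mu]_z (heat_kernel 1 (x, y, z) * expR (- (e * `|z|))) =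
  (8 * pi ^+ 2)^-1 * \int[mu]_m (kenv 1 (e * m) (x, y, 0) * (2 * (oneDsqr m)^-1)).
Proof.
move=> e0; have en0 : e != 0 by rewrite gt_eqF.
have [C C0 HC] := @kint_env_le R 1 ltr01.
pose f (zl : R * R) := expR (- (e * `|zl.1|)) * kint 1 zl.2 (x, y, zl.1).
have i1 (z : R) : mu.-integrable setT (fun l => (f (z, l))%:E).
  exact: (integrableZl measurableT (expR (- (e * `|z|))) (integrable_kint 1 (x, y, z) ltr01)).
have me : measurable_fun setT (fun z : R => expR (- (e * `|z|))).
  have /integrableP[/measurable_EFinP + _] := integrable_expabs e e0; exact.
have mf : measurable_fun setT f.
  apply: measurable_funM; first exact: (measurableT_comp me measurable_fst).
  apply: measurable_kint => //; exact: measurable_hmk.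
have fE z l : f (z, l) = kenv 1 l (x, y, 0) * (cos (l * z) * expR (- (e * `|z|))).
  by rewrite /f /kint /kenv /=; ring.
have i1' (l : R) : mu.-integrable setT (fun z => (f (z, l))%:E).
  apply: le_integrable (integrableZl measurableT C (integrable_expabs e e0)) => //.
    by apply/measurable_EFinP; apply: (measurableT_comp mf); exact: measurable_fun_pair.
  move=> z _; rewrite /= lee_fin /f/= normrM [leRHS]normrM mulrC.
  rewrite ler_wpM2r// (le_trans (HC l _))// (ger0_norm C0) -[leRHS]mulr1 ler_wpM2l//.
  by rewrite invf_le1 ?oneDsqr_ge1// (lt_le_trans ltr01)// oneDsqr_ge1.
have i2 : (mu \x mu)%E.-integrable setT (EFin \o f).
  have mfE : measurable_fun setT (EFin \o f) by exact/measurable_EFinP.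
  pose D (zl : R * R) := expR (- (e * `|zl.1|)) * (C * (oneDsqr zl.2)^-1).
  apply: le_integrable (_ : (mu \x mu)%E.-integrable setT (EFin \o D)) => //.
    move=> [z l] _; rewrite /= lee_fin /f/= normrM [leRHS]normrM ler_wpM2l//.
    exact: le_trans (HC l _) (ler_norm _).
  have md : measurable_fun setT (EFin \o D).
    apply/measurable_EFinP; apply: measurable_funM.
      exact: (measurableT_comp me measurable_fst).
    apply: measurable_funM => //.
    exact: (measurableT_comp measurable_oneDsqrV measurable_snd).
  apply/(@integrable12ltyP _ _ _ _ R mu mu _ md).
  have -> : (\int[mu]_z \int[mu]_l `|(EFin \o D) (z, l)| =
      \int[mu]_z ((C * pi)%:E * (expR (- (e * `|z|)))%:E))%E.
    apply: eq_integral => z _ /=.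
    transitivity (\int[mu]_l ((expR (- (e * `|z|)) * C)%:E * ((oneDsqr l)^-1)%:E))%E.
      apply: eq_integral => l _; rewrite -EFinM -mulrA ger0_norm//.
      by rewrite /D/= mulr_ge0 ?expR_ge0// mulr_ge0// oneDsqrV_ge0.
    rewrite ge0_integralZl_EFin.
    - by rewrite integral_oneDsqrV -!EFinM; congr EFin; ring.
    - exact: measurableT.
    - by move=> l _; rewrite lee_fin oneDsqrV_ge0.
    - by apply/measurable_EFinP; exact: measurable_oneDsqrV.
    - by rewrite mulr_ge0 ?expR_ge0.
  rewrite ge0_integralZl_EFin.
  - by rewrite integral_expabs// -EFinM ltry.
  - exact: measurableT.
  - by move=> z _; rewrite lee_fin expR_ge0.
  - exact/measurable_EFinP.
  - by rewrite mulr_ge0// pi_ge0.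
transitivity ((8 * pi ^+ 2)^-1 * \int[mu]_z \int[mu]_l f (z, l)).
  have ifF := integrable_fubini_F i2.
  have E1 z : (\int[mu]_l (f (z, l))%:E = (\int[mu]_l f (z, l))%:E)%E.
    by rewrite fineK//; apply: integrable_fin_num.
  have {}ifF : mu.-integrable setT (EFin \o (fun z => \int[mu]_l f (z, l))).
    by apply: eq_integrable ifF => // z _; rewrite /fubini_F /= E1.
  rewrite -(RintegralZl _ measurableT ifF); apply: eq_Rintegral => z _.
  rewrite heat_kernelE -mulrA; congr (_ * _).
  rewrite mulrC.
  by rewrite -(RintegralZl _ measurableT (integrable_kint 1 (x, y, z) ltr01)).
rewrite (Rintegral_swap f i2 i1 i1'); congr (_ * _).
have mg : measurable_fun setT
    (fun l => kenv 1 l (x, y, 0) * (2 * e / (e ^+ 2 + l ^+ 2))).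
  apply: measurable_funM; first exact: measurable_kenv_l.
  apply: measurable_funM => //; apply: (measurableT_comp measurable_invr).
  by apply: measurable_funD => //; exact: measurable_funX.
transitivity (\int[mu]_l (kenv 1 l (x, y, 0) * (2 * e / (e ^+ 2 + l ^+ 2)))).
  apply: eq_Rintegral => l _.
  rewrite -(Rintegral_cos_expabs e l e0).
  have ic : mu.-integrable setT (EFin \o (fun z : R => cos (l * z) * expR (- (e * `|z|)))).
    have /integrableP[/measurable_EFinP mee _] := integrable_expabs e e0.
    apply: le_integrable (integrable_expabs e e0) => //.
      apply/measurable_EFinP; apply: measurable_funM => //.
      apply: continuous_measurable_fun => z.
      apply: (cvg_comp _ cos); last exact: continuous_cos.
      by apply: cvgM; [exact: cvg_cst|exact: cvg_id].
    move=> z _; rewrite /= lee_fin normrM -[leRHS]mul1r ler_wpM2r//.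
    exact: normr_cos_le1.
  by rewrite -(RintegralZl _ measurableT ic); apply: eq_Rintegral => z _; rewrite fE.
have H := Rintegral_affine e 0 _ e0 mg.
set I := Rintegral _ _ _ in H *.
apply: (mulfI (_ : e^-1 != 0)); first by rewrite invr_eq0.
rewrite -H.
have is' : mu.-integrable setT (EFin \o (fun m =>
    kenv 1 (e * m) (x, y, 0) * (2 * (oneDsqr m)^-1))).
  apply: le_integrable (integrable_kint_dom 8) => //.
    apply/measurable_EFinP; apply: measurable_funM.
      by apply: measurable_kenv => //; exact: measurable_funM.
    by apply: measurable_funM => //; exact: measurable_oneDsqrV.
  move=> m _; rewrite /= lee_fin normrM (ger0_norm (kenv_ge0 _ _ _ ltr01)).
  rewrite (_ : 8 = 4 * 2); last by ring.
  rewrite -(mulrA 4) [leRHS]normrM (ger0_norm (_ : 0 <= 4 :> R))//.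
  by rewrite ler_wpM2r// kenv_le4.
rewrite -(RintegralZl e^-1 measurableT is'); apply: eq_Rintegral => m _.
rewrite addr0 /oneDsqr.
have den : 1 + m ^+ 2 != 0 by rewrite gt_eqF// ltr_pwDl// sqr_ge0.
have -> : e ^+ 2 + (e * m) ^+ 2 = e ^+ 2 * (1 + m ^+ 2) by ring.
by field; rewrite den en0.
Qed.

End heat_kernel_mass.

Section heat_kernel_total_mass.
Context {R : realType}.
Local Notation mu := (@lebesgue_measure R).
Context (hk0 : forall q : heis R, 0 <= heat_kernel 1 q).

Let mhk := measurable_heat_kernel (1 : R) ltr01.

Let gauss_fiber (x y : R) : R := (4 * pi)^-1 * expR (- ((x ^+ 2 + y ^+ 2) / 4)).

(** Nonnegativity makes the damped integrands increase to the kernel, so monotone convergence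
    identifies the integral with the Abel limit. The constant is [(8 pi ^ 2)^-1 * 2 pi]. *)
Lemma fiber_mass (x y : R) :
  (\int[mu]_z (heat_kernel 1 (x, y, z))%:E = (gauss_fiber x y)%:E)%E.
Proof.
pose g n (z : R) : \bar R :=
  (heat_kernel 1 (x, y, z) * expR (- (n.+1%:R^-1 * `|z|)))%:E.
have mz : measurable_fun setT (fun z : R => heat_kernel 1 (x, y, z)).
  by apply: (measurableT_comp mhk); exact: measurable_fun_pair.
have en0 n : 0 < n.+1%:R^-1 :> R by rewrite invr_gt0.
have mg n : measurable_fun setT (g n).
  apply/measurable_EFinP; apply: measurable_funM => //.
  have /integrableP[/measurable_EFinP + _] := integrable_expabs _ (en0 n); exact.
have g0 n z : setT z -> (0 <= g n z)%E.
  by move=> _; rewrite lee_fin mulr_ge0 ?expR_ge0.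
have ndg z : setT z -> {homo g^~ z : a b / (a <= b)%N >-> (a <= b)%E}.
  move=> _ a b ab; rewrite lee_fin ler_wpM2l// ler_expR lerN2 ler_wpM2r//.
  by rewrite lef_pV2 ?posrE// ler_nat.
have gl z : g n z @[n --> \oo] --> (heat_kernel 1 (x, y, z))%:E.
  apply: cvg_EFin; first exact: nearW.
  rewrite /g /= -[X in _ --> X]mulr1; apply: cvgM; first exact: cvg_cst.
  have cz : - (n.+1%:R^-1 * `|z|) @[n --> \oo] --> (0 : R).
    rewrite -[X in _ --> X]oppr0; apply: cvgN; rewrite -[X in _ --> X](mul0r `|z|).
    by apply: cvgM; [exact: cvg_harmonic|exact: cvg_cst].
  rewrite -[X in _ --> X]expR0; apply: (cvg_comp _ expR cz); exact: continuous_expR.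
have cv1 := @cvg_monotone_convergence _ _ _ mu setT measurableT g mg g0 ndg.
have E1 : (fun z => limn (g^~ z)) = fun z => (heat_kernel 1 (x, y, z))%:E.
  by apply/funext => z; apply/cvg_lim => //; exact: gl.
rewrite E1 in cv1.
have E2 n : (\int[mu]_z g n z = ((8 * pi ^+ 2)^-1 *
    \int[mu]_m (kenv 1 (n.+1%:R^-1 * m) (x, y, 0) * (2 * (oneDsqr m)^-1)))%:E)%E.
  rewrite -(fiber_abel _ x y (en0 n)) /Rintegral fineK//.
  have [C C0 HC] := @kint_env_le R 1 ltr01.
  (* A bounded kernel makes each damped integral finite, so the real-valued formula of [fiber_abel]
     transfers to extended reals. *)
  have [M HM] : exists M, forall q : heis R, `|heat_kernel 1 q| <= M.
    exists ((8 * pi ^+ 2)^-1 * \int[mu]_l (C * (oneDsqr l)^-1)) => q.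
    have c0 : 0 <= (8 * pi ^+ 2)^-1 :> R.
      by rewrite invr_ge0; apply: mulr_ge0 => //; exact: sqr_ge0.
    rewrite heat_kernelE normrM (ger0_norm c0); apply: (ler_wpM2l c0).
    apply: (le_trans (le_normr_Rintegral measurableT (integrable_kint 1 q ltr01))).
    apply: le_Rintegral => //.
    - exact: integrable_norm (integrable_kint 1 q ltr01).
    - exact: integrable_kint_dom.
  apply: integrable_fin_num => //.
  apply: le_integrable (integrableZl measurableT M (integrable_expabs _ (en0 n))) => //.
    exact: mg.
  move=> z _; rewrite /= lee_fin normrM [leRHS]normrM ler_wpM2r//.
  exact: le_trans (HM _) (ler_norm _).
have cv2 : (\int[mu]_z g n z @[n --> \oo] -->
    ((8 * pi ^+ 2)^-1 * (2 * pi * expR (- ((x ^+ 2 + y ^+ 2) / 4))))%:E)%E.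
  under eq_fun do rewrite E2.
  apply: cvg_EFin; first exact: nearW.
  by apply: cvgM; [exact: cvg_cst|exact: (fiber_abel_limit (x, y, 0))].
rewrite -(cvg_lim (@ereal_hausdorff R) cv1) (cvg_lim (@ereal_hausdorff R) cv2).
congr EFin; rewrite /gauss_fiber.
have pi0 : pi != 0 :> R by rewrite gt_eqF// pi_gt0.
by set p : R := pi in pi0 *; clearbody p; field.
Qed.

Lemma integral_gauss4 : (\int[mu]_x (expR (- (x ^+ 2 / 4)))%:E = (2 * Num.sqrt pi)%:E)%E.
Proof.
have mg : measurable_fun setT (fun x : R => (gauss_fun x)%:E).
  by apply/measurable_EFinP; exact: measurable_gauss_fun.
have h : (0 : R) < 2^-1 by rewrite invr_gt0.
have := ge0_integral_affine (2^-1) 0 (fun x : R => (gauss_fun x)%:E) h mg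
  (fun x => gauss_fun_ge0 x).
rewrite integralT_gauss invrK -EFinM => <-.
apply: eq_integral => x _; rewrite /gauss_fun addr0; congr (expR (- _))%:E.
by field.
Qed.

Lemma heat_kernel_mass_ereal : (\int[heis_leb]_q (heat_kernel (1 : R) q)%:E = 1%E)%E.
Proof.
have me : measurable_fun setT (fun x : R => expR (- (x ^+ 2 / 4))).
  apply: measurableT_comp => //; apply: measurableT_comp => //.
  by apply: measurable_funM => //; exact: measurable_funX.
have pi0 : (0 : R) < pi by exact: pi_gt0.
rewrite (ge0_integral_heis (fun q => (heat_kernel 1 q)%:E)); last 2 first.
- exact/measurable_EFinP.
- by move=> q; rewrite lee_fin.
transitivity (\int[mu]_x ((((4 * pi)^-1 * (2 * Num.sqrt pi))%:E *
    (expR (- (x ^+ 2 / 4)))%:E)))%E.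
  apply: eq_integral => x _.
  transitivity (\int[mu]_y (((4 * pi)^-1 * expR (- (x ^+ 2 / 4)))%:E *
      (expR (- (y ^+ 2 / 4)))%:E))%E.
    apply: eq_integral => y _; rewrite fiber_mass /gauss_fiber -EFinM.
    by rewrite -[in RHS]mulrA -expRD; congr (_ * expR _)%:E; field.
  rewrite ge0_integralZl_EFin.
  - by rewrite integral_gauss4 -!EFinM; congr EFin; ring.
  - exact: measurableT.
  - by move=> y _; rewrite lee_fin expR_ge0.
  - exact/measurable_EFinP.
  - by rewrite mulr_ge0 ?expR_ge0// invr_ge0 mulr_ge0// ltW.
rewrite ge0_integralZl_EFin.
- rewrite integral_gauss4 -!EFinM; congr EFin.
  have -> : (4 * pi)^-1 * (2 * Num.sqrt pi) * (2 * Num.sqrt pi) =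
    pi^-1 * Num.sqrt pi ^+ 2 :> R.
    have := lt0r_neq0 pi0; set p : R := pi; clearbody p => p0; by field.
  by rewrite sqr_sqrtr ?ltW// mulVf// gt_eqF.
- exact: measurableT.
- by move=> y _; rewrite lee_fin expR_ge0.
- exact/measurable_EFinP.
- by rewrite mulr_ge0 ?mulr_ge0 ?sqrtr_ge0// invr_ge0 mulr_ge0// ltW.
Qed.

Lemma heat_kernel_mass : \int[heis_leb]_q heat_kernel (1 : R) q = 1.
Proof. by rewrite /Rintegral heat_kernel_mass_ereal. Qed.

Lemma integrable_heat_kernel : heis_leb.-integrable setT (EFin \o heat_kernel (1 : R)).
Proof.
apply/integrableP; split; first exact/measurable_EFinP.
rewrite (_ : integral _ _ _ = 1%E) ?ltry//.
rewrite -heat_kernel_mass_ereal; apply: eq_integral => q _ /=.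
by rewrite ger0_norm.
Qed.

End heat_kernel_total_mass.

(** * Maximum principle and Jensen's inequality *)

Section one_variable.
Context {R : realType}.
Implicit Types (f g : R -> R).

(** Only times before [a] are compared, because the maximum in the maximum principle may sit at the
    final time. *)
Lemma is_derive_ge0_at_left_max f (a r D : R) : 0 < r -> is_derive a 1 f D ->
  (forall x, a - r < x -> x <= a -> f x <= f a) -> 0 <= D.
Proof.
move=> r0 [df fD] fm; rewrite leNgt; apply/negP => D0.
have c : h^-1 *: ((f \o shift a) (h *: (1 : R)) - f a) @[h --> (0 : R)^'] --> 'D_1 f a by exact: df.
rewrite fD in c.
have /cvgr_lt /(_ 0 D0) := c.
move=> /nbhs_ballP[d /= d0 Hd].
pose h := - (Num.min d r / 2).
have m0 : 0 < Num.min d r by rewrite lt_min d0.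
have hd : h < 0 by rewrite oppr_lt0 divr_gt0.
have md : Num.min d r <= d by rewrite ge_min lexx.
have mr : Num.min d r <= r by rewrite ge_min lexx orbT.
have := Hd h; rewrite /ball/= sub0r normrN ltr0_norm// => H.
have {}H : h^-1 *: ((f \o shift a) (h *: (1 : R)) - f a) < 0.
  by apply: H; [rewrite /h opprK; lra|rewrite lt_eqF].
move: H; rewrite /= [h *: 1]mulr1 /GRing.scale/= nmulr_rlt0 ?invr_lt0//.
rewrite subr_gt0 ltNge => /negP; apply; apply: fm; rewrite /h; lra.
Qed.

(** If [D > 0], then [g], which vanishes at the maximum, is positive just to the right of 0, and the
    mean value theorem makes [f] exceed [f 0]. *)
Lemma second_derivative_max f g (D : R) : (forall x : R, is_derive x 1 f (g x)) ->
  is_derive (0 : R) 1 g D -> (forall x, f x <= f 0) -> D <= 0.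
Proof.
move=> df dg fm.
have g0 : g 0 = 0.
  apply/eqP; rewrite eq_le; apply/andP; split.
    have dN : is_derive (0 : R) 1 (fun x => f (- x)) (- g 0).
      have H := df (- 0); have H2 : is_derive (0 : R) 1 (fun x : R => - x) (- 1).
        exact: is_deriveN.
      have := @is_derive1_comp R f (fun x => - x) 0 _ _ H H2.
      by rewrite oppr0 mulrN1.
    rewrite -oppr_ge0; apply: (is_derive_ge0_at_left_max _ 0 1 _ ltr01 dN) => x _ _.
    by rewrite oppr0.
  by apply: (is_derive_ge0_at_left_max f 0 1 _ ltr01 (df 0)) => x _ _.
rewrite leNgt; apply/negP => D0.
have [dg1 dg2] := dg.
have c : h^-1 *: ((g \o shift 0) (h *: (1 : R)) - g 0) @[h --> (0 : R)^'] --> 'D_1 g 0 by exact: dg1.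
rewrite dg2 in c.
have /cvgr_gt /(_ 0 D0) := c.
move=> /nbhs_ballP[d /= d0 Hd].
have gp x : 0 < x -> x < d -> 0 < g x.
  move=> x0 xd; have := Hd x; rewrite /ball/= sub0r normrN gtr0_norm// => H.
  have {}H : 0 < x^-1 *: ((g \o shift 0) (x *: (1 : R)) - g 0).
    by apply: H => //; rewrite gt_eqF.
  by move: H; rewrite /= [x *: 1]mulr1 addr0 g0 subr0 /GRing.scale/= pmulr_rgt0 ?invr_gt0.
have d20 : 0 < d / 2 by rewrite divr_gt0.
have cf : {within `[0, d / 2], continuous f}.
  apply: continuous_subspaceT => x; apply: differentiable_continuous.
  by apply/derivable1_diffP; have H := df x; exact: ex_derive.
have [x xI] := @MVT _ f g _ _ d20 (fun x _ => df x) cf.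
rewrite subr0 => E.
move: xI; rewrite in_itv/= => /andP[x0 xd2].
have : 0 < g x * (d / 2) by rewrite mulr_gt0// gp//; lra.
by rewrite -E subr_gt0 ltNge fm.
Qed.

Lemma convex_tangent (k : R -> R) (D : set R) (m u d : R) : convex_function D k ->
  D m -> D u -> is_derive m 1 k d -> k m + d * (u - m) <= k u.
Proof.
move=> ck Dm Du dk.
(* Minus the gap between chord and graph, with the parameter reversed so that the segment towards
   [u] lies to the left of 0. Convexity gives [f <= f 0] there, and the one-sided criterion
   applies. *)
pose f x := - ((- x) * (k u - k m) - (k (m + (- x) * (u - m)) - k m)).
have df : is_derive (0 : R) 1 f (k u - k m - d * (u - m)).
  have H : is_derive (m + - 0 * (u - m)) 1 k d by rewrite oppr0 mul0r addr0.
  have H2 : is_derive (0 : R) 1 (fun x : R => m + - x * (u - m)) (- (u - m)).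
    by apply: is_derive_eq; rewrite /GRing.scale/=; ring.
  have H3 : is_derive (0 : R) 1 (fun x : R => k (m + - x * (u - m))) (d * - (u - m)).
    exact: (@is_derive1_comp R k (fun x : R => m + - x * (u - m)) 0 _ _ H H2).
  by rewrite /f; apply: is_derive_eq; rewrite /GRing.scale/=; ring.
have : 0 <= k u - k m - d * (u - m); last by lra.
apply: (is_derive_ge0_at_left_max f 0 1 _ ltr01 df) => x x1 x0.
rewrite /f !oppr0 !mul0r addr0 subrr subr0 oppr0 oppr_le0.
have nx0 : 0 <= - x by lra.
have nx1 : - x <= 1 by lra.
have := ck (Itv01 nx0 nx1) u m (mem_set Du) (mem_set Dm).
have -> : conv (Itv01 nx0 nx1) (u : convex_lmodType R^o) m = m + - x * (u - m).
  by transitivity (- x * u + (1 - - x) * m); [|ring].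
have -> : conv (Itv01 nx0 nx1) (k u : R^o) (k m) = - x * k u + (1 + x) * k m.
  by transitivity (- x * k u + (1 - - x) * k m); [|ring].
lra.
Qed.

End one_variable.

(** * The semigroup as an average against the fixed time-1 kernel *)

Section dilated_semigroup.
Context {R : realType}.
Context (hk0 : forall q : heis R, 0 <= heat_kernel 1 q).
Implicit Types (s a b M : R) (p q : heis R) (F G : heis R -> R).

Let hk : heis R -> R := heat_kernel 1.
Let ihk : heis_leb.-integrable setT (EFin \o hk) := integrable_heat_kernel hk0.

(* Rescaling the kernel to time [1] gives a form of the semigroup that is
   continuous up to time [0]. *)
Definition dil_semigroup s F p : R :=
  \int[heis_leb]_q (F (heis_mul p (dil (Num.sqrt s) q)) * heat_kernel 1 q).

Definition bounded_measurable F :=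
  measurable_fun setT F /\ exists M, forall q, `|F q| <= M.

(** At [s = 0] the dilation collapses the group to its origin, and total mass 1 reproduces the
    convention [P_0 = Id]. *)
Lemma heat_semigroup_dilE s F p : 0 <= s -> bounded_measurable F ->
  heat_semigroup s F p = dil_semigroup s F p.
Proof.
move=> s0 [mF [M FM]]; have [->|sn0] := eqVneq s 0.
  rewrite /heat_semigroup eqxx /dil_semigroup sqrtr0.
  transitivity (\int[heis_leb]_q (F p * hk q)).
    by rewrite (RintegralZl (F p) measurableT ihk) heat_kernel_mass// mulr1.
  apply: eq_Rintegral => q _; congr (F _ * _).
  rewrite /dil /heis_mul/= expr0n/= !mul0r !mulr0 subrr mulr0 !addr0.
  by case: p => [[]].
have sp : 0 < s by rewrite lt_def sn0.
rewrite -{1}(sqr_sqrtr s0); apply: (heat_semigroup_dil _ M) => //.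
by rewrite sqrtr_gt0.
Qed.

Lemma integrable_dil s F p : bounded_measurable F -> heis_leb.-integrable setT
  (EFin \o (fun q => F (heis_mul p (dil (Num.sqrt s) q)) * heat_kernel 1 q)).
Proof.
move=> [mF [M FM]].
apply: (integrable_mul_bounded _ (fun q => F (heis_mul p (dil (Num.sqrt s) q))) M ihk) => //.
exact: (measurableT_comp mF (measurableT_comp (measurable_heis_mul p) (measurable_dil _))).
Qed.

Lemma dil_semigroup_cst s a p : dil_semigroup s (cst a) p = a.
Proof.
rewrite /dil_semigroup (RintegralZl a measurableT ihk) heat_kernel_mass//.
by rewrite mulr1.
Qed.

Lemma bounded_measurable_cst a : bounded_measurable (cst a).
Proof. by split; [exact: measurable_cst|exists `|a|]. Qed.

Lemma bounded_measurableD F G : bounded_measurable F -> bounded_measurable G ->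
  bounded_measurable (fun q => F q + G q).
Proof.
move=> [mF [M FM]] [mG [N GN]]; split; first exact: measurable_funD.
by exists (M + N) => q; rewrite (le_trans (ler_normD _ _))// lerD.
Qed.

Lemma bounded_measurableZ a F : bounded_measurable F ->
  bounded_measurable (fun q => a * F q).
Proof.
move=> [mF [M FM]]; split; first exact: measurable_funM.
by exists (`|a| * M) => q; rewrite normrM ler_wpM2l.
Qed.

Lemma dil_semigroupD s F G p : bounded_measurable F -> bounded_measurable G ->
  dil_semigroup s (fun q => F q + G q) p = dil_semigroup s F p + dil_semigroup s G p.
Proof.
move=> bF bG; rewrite /dil_semigroup.
rewrite -(RintegralD measurableT (integrable_dil s F p bF) (integrable_dil s G p bG)).
by apply: eq_Rintegral => q _; rewrite mulrDl.
Qed.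

Lemma dil_semigroupZ s a F p : bounded_measurable F ->
  dil_semigroup s (fun q => a * F q) p = a * dil_semigroup s F p.
Proof.
move=> bF; rewrite /dil_semigroup.
rewrite -(RintegralZl a measurableT (integrable_dil s F p bF)).
by apply: eq_Rintegral => q _; rewrite mulrA.
Qed.

Lemma le_dil_semigroup s F G p : bounded_measurable F -> bounded_measurable G ->
  (forall q, F q <= G q) -> dil_semigroup s F p <= dil_semigroup s G p.
Proof.
move=> bF bG FG; apply: le_Rintegral => //; [exact: integrable_dil|exact: integrable_dil|].
by move=> q _; rewrite ler_wpM2r.
Qed.

Lemma dil_semigroup_itv s a b F p : bounded_measurable F ->
  (forall q, a <= F q <= b) -> a <= dil_semigroup s F p <= b.
Proof.
move=> bF ab; apply/andP; split.
  rewrite -[leLHS](dil_semigroup_cst s a p).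
  apply: le_dil_semigroup => //; first exact: bounded_measurable_cst.
  by move=> q; case/andP: (ab q).
rewrite -[leRHS](dil_semigroup_cst s b p).
apply: le_dil_semigroup => //; first exact: bounded_measurable_cst.
by move=> q; case/andP: (ab q).
Qed.

Lemma cvg_triple (a b c : nat -> R) (x y z : R) :
  a n @[n --> \oo] --> x -> b n @[n --> \oo] --> y -> c n @[n --> \oo] --> z ->
  ((a n, b n, c n) : heis R) @[n --> \oo] --> ((x, y, z) : heis R).
Proof.
move=> ax bY cz.
have e : (a n, b n) @[n --> \oo] --> ((x, y) : R * R) by exact: (cvg_pair ax bY).
exact: (cvg_pair e cz).
Qed.

(** Dominated by [M] times the kernel. As [Num.sqrt] is 0 on negative reals, continuity holds for
    all real times and no one-sided limit at 0 is involved. *)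
Lemma continuous_dil_semigroup F M : continuous F -> (forall q, `|F q| <= M) ->
  continuous (fun sp : R * heis R => dil_semigroup sp.1 F sp.2).
Proof.
move=> cF FM sp; apply: cvg_seq_continuous => u usp.
have mF := continuous_measurable_heis _ cF.
apply: (cvg_Rintegral _ _ heis_leb
  (fun n q => F (heis_mul (u n).2 (dil (Num.sqrt (u n).1) q)) * heat_kernel 1 q)
  (fun q => F (heis_mul sp.2 (dil (Num.sqrt sp.1) q)) * heat_kernel 1 q)
  (fun q => M * heat_kernel 1 q)).
- move=> n; apply: measurable_funM; last exact: measurable_heat_kernel.
  exact: (measurableT_comp mF (measurableT_comp (measurable_heis_mul _) (measurable_dil _))).
- exact: (integrableZl measurableT M ihk).
- by move=> n q; rewrite normrM (ger0_norm (hk0 q)) ler_wpM2r.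
move=> q; apply: cvgM; last exact: cvg_cst.
apply: (cvg_comp _ F); last exact: cF.
have c0 : Num.sqrt (u n).1 @[n --> \oo] --> Num.sqrt sp.1.
  apply: (cvg_comp _ Num.sqrt); last exact: sqrt_continuous.
  by apply: (cvg_comp u fst usp); exact: cvg_fst.
have cu2 : (u n).2 @[n --> \oo] --> sp.2 by apply: (cvg_comp u snd usp); exact: cvg_snd.
have [k1 k2 k3] := cvg_coords sp.2.
have {}k1 : (u n).2.1.1 @[n --> \oo] --> sp.2.1.1 by exact: (cvg_comp _ _ cu2 k1).
have {}k2 : (u n).2.1.2 @[n --> \oo] --> sp.2.1.2 by exact: (cvg_comp _ _ cu2 k2).
have {}k3 : (u n).2.2 @[n --> \oo] --> sp.2.2 by exact: (cvg_comp _ _ cu2 k3).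
have d1 : Num.sqrt (u n).1 * q.1.1 @[n --> \oo] --> Num.sqrt sp.1 * q.1.1.
  by apply: cvgM => //; exact: cvg_cst.
have d2 : Num.sqrt (u n).1 * q.1.2 @[n --> \oo] --> Num.sqrt sp.1 * q.1.2.
  by apply: cvgM => //; exact: cvg_cst.
have d3 : Num.sqrt (u n).1 ^+ 2 * q.2 @[n --> \oo] --> Num.sqrt sp.1 ^+ 2 * q.2.
  by apply: cvgM; [exact: (cvgM c0 c0)|exact: cvg_cst].
have e1 : (u n).2.1.1 + Num.sqrt (u n).1 * q.1.1 @[n --> \oo] -->
    sp.2.1.1 + Num.sqrt sp.1 * q.1.1 by exact: cvgD.
have e2 : (u n).2.1.2 + Num.sqrt (u n).1 * q.1.2 @[n --> \oo] -->
    sp.2.1.2 + Num.sqrt sp.1 * q.1.2 by exact: cvgD.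
have g1 : (u n).2.1.1 * (Num.sqrt (u n).1 * q.1.2) @[n --> \oo] -->
  sp.2.1.1 * (Num.sqrt sp.1 * q.1.2) by exact: cvgM.
have g2 : (u n).2.1.2 * (Num.sqrt (u n).1 * q.1.1) @[n --> \oo] -->
  sp.2.1.2 * (Num.sqrt sp.1 * q.1.1) by exact: cvgM.
have g3 : (u n).2.1.1 * (Num.sqrt (u n).1 * q.1.2)
     - (u n).2.1.2 * (Num.sqrt (u n).1 * q.1.1) @[n --> \oo] -->
   sp.2.1.1 * (Num.sqrt sp.1 * q.1.2) - sp.2.1.2 * (Num.sqrt sp.1 * q.1.1).
  by exact: cvgB.
have e4 : (u n).2.2 + Num.sqrt (u n).1 ^+ 2 * q.2 @[n --> \oo] -->
  sp.2.2 + Num.sqrt sp.1 ^+ 2 * q.2 by exact: cvgD.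
have e5 : 2^-1 * ((u n).2.1.1 * (Num.sqrt (u n).1 * q.1.2)
     - (u n).2.1.2 * (Num.sqrt (u n).1 * q.1.1)) @[n --> \oo] -->
   2^-1 * (sp.2.1.1 * (Num.sqrt sp.1 * q.1.2) - sp.2.1.2 * (Num.sqrt sp.1 * q.1.1)).
  by apply: cvgM => //; exact: cvg_cst.
have e6 : heis_mul (u n).2 (dil (Num.sqrt (u n).1) q) @[n --> \oo] -->
  heis_mul sp.2 (dil (Num.sqrt sp.1) q).
  exact: (cvg_triple _ _ _ _ _ _ e1 e2 (cvgD e4 e5)).
exact: e6.
Qed.

End dilated_semigroup.

Section weak_maximum_principle.
Context {R : realType}.
Implicit Types (p q v : heis R).

Definition barrier p : R := 1 + p.1.1 ^+ 2 + p.1.2 ^+ 2 + p.2 ^+ 2.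

Definition barrier1 p v : R := 2 * (p.1.1 * v.1.1 + p.1.2 * v.1.2 + p.2 * v.2).

Definition barrier2 v : R := 2 * (v.1.1 ^+ 2 + v.1.2 ^+ 2 + v.2 ^+ 2).

Lemma is_derive_barrier p v (e : R) :
  is_derive e 1 (fun e : R => barrier (p + e *: v)) (barrier1 (p + e *: v) v).
Proof.
rewrite /barrier /barrier1/=; under eq_fun do rewrite /GRing.scale/=.
by apply: is_derive_eq; rewrite /GRing.scale/=; ring.
Qed.

Lemma is_derive_barrier1 p v (e : R) :
  is_derive e 1 (fun e : R => barrier1 (p + e *: v) v) (barrier2 v).
Proof.
rewrite /barrier2 /barrier1/=; under eq_fun do rewrite /GRing.scale/=.
by apply: is_derive_eq; rewrite /GRing.scale/=; ring.
Qed.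

Lemma barrier_ge1 p : 1 <= barrier p.
Proof. by rewrite /barrier -!addrA lerDl !addr_ge0// sqr_ge0. Qed.

Lemma barrier_gt (K : R) p : 1 <= K -> ~ hbounded K p -> K < barrier p.
Proof.
move=> K1 nb; have [k|k] := ltP K (barrier p) => //; exfalso; apply: nb.
have H (a b c : R) : 1 + a ^+ 2 + b ^+ 2 + c ^+ 2 <= K -> `|a| <= K.
  move=> h; have : 0 <= b ^+ 2 by exact: sqr_ge0.
  have : 0 <= c ^+ 2 by exact: sqr_ge0.
  by move=> ? ?; rewrite ler_norml; apply/andP; split; nra.
move: k; rewrite /barrier => k; split.
- exact: H k.
- by apply: (H _ p.1.1 p.2); lra.
- by apply: (H _ p.1.1 p.1.2); lra.
Qed.

Lemma continuous_barrier : continuous barrier.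
Proof.
move=> p; have [c1 c2 c3] := cvg_coords p.
apply: cvgD; last exact: (cvgM c3 c3).
apply: cvgD; last exact: (cvgM c2 c2).
by apply: cvgD; [exact: cvg_cst|exact: (cvgM c1 c1)].
Qed.

(* [L barrier] is [4 + (x ^+ 2 + y ^+ 2) / 2], so [expR (5 * s) * barrier p] is
   a strict supersolution of the heat equation that is proper in [p]. *)
Lemma weak_maximum_principle (t B : R) (w : R -> heis R -> R) p : 0 <= t ->
  continuous (fun sp : R * heis R => w sp.1 sp.2) ->
  (forall q, w 0 q <= 0) ->
  (forall s q, 0 <= s <= t -> w s q <= B) ->
  (forall s q, 0 < s <= t -> exists D gX hX gY hY,
    [/\ is_derive s 1 (w^~ q) D,
      forall e : R, is_derive e 1 (fun e : R => w s (q + e *: vX q)) (gX e) /\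
                    is_derive e 1 (fun e : R => w s (q + e *: vY q)) (gY e),
      is_derive (0 : R) 1 gX hX, is_derive (0 : R) 1 gY hY & D <= hX + hY]) ->
  w t p <= 0.
Proof.
move=> t0 cw w0 wB hw; rewrite leNgt; apply/negP => wt.
(* Chosen so that the penalty at (t, p) is half of [w t p], leaving [v t p] positive. *)
pose eps := w t p / (2 * (expR (5 * t) * barrier p)).
have b0 q : 0 < barrier q by exact: lt_le_trans (barrier_ge1 q).
have e0 : 0 < eps by rewrite divr_gt0// !mulr_gt0// expR_gt0.
pose v s q := w s q - eps * (expR (5 * s) * barrier q).
have vt : 0 < v t p.
  rewrite /v /eps; set c := expR _ * _.
  have c0 : 0 < c by rewrite mulr_gt0// expR_gt0.
  have -> : w t p / (2 * c) * c = w t p / 2 by field; rewrite gt_eqF.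
  lra.
(* Outside this box the penalty exceeds [eps * K > |B|], so [v] is negative there; the box also
   contains [p]. The maximum over the compact set is therefore global in space. *)
pose K := 1 + `|B| / eps + `|p|.
have K1 : 1 <= K by rewrite /K -addrA lerDl addr_ge0// divr_ge0// ltW.
have pK : hbounded K p.
  apply: hbounded_ge (hbounded_norm p).
  by rewrite /K lerDr addr_ge0// divr_ge0// ltW.
have vout s q : 0 <= s <= t -> ~ hbounded K q -> v s q < 0.
  move=> st nb; have := barrier_gt K q K1 nb => Kb.
  have : eps * K <= eps * (expR (5 * s) * barrier q).
    rewrite ler_pM2l//; apply: (le_trans (ltW Kb)); rewrite ler_peMl ?(ltW (b0 q))//.
    by rewrite -expR0 ler_expR mulr_ge0//; case/andP: st.
  have : `|B| < eps * K.
    rewrite /K !mulrDr mulrCA divff ?gt_eqF// !mulr1.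
    have : 0 <= eps * `|p| by rewrite mulr_ge0// ltW.
    lra.
  have := ler_norm B; have := wB s q st; rewrite /v; lra.
pose A := `[0, t] `*` [set q : heis R | hbounded K q].
have cA : compact A by apply: compact_setX; [exact: segment_compact|exact: compact_hbounded].
have cv : continuous (fun sp : R * heis R => v sp.1 sp.2).
  move=> sp; apply: cvgB; first exact: cw.
  apply: cvgM; first exact: cvg_cst.
  have c1 : expR (5 * x.1) @[x --> sp] --> expR (5 * sp.1).
    apply: (cvg_comp _ (fun x : R => expR (5 * x))); first exact: cvg_fst.
    apply: (cvg_comp _ expR); last exact: continuous_expR.
    by apply: cvgM; [exact: cvg_cst|exact: cvg_id].
  apply: cvgM => //.
  by apply: (cvg_comp _ barrier); [exact: cvg_snd|exact: continuous_barrier].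
have tA : A (t, p) by split => //=; rewrite in_itv/= t0 lexx.
have [[s0 p0]] := compact_EVT_max (ex_intro _ _ tA) cA (continuous_subspaceT cv).
rewrite inE => -[/= s0t p0K] vmax.
have {}vmax s q : 0 <= s <= t -> hbounded K q -> v s q <= v s0 p0.
  by move=> st qK; apply: (vmax (s, q)); rewrite inE; split => //=; rewrite in_itv.
have v00 : 0 < v s0 p0.
  by apply: (lt_le_trans vt); apply: vmax => //; rewrite t0 lexx.
move: s0t; rewrite in_itv/= => s0t.
have s00 : 0 < s0.
  rewrite lt_def; case/andP: (s0t) => -> _; rewrite andbT; apply/negP => /eqP s0E.
  move: v00; rewrite s0E /v; have := w0 p0.
  have : 0 < eps * (expR (5 * 0) * barrier p0).
    exact: (mulr_gt0 e0 (mulr_gt0 (expR_gt0 _) (b0 p0))).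
  lra.
have s0t' : 0 < s0 <= t by rewrite s00; case/andP: s0t.
have vmaxq q : v s0 q <= v s0 p0.
  have [qK|qK] := pselect (hbounded K q); first exact: vmax.
  by apply: ltW; apply: (lt_trans (vout s0 q s0t qK)).
have [D [gX [hX [gY [hY [dD dXY dX dY Dle]]]]]] := hw s0 p0 s0t'.
pose E := eps * expR (5 * s0).
have E0 : 0 < E by rewrite mulr_gt0// expR_gt0.
have dv : is_derive s0 1 (v^~ p0) (D - 5 * E * barrier p0).
  by rewrite /v; apply: is_derive_eq; rewrite /GRing.scale/= /E; ring.
have D0 : 0 <= D - 5 * E * barrier p0.
  apply: (is_derive_ge0_at_left_max _ s0 s0 _ s00 dv) => s; rewrite subrr => s1 s2.
  by apply: vmax => //; rewrite (ltW s1) (le_trans s2)//; case/andP: s0t.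
have second u g h : (forall e : R, is_derive e 1 (fun e : R => w s0 (p0 + e *: u)) (g e)) ->
    is_derive (0 : R) 1 g h -> h - E * barrier2 u <= 0.
  move=> dg dh; apply: (second_derivative_max (fun e : R => v s0 (p0 + e *: u))
    (fun e : R => g e - E * barrier1 (p0 + e *: u) u)).
  - move=> e; have h1 := dg e; have h2 := is_derive_barrier p0 u e.
    by rewrite /v; apply: is_derive_eq; rewrite /GRing.scale/= /E; ring.
  - have h2 := is_derive_barrier1 p0 u 0.
    by apply: is_derive_eq; rewrite /GRing.scale/=; ring.
  - by move=> e; rewrite scale0r addr0; exact: vmaxq.
have HX := second _ _ _ (fun e => (dXY e).1) dX.
have HY := second _ _ _ (fun e => (dXY e).2) dY.
(* This strict inequality contradicts [D <= hX + hY] together with the signs of the derivatives of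
   [v] at its maximum. *)
have : E * (barrier2 (vX p0) + barrier2 (vY p0)) < 5 * E * barrier p0.
  rewrite (_ : 5 * E * _ = E * (5 * barrier p0)); last by ring.
  rewrite (ltr_pM2l E0) /barrier2 /barrier /vX /vY/=.
  have := sqr_ge0 p0.1.1; have := sqr_ge0 p0.1.2; have := sqr_ge0 p0.2.
  rewrite !expr2; lra.
lra.
Qed.

End weak_maximum_principle.

Section semigroup_calculus.
Context {R : realType}.
Context (hk0 : forall q : heis R, 0 <= heat_kernel 1 q).
Implicit Types (s t a b M : R) (p q v : heis R) (F f g : heis R -> R).

Lemma bounded_support_measurable M F : bounded_support M F -> bounded_measurable F.
Proof. by case=> mF FM _; split => //; exists M. Qed.

(** For [s > 0], these are the first and second derivatives of [P_s F] along [v] and its time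
    derivative. *)
Definition sg1 F s p v : R := (8 * pi ^+ 2)^-1 * Phi1 F s p v.
Definition sg2 F s p v : R := (8 * pi ^+ 2)^-1 * Phi2 F s p v.
Definition sgS F s p : R := (8 * pi ^+ 2)^-1 * PhiS F s p.

Lemma sg_heat M F s p : bounded_support M F -> 0 < s ->
  sgS F s p = sg2 F s p (vX p) + sg2 F s p (vY p).
Proof. by move=> bF s0; rewrite /sgS (Phi_heat M F s p bF s0) mulrDr. Qed.

Lemma dil_semigroupE M F s p : bounded_support M F -> 0 < s ->
  dil_semigroup s F p = (8 * pi ^+ 2)^-1 * Phi F s p.
Proof.
move=> bF s0; rewrite -(heat_semigroup_dilE hk0 s F p (ltW s0)).
  exact: (heat_semigroupE M).
exact: bounded_support_measurable bF.
Qed.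

Lemma is_derive_dil_line M F s p v (e : R) : bounded_support M F -> 0 < s ->
  is_derive e 1 (fun e : R => dil_semigroup s F (p + e *: v)) (sg1 F s (p + e *: v) v).
Proof.
move=> bF s0; under eq_fun do rewrite (dil_semigroupE M F s _ bF s0).
have H := is_derive_Phi M F s p v e bF s0.
by apply: is_derive_eq; rewrite /GRing.scale/= /sg1; ring.
Qed.

Lemma is_derive_sg1 M F s p v (e : R) : bounded_support M F -> 0 < s ->
  is_derive e 1 (fun e : R => sg1 F s (p + e *: v) v) (sg2 F s (p + e *: v) v).
Proof.
move=> bF s0; rewrite /sg1.
have H := is_derive_Phi1 M F s p v e bF s0.
by apply: is_derive_eq; rewrite /GRing.scale/= /sg2; ring.
Qed.

Lemma is_derive_dil_time M F s p : bounded_support M F -> 0 < s ->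
  is_derive s 1 (fun s : R => dil_semigroup s F p) (sgS F s p).
Proof.
move=> bF s0; have H := is_derive_PhiS M F s p bF s0.
have H2 : is_derive s 1 (fun s => (8 * pi ^+ 2)^-1 * Phi F s p) (sgS F s p).
  by apply: is_derive_eq; rewrite /GRing.scale/= /sgS; ring.
apply: near_eq_is_derive H2.
near=> r; apply/esym/(dil_semigroupE M) => //.
by near: r; exact: lt_nbhsr.
Unshelve. all: by end_near. Qed.

Lemma grad_norm_heat_semigroup M F s p : bounded_support M F -> 0 < s ->
  grad_norm (heat_semigroup s F) p ^+ 2 = sg1 F s p (vX p) ^+ 2 + sg1 F s p (vY p) ^+ 2.
Proof.
move=> bF s0; have d v : 'D_v (heat_semigroup s F) p = sg1 F s p v.
  have H := is_derive_dil_line M F s p v 0 bF s0.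
  have {}H : is_derive (0 : R) 1 (fun e => heat_semigroup s F (p + e *: v)) (sg1 F s p v).
    rewrite scale0r addr0 in H.
    under eq_fun do rewrite (heat_semigroup_dilE hk0 s F _ (ltW s0)
      (bounded_support_measurable _ _ bF)).
    exact: H.
  by have [_ <-] := is_derive_line _ _ _ _ H.
rewrite grad_norm_sqr /fieldX /fieldY !d.
(* The fields are defined through coordinate derivatives; linearity read off the integral formula
   recombines them along [vX] and [vY], with no appeal to differentiability of [P_s F] in several
   variables. *)
have lin (a : heis R) b c : sg1 F s p (a + b *: c) = sg1 F s p a + b * sg1 F s p c.
  rewrite /sg1 -[a in LHS]scale1r (Phi1_linear M F s p 1 b a c bF s0); ring.
congr (_ ^+ 2 + _ ^+ 2); rewrite -?mulNr -lin; congr sg1; rewrite /vX /vY.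
- transitivity ((1 + - p.1.2 / 2 * 0, 0 + - p.1.2 / 2 * 0, 0 + - p.1.2 / 2 * 1) : heis R).
    by [].
  by congr (_, _, _); ring.
- transitivity ((0 + p.1.1 / 2 * 0, 1 + p.1.1 / 2 * 0, 0 + p.1.1 / 2 * 1) : heis R).
    by [].
  by congr (_, _, _); ring.
Qed.

(* Convexity of [-1/psi] makes [(u, v) |-> psi u * v ^+ 2] convex, which is
   Jensen's inequality for the probability with density [heat_kernel 1]. *)
Lemma dil_semigroup_jensen (I : set R) (psi : R -> R) s p f g :
  (forall u, I u -> 0 < psi u) -> convex_function I (fun u : R => - 1 / psi u) ->
  (forall u, I u -> derivable psi u 1) ->
  (forall q, I (f q)) -> I (dil_semigroup s f p) ->
  bounded_measurable f -> bounded_measurable g ->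
  bounded_measurable (fun q => psi (f q) * g q ^+ 2) ->
  psi (dil_semigroup s f p) * dil_semigroup s g p ^+ 2 <=
  dil_semigroup s (fun q => psi (f q) * g q ^+ 2) p.
Proof.
move=> psi0 ck dpsi If Im bf bg bh.
set m := dil_semigroup s f p in Im *; set V := dil_semigroup s g p.
pose k u : R := - 1 / psi u.
have [d dk] : exists d, is_derive m 1 k d.
  exists ('D_1 k m); apply: DeriveDef => //.
  apply: derivableM; first exact: derivable_cst.
  by apply: derivableV; [rewrite gt_eqF// psi0|exact: dpsi].
(* An affine minorant in (f, g) whose mean is the left-hand side. Completing the square gives
   [psi u * v ^ 2 >= 2 c v + c ^ 2 k u], and [k u] lies above its tangent at the mean [m]; averaging
   leaves [2 c V + c ^ 2 k m = psi m * V ^ 2]. *)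
pose c := psi m * V.
pose G q := 2 * c * g q + (c ^+ 2 * d * f q + c ^+ 2 * (k m - d * m)).
have b1 := bounded_measurableZ (2 * c) g bg.
have b2 := bounded_measurableZ (c ^+ 2 * d) f bf.
have b3 := bounded_measurable_cst (c ^+ 2 * (k m - d * m)).
have b4 := bounded_measurableD _ _ b2 b3.
have EG : dil_semigroup s G p = psi m * V ^+ 2.
  rewrite /G (dil_semigroupD hk0 s _ _ p b1 b4) (dil_semigroupD hk0 s _ _ p b2 b3).
  rewrite (dil_semigroupZ hk0 s _ _ p bg) (dil_semigroupZ hk0 s _ _ p bf).
  rewrite (dil_semigroup_cst hk0 s (c ^+ 2 * (k m - d * m)) p) -/m -/V /c /k.
  by field; rewrite gt_eqF// psi0.
rewrite -EG; apply: (le_dil_semigroup hk0 s _ _ p (bounded_measurableD _ _ b1 b4) bh) => q.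
have := convex_tangent k I m (f q) d ck Im (If q) dk.
rewrite /G; move: (k m) => km; set u := f q; set v := g q.
have p0 := psi0 u (If q); rewrite /k => H.
have H2 : c ^+ 2 * (km + d * (u - m)) <= c ^+ 2 * (- 1 / psi u) by rewrite ler_wpM2l// sqr_ge0.
have H3 : 0 <= (psi u * v - c) ^+ 2 / psi u by rewrite divr_ge0// ?sqr_ge0// ltW.
have E : (psi u * v - c) ^+ 2 / psi u = psi u * v ^+ 2 - 2 * c * v - c ^+ 2 * (- 1 / psi u).
  by field; rewrite gt_eqF.
by rewrite E in H3; rewrite /=; lra.
Qed.

End semigroup_calculus.

(** * Composition with [phi] and the final comparison *)

Section convex_function_of_test_function.
Context {R : realType}.
Implicit Types (phi : R -> R) (I : set R).

Lemma smooth_on_derive1n I phi n (u : R) : smooth_on I phi -> I u ->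
  is_derive u 1 (derive1n n phi) (derive1n n.+1 phi u).
Proof.
by move=> sphi Iu; apply: DeriveDef; [exact: sphi|rewrite derive1nS derive1E].
Qed.

(** The common differentiation rule for [w]: [U] is the identity for the time derivative and the
    constant [s] for derivatives in space. *)
Lemma is_derive_lin (k c e : R) (A B U H : R -> R) (a b u h D : R) :
  is_derive e 1 A a -> is_derive e 1 B b -> is_derive e 1 U u -> is_derive e 1 H h ->
  D = a - b - c * (u * H e + U e * h) ->
  is_derive e 1 (fun e => k + A e - B e - c * (U e * H e)) D.
Proof.
move=> dA dB dU dH ->.
by apply: is_derive_eq; rewrite /GRing.scale/=; ring.
Qed.

Lemma continuous_derive1n_comp I phi n (f : heis R -> R) : smooth_on I phi ->
  (forall p, I (f p)) -> continuous f -> continuous (fun p => derive1n n phi (f p)).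
Proof.
move=> sphi If cf p; apply: (cvg_comp f (derive1n n phi)); first exact: cf.
apply: differentiable_continuous; apply/derivable1_diffP.
exact: sphi.
Qed.

(** The value 0 is attained off the support, hence lies in [I], and the extreme values of [f] are
    attained. Averages of [f] thus stay in a closed interval with endpoints in [I], where [phi] is
    under control. *)
Lemma Cc_infty_range I (f : heis R -> R) : Cc_infty I f ->
  exists K a b, [/\ forall p, K < `|p| -> f p = 0, I 0, I a, I b & forall p, a <= f p <= b].
Proof.
move=> [sf cf If].
have [K [_ HK]] := compact_bounded cf.
have f0 p : `|K| + 1 < `|p| -> f p = 0.
  move=> Kp; apply/eqP; apply/negP => /negP fp.
  have : `|p| <= `|K| + 1.
    by apply: HK; [have := ler_norm K; lra|exact: subset_closure].
  lra.
(* Large enough for the box to contain a zero of [f], namely (N, 0, 0), so that extrema over the box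
   are global. *)
pose N := `|K| + 2; have K0 := normr_ge0 K.
have N0 : 0 <= N by rewrite /N; lra.
have Nout p : ~ hbounded N p -> f p = 0.
  move=> nb; apply: f0; rewrite ltNge; apply/negP => pK; apply: nb.
  by apply/(hboundedP N p N0); rewrite /N; lra.
have pN : hbounded N ((N, 0, 0) : heis R).
  by split; rewrite /= ?normr0// ger0_norm.
have fN : f (N, 0, 0) = 0.
  apply: f0; have [+ _ _] := hbounded_norm ((N, 0, 0) : heis R).
  by rewrite /= ger0_norm// /N; lra.
have cNf : {within [set p : heis R | hbounded N p], continuous f}.
  by apply: continuous_subspaceT; exact: smooth_continuous.
have ne : [set p : heis R | hbounded N p] !=set0 by exists (N, 0, 0).
have [q1 _ H1] := compact_EVT_min ne (compact_hbounded N) cNf.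
have [q2 _ H2] := compact_EVT_max ne (compact_hbounded N) cNf.
exists (`|K| + 1), (f q1), (f q2); split => //; first by rewrite -fN.
move=> p; have [pb|/Nout ->] := pselect (hbounded N p).
  by rewrite H1 ?inE//= H2 ?inE.
by rewrite -fN H1 ?inE//= H2 ?inE.
Qed.

End convex_function_of_test_function.

Theorem theorem6p1 (R : realType) (C1 : R)
    (hC1 : smallest_gradient_constant C1)
    (I : set R) (I_open : open I) (I_itv : is_interval I)
    (phi : R -> R) (phi_smooth : smooth_on I phi)
    (phi_convex : convex_function I phi)
    (phi2_pos : forall u, I u -> 0 < derive1n 2 phi u)
    (phi2_convex : convex_function I (fun u : R => - 1 / derive1n 2 phi u))
    (t : R) (t_ge0 : 0 <= t) (x : R * R * R)
    (f : R * R * R -> R) (hf : Cc_infty I f) :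
  heat_semigroup t (fun y => phi (f y)) x - phi (heat_semigroup t f x) <=
  C1 ^+ 2 * t * heat_semigroup t (fun y => derive1n 2 phi (f y) * grad_norm f y ^+ 2) x.
Proof.
have gC := hC1.1; have C1_ge1 := gradient_bound_ge1 C1 gC.
have hk0 := heat_kernel_ge0 C1 gC.
have [K [a [b [f0 I0 Ia Ib fab]]]] := Cc_infty_range I f hf.
have [sf _ If] := hf; have cf := smooth_continuous f sf.
have cphi : continuous (fun p => phi (f p)).
  exact: (continuous_derive1n_comp I phi 0 f phi_smooth If cf).
have cpsi := continuous_derive1n_comp I phi 2 f phi_smooth If cf.
have cg := continuous_grad_norm f sf.
pose F p := phi (f p) - phi 0; pose h p := derive1n 2 phi (f p) * grad_norm f p ^+ 2.
have [Mf bsf] := continuous_bounded_support f K cf f0.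
have [Mg bsg] := continuous_bounded_support (grad_norm f) K cg (grad_norm_eq0 f K f0).
have cF : continuous F by move=> p; apply: cvgB; [exact: cphi|exact: cvg_cst].
have [MF bsF] : exists M, bounded_support M F.
  by apply: (continuous_bounded_support F K cF) => p /f0 fp; rewrite /F fp subrr.
have ch : continuous h.
  by move=> p; apply: cvgM; [exact: cpsi|exact: (cvgM (cg p) (cg p))].
have [Mh bsh] : exists M, bounded_support M h.
  apply: (continuous_bounded_support h K ch) => p /(grad_norm_eq0 f K f0) gp.
  by rewrite /h gp expr0n/= mulr0.
have bf := bounded_support_measurable _ _ bsf.
have bg := bounded_support_measurable _ _ bsg.
have bF := bounded_support_measurable _ _ bsF.
have bh := bounded_support_measurable _ _ bsh.
pose S (s : R) (G : R * R * R -> R) p := dil_semigroup s G p.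
have Srange s p : a <= S s f p <= b by exact: (dil_semigroup_itv hk0).
have SI s p : I (S s f p) by exact: (I_itv a b).
have S0 G p : bounded_measurable G -> S 0 G p = G p.
  by move=> bG; rewrite /S -(heat_semigroup_dilE hk0)// /heat_semigroup eqxx.
have Sh0 s p : 0 <= S s h p.
  rewrite -(dil_semigroup_cst hk0 s 0 p); apply: (le_dil_semigroup hk0) => //.
    exact: bounded_measurable_cst.
  by move=> q; rewrite /h mulr_ge0 ?sqr_ge0// ltW// phi2_pos.
have SF_le s p : S s F p <= MF.
  have : - MF <= S s F p <= MF; last by case/andP.
  apply: (dil_semigroup_itv hk0) => // q.
  by have [_ FM _] := bsF; rewrite -ler_norml; exact: FM.
pose w (s : R) p := phi 0 + S s F p - phi (S s f p) - C1 ^+ 2 * (s * S s h p).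
suff : w t x <= 0.
  have -> : heat_semigroup t (fun y => phi (f y)) x = phi 0 + S t F x.
    have E : (fun y => phi (f y)) = (fun y => cst (phi 0) y + F y).
      by apply/funext => y; rewrite /F/= addrC subrK.
    have bc := bounded_measurable_cst (phi 0).
    rewrite E (heat_semigroup_dilE hk0)//; last exact: (bounded_measurableD _ _ bc bF).
    by rewrite (dil_semigroupD hk0 t _ _ x bc bF) dil_semigroup_cst.
  rewrite (heat_semigroup_dilE hk0 t f)// (heat_semigroup_dilE hk0 t h)//.
  rewrite /w /S; lra.
(* The upper bound for [w] comes from the tangent of [phi] at 0: [phi 0 - phi (P_s f)] is at most
   [- phi'(0) P_s f], and the term with [C1 ^ 2] is subtracted and nonnegative. *)
apply: (weak_maximum_principle t (MF + `|derive1n 1 phi 0| * Mf) w x t_ge0).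
- move=> sp.
  have cS G M : continuous G -> bounded_support M G ->
      {for sp, continuous (fun sp : R * heis R => S sp.1 G sp.2)}.
    by move=> cG [_ GM _]; exact: (continuous_dil_semigroup hk0 G M cG GM).
  have cSf := cS f Mf cf bsf; have cSF := cS F MF cF bsF; have cSh := cS h Mh ch bsh.
  apply: cvgB; first apply: cvgB.
  + by apply: cvgD; [exact: cvg_cst|exact: cSF].
  + have cphiS : {for S sp.1 f sp.2, continuous phi}.
      apply: differentiable_continuous.
      by apply/derivable1_diffP; exact: (phi_smooth 0%N).
    exact: (cvg_comp _ phi cSf cphiS).
  + apply: cvgM; first exact: cvg_cst.
    by apply: cvgM; [exact: cvg_fst|exact: cSh].
- by move=> q; rewrite /w mul0r mulr0 subr0 !S0// /F; lra.
- move=> s q /andP[s0 _].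
  have tangent := convex_tangent phi I 0 (S s f q) _ phi_convex I0 (SI s q)
    (smooth_on_derive1n I phi 0 0 phi_smooth I0).
  have Sf_le : `|S s f q| <= Mf.
    have [_ fM _] := bsf; rewrite ler_norml; apply: (dil_semigroup_itv hk0) => // r.
    by rewrite -ler_norml; exact: fM.
  have : `|derive1n 1 phi 0 * S s f q| <= `|derive1n 1 phi 0| * Mf.
    by rewrite normrM ler_wpM2l.
  rewrite ler_norml => /andP[+ _].
  have : 0 <= C1 ^+ 2 * (s * S s h q) by exact: (mulr_ge0 (sqr_ge0 _) (mulr_ge0 s0 (Sh0 s q))).
  move: tangent (SF_le s q); rewrite subr0 /w; lra.
move=> s q /andP[s0 _].
pose e1 (G : R * R * R -> R) (v : R * R * R) (e : R) := sg1 G s (q + e *: v) v.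
pose gr (v : R * R * R) (e : R) := e1 F v e - derive1n 1 phi (S s f (q + e *: v)) * e1 f v e
  - C1 ^+ 2 * (s * e1 h v e).
(* The chain rule contributes the square of the first derivative of [P_s f]; summed over [vX] and
   [vY] it yields the squared gradient, the only space term that the heat equations leave over. *)
pose hs (v : R * R * R) := sg2 F s q v
  - (derive1n 2 phi (S s f q) * sg1 f s q v ^+ 2 + derive1n 1 phi (S s f q) * sg2 f s q v)
  - C1 ^+ 2 * (s * sg2 h s q v).
have d1 v (e : R) : is_derive e 1 (fun e : R => w s (q + e *: v)) (gr v e).
  have hF := is_derive_dil_line hk0 MF F s q v e bsF s0.
  have hh := is_derive_dil_line hk0 Mh h s q v e bsh s0.
  have hf1 := is_derive_dil_line hk0 Mf f s q v e bsf s0.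
  have hphi : is_derive e 1 (fun e : R => phi (dil_semigroup s f (q + e *: v)))
      (derive1n 1 phi (S s f (q + e *: v)) * sg1 f s (q + e *: v) v).
    exact: (@is_derive1_comp R phi (fun e : R => S s f (q + e *: v)) e _ _
      (smooth_on_derive1n I phi 0 _ phi_smooth (SI s _)) hf1).
  apply: (is_derive_lin _ _ _ _ _ (fun=> s) _ _ _ _ _ _ hF hphi (is_derive_cst s e 1) hh).
  by rewrite mul0r add0r.
have d2 v : is_derive (0 : R) 1 (gr v) (hs v).
  have hF := is_derive_sg1 MF F s q v 0 bsF s0.
  have hh := is_derive_sg1 Mh h s q v 0 bsh s0.
  have hf1 := is_derive_sg1 Mf f s q v 0 bsf s0.
  have hl := is_derive_dil_line hk0 Mf f s q v 0 bsf s0.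
  have hphi : is_derive (0 : R) 1 (fun e : R => derive1n 1 phi (dil_semigroup s f (q + e *: v)))
      (derive1n 2 phi (S s f (q + (0 : R) *: v)) * sg1 f s (q + (0 : R) *: v) v).
    exact: (@is_derive1_comp R (derive1n 1 phi) (fun e : R => S s f (q + e *: v)) 0 _ _
      (smooth_on_derive1n I phi 1 _ phi_smooth (SI s _)) hl).
  have hprod := is_deriveM hphi hf1.
  have {}hprod : is_derive (0 : R) 1 (fun e : R =>
      derive1n 1 phi (S s f (q + e *: v)) * e1 f v e)
      (derive1n 2 phi (S s f q) * sg1 f s q v ^+ 2 + derive1n 1 phi (S s f q) * sg2 f s q v).
    apply: is_derive_eq hprod _; rewrite scale0r addr0 /GRing.scale/= /S; ring.
  rewrite (_ : gr v = fun e => 0 + e1 F v e - derive1n 1 phi (S s f (q + e *: v)) * e1 f v e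
    - C1 ^+ 2 * (s * e1 h v e)); last by apply/funext => e; rewrite add0r.
  have hs0 : is_derive (0 : R) 1 (fun=> s : R) 0 by exact: is_derive_cst.
  apply: (is_derive_lin 0 (C1 ^+ 2) 0 (e1 F v) _ (fun=> s) (e1 h v) _ _ _ _ _ hF hprod hs0 hh).
  by rewrite /hs mul0r add0r scale0r addr0.
have dt : is_derive s 1 (w^~ q) (sgS F s q - derive1n 1 phi (S s f q) * sgS f s q
    - C1 ^+ 2 * (S s h q + s * sgS h s q)).
  have hF := is_derive_dil_time hk0 MF F s q bsF s0.
  have hh := is_derive_dil_time hk0 Mh h s q bsh s0.
  have hf1 := is_derive_dil_time hk0 Mf f s q bsf s0.
  have hphi : is_derive s 1 (fun s : R => phi (dil_semigroup s f q))
      (derive1n 1 phi (S s f q) * sgS f s q).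
    exact: (@is_derive1_comp R phi (fun s => S s f q) s _ _
      (smooth_on_derive1n I phi 0 _ phi_smooth (SI s _)) hf1).
  apply: (is_derive_lin _ _ _ _ _ id _ _ _ _ _ _ hF hphi (is_derive_id s 1) hh).
  by rewrite mul1r.
exists (sgS F s q - derive1n 1 phi (S s f q) * sgS f s q
    - C1 ^+ 2 * (S s h q + s * sgS h s q)), (gr (vX q)), (hs (vX q)), (gr (vY q)), (hs (vY q)).
split => //.
rewrite (sg_heat MF F s q bsF s0) (sg_heat Mf f s q bsf s0) (sg_heat Mh h s q bsh s0).
have grad := grad_norm_heat_semigroup hk0 Mf f s q bsf s0.
have bound := gC s f q (ltW s0) (bounded_support_poly_growth f K sf f0).
have jensen := dil_semigroup_jensen hk0 I (derive1n 2 phi) s q f (grad_norm f)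
  phi2_pos phi2_convex (phi_smooth 2%N) If (SI s q) bf bg bh.
rewrite (heat_semigroup_dilE hk0 s (grad_norm f) q (ltW s0) bg) in bound.
(* Squaring is legitimate because the right side of the gradient bound dominates a nonnegative
   quantity. The factor [C1 ^ 2] in the theorem comes from here. *)
have bound2 : grad_norm (heat_semigroup s f) q ^+ 2 <=
    (C1 * dil_semigroup s (grad_norm f) q) ^+ 2.
  by rewrite ler_sqr ?nnegrE ?grad_norm_ge0// (le_trans _ bound) ?grad_norm_ge0.
have psi0 := phi2_pos _ (SI s q).
have key : derive1n 2 phi (S s f q) * (sg1 f s q (vX q) ^+ 2 + sg1 f s q (vY q) ^+ 2) <=
    C1 ^+ 2 * S s h q.
  rewrite -grad; apply: (le_trans (ler_wpM2l (ltW psi0) bound2)).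
  by rewrite exprMn mulrCA; apply: (ler_wpM2l (sqr_ge0 _)).
rewrite /hs; lra.
Qed.
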